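(* Assume the following. (a) (Weak $B$-condition) There are a strictly positive self-adjoint $B\in L(H)$ with $A^*B\in L(H)$ and $c_0\ge0$ such that $-A^*B+c_0B\ge0$. (b) $l$ is continuous on $H\times\Lambda_0$ and there is $C>0$ such that $|l(x,a)-l(x',a)|\le C\|x-x'\|_{-1}$, $|l(x,a)|\le C(1+\|x\|_H+\|a\|_\Lambda^2)$ and $|g(x)-g(x')|\le C\|x-x'\|_{-1}$ for all $x,x'\in H$, $a\in\Lambda_0$; moreover, if $\Lambda_0$ is unbounded, $l$ and $g$ are bounded from below. (c) $b,\sigma$ extend to affine and continuous functions $b:H_{-1}\times\Lambda\to H$ and $\sigma:H_{-1}\times\Lambda\to L_2(\Xi,H)$. (d) $l:H\times\Lambda_0\to\mathbb R$ and $g:H\to\mathbb R$ are convex. Then, for every $t\in[0,T]$, the function $V(t,\cdot)$ is convex.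
   Context: $H$ and $\Xi$ are real separable Hilbert spaces, $\Lambda$ is a real separable Banach space, $\Lambda_0\subset\Lambda$ is convex, $p>2$ and $0<T<\infty$ are fixed. $L(H)$ denotes bounded linear operators on $H$, $L_2(\Xi,H)$ Hilbert--Schmidt operators. For $C\in L(H)$, $C\ge0$ means $\langle Cx,x\rangle_H\ge0$ for all $x$; a self-adjoint $B$ is strictly positive if $\langle Bx,x\rangle_H>0$ for $x\neq0$; $\|x\|_{-1}^2:=\langle Bx,x\rangle_H$ and $H_{-1}$ is the completion of $H$ in this norm. $A:\mathcal D(A)\subset H\to H$ is linear, densely defined and maximal dissipative; it generates a $C_0$-semigroup of contractions $(\mathrm e^{sA})_{s\ge 0}$. The coefficients are $b:H\times\Lambda\to H$, $\sigma:H\times\Lambda\to L_2(\Xi,H)$, $l:H\times\Lambda\to\mathbb R$, $g:H\to\mathbb R$. For $t\in[0,T]$, a reference probability space $(\Omega,\mathscr F,(\mathscr F^t_s)_{s\in[t,T]},\mathbb P,(W(s))_{s\in[t,T]})$ is fixed: $(\Omega,\mathscr F,\mathbb P)$ is complete, $W$ is a cylindrical Wiener process in $\Xi$ with $W(t)=0$ $\mathbb P$-a.s., and $\mathscr F^t_s$ is generated by $\{W(\tau):t\le\tau\le s\}$ and the $\mathbb P$-null sets. $\mathcal U_t$ is the set of all $\mathscr F^t_s$-progressively measurable $a(\cdot):[t,T]\times\Omega\to\Lambda_0$ with $\mathbb E\int_t^T\|a(s)\|_\Lambda^p\,\mathrm ds<\infty$. $X(\cdot;t,x,a(\cdot))$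 is the mild solution with continuous trajectories of $\mathrm dX(s)=[AX(s)+b(X(s),a(s))]\mathrm ds+\sigma(X(s),a(s))\mathrm dW(s)$, $X(t)=x$, i.e. $X(s)=\mathrm e^{(s-t)A}x+\int_t^s\mathrm e^{(s-r)A}b(X(r),a(r))\mathrm dr+\int_t^s\mathrm e^{(s-r)A}\sigma(X(r),a(r))\mathrm dW(r)$. Further $J(t,x;a(\cdot))=\mathbb E\big[\int_t^T l(X(s),a(s))\mathrm ds+g(X(T))\big]$ with $X(s)=X(s;t,x,a(\cdot))$, and the value function is $V(t,x)=\inf_{a(\cdot)\in\mathcal U_t}J(t,x;a(\cdot))$. *)

(* Defs.v *)
From HB Require Import structures.
From mathcomp Require Import all_boot all_order all_algebra.
From mathcomp Require Import all_classical all_reals all_analysis.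
Set Implicit Arguments.
Unset Strict Implicit.
Unset Printing Implicit Defensive.
Import Order.TTheory GRing.Theory Num.Theory.
Import numFieldNormedType.Exports.
Local Open Scope classical_set_scope.
Local Open Scope ring_scope.

Definition separable (T : topologicalType) : Prop :=
  exists2 D : set T, countable D & dense D.

(* A real Hilbert space is a complete normed module whose norm comes from the
   inner product [ip]. *)
Definition norm_from_dot (R : realType) (H : normedModType R)
    (ip : {dot H for (@idfun R)}) : Prop :=
  forall x : H, `|x| ^+ 2 = ip x x.

Section UnboundedOperators.
Variables (R : realType) (H : completeNormedModType R).
Variable ip : {dot H for (@idfun R)}.

(* Unbounded operators are pairs (domain, total function); the values of the
   function outside the domain are never used. *)
Definition linear_on (D : set H) (A : H -> H) : Prop :=
  D 0 /\
  forall (k : R) x y, D x -> D y ->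
    D (k *: x + y) /\ A (k *: x + y) = k *: A x + A y.

Definition dissipative (D : set H) (A : H -> H) : Prop :=
  forall x, D x -> ip (A x) x <= 0.

Definition maximal_dissipative (D : set H) (A : H -> H) : Prop :=
  dissipative D A /\
  forall (D' : set H) (A' : H -> H),
    linear_on D' A' -> dissipative D' A' ->
    D `<=` D' -> (forall x, D x -> A' x = A x) -> D' `<=` D.

(* y belongs to the domain of the adjoint of A, and z is its image. *)
Definition adjoint_at (D : set H) (A : H -> H) (y z : H) : Prop :=
  forall x, D x -> ip (A x) y = ip x z.

Definition contraction_semigroup (S : R -> {linear H -> H}) : Prop :=
  [/\ forall x, S 0 x = x,
      forall s r x, 0 <= s -> 0 <= r -> S (s + r) x = S s (S r x),
      forall x, S h x @[h --> 0^'+] --> x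
    & forall s x, 0 <= s -> `|S s x| <= `|x| ].

Definition generates (D : set H) (A : H -> H) (S : R -> {linear H -> H}) : Prop :=
  forall x y,
    (D x /\ A x = y) <-> (h^-1 *: (S h x - x) @[h --> 0^'+] --> y).

Definition self_adjoint (B : H -> H) : Prop :=
  forall x y, ip (B x) y = ip x (B y).

Definition strictly_positive (B : H -> H) : Prop :=
  forall x, x != 0 -> 0 < ip (B x) x.

Definition nonneg_operator (C : H -> H) : Prop := forall x, 0 <= ip (C x) x.

Definition normm1 (B : H -> H) (x : H) : R := Num.sqrt (ip (B x) x).

(* (H1, iota) is the completion of H in the norm [normm1 B]. *)
Definition is_completion_m1 (B : H -> H) (H1 : completeNormedModType R)
    (iota : {linear H -> H1}) : Prop :=
  (forall x, `|iota x| = normm1 B x) /\ dense (range iota).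

End UnboundedOperators.

Definition affine (R : realType) (U V : lmodType R) (f : U -> V) : Prop :=
  forall (k : R) x y, f (k *: x + (1 - k) *: y) = k *: f x + (1 - k) *: f y.

Section HilbertSchmidt.
Variables (R : realType) (Xi H : completeNormedModType R).
Variable ipXi : {dot Xi for (@idfun R)}.

Definition orthonormal_basis (E : set Xi) : Prop :=
  [/\ forall e, E e -> ipXi e e = 1,
      forall e f, E e -> E f -> e != f -> ipXi e f = 0
    & forall x, (forall e, E e -> ipXi e x = 0) -> x = 0 ].

Variable E : set Xi.

Definition HS_norm2 (T : Xi -> H) : \bar R :=
  (\esum_(e in E) (`|T e| ^+ 2)%:E)%E.

Definition hilbert_schmidt (T : Xi -> H) : Prop :=
  [/\ linear T, continuous T & (HS_norm2 T < +oo)%E].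

Definition HS_continuous (U : topologicalType) (f : U -> Xi -> H) : Prop :=
  forall z, HS_norm2 (fun xi => f z' xi - f z xi) @[z' --> z] --> 0%E.

End HilbertSchmidt.

Section BochnerIntegral.
Variables (R : realType) (H : completeNormedModType R).
Local Notation mu := (@lebesgue_measure R).

Definition simple_eval (f : seq (set R * H)) (r : R) : H :=
  \sum_(Ay <- f) (\1_(Ay.1) r : R) *: Ay.2.

Definition simple_integral (D : set R) (f : seq (set R * H)) : H :=
  \sum_(Ay <- f) fine (mu (D `&` Ay.1)) *: Ay.2.

(* For H separable: f is Bochner integrable on D, with integral y. *)
Definition is_bochner_integral (D : set R) (f : R -> H) (y : H) : Prop :=
  (forall U : set H, open U -> measurable (D `&` f @^-1` U)) /\
  exists fn : nat -> seq (set R * H),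
    [/\ forall n Ay, Ay \in fn n -> measurable Ay.1,
        (\int[mu]_(r in D) (`|f r - simple_eval (fn n) r|)%:E)%E
          @[n --> \oo] --> 0%E
      & simple_integral D (fn n) @[n --> \oo] --> y ].

End BochnerIntegral.

Section Processes.
Variables (R : realType) (d : measure_display) (Omega : measurableType d).
Variable P : probability Omega R.
Local Notation mu := (@lebesgue_measure R).

Definition borel_measurable (E : topologicalType) (Y : Omega -> E) : Prop :=
  forall U : set E, <<s @open E >> U -> measurable (Y @^-1` U).

Definition progressive (t T : R) (F : R -> set (set Omega))
    (E : topologicalType) (Y : R -> Omega -> E) : Prop :=
  forall s, t <= s <= T -> forall U : set E, <<s @open E >> U ->
    <<s `[t, s] `*` setT,
        [set C | exists I G, [/\ measurable I, I `<=` `[t, s], F s G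
                              & C = I `*` G]] >>
      ((`[t, s] `*` setT) `&` [set z | U (Y z.1 z.2)]).

Variables (Xi : completeNormedModType R).
Variable ipXi : {dot Xi for (@idfun R)}.

(* A cylindrical Wiener process is a family W s xi of real random variables,
   formally <W(s), xi>. *)
Variable W : R -> Xi -> Omega -> R.

Definition wiener_filtration (t s : R) : set (set Omega) :=
  <<s [set A | exists r xi (U : set R),
         [/\ t <= r <= s, measurable U & A = W r xi @^-1` U]]
      `|` [set N | P.-negligible N] >>.

Definition increment (s r : R) (xi : Xi) (w : Omega) : R := W r xi w - W s xi w.

Record cylindrical_wiener (t T : R) : Prop := CylindricalWiener {
  cw_measurable : forall s xi, t <= s <= T -> measurable_fun setT (W s xi);
  cw_linear : forall s (k : R) xi eta, t <= s <= T ->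
    {ae P, forall w, W s (k *: xi + eta) w = k * W s xi w + W s eta w};
  cw_start : forall xi, {ae P, forall w, W t xi w = 0};
  cw_continuous : forall xi,
    {ae P, forall w, {within `[t, T], continuous (fun s => W s xi w)}};
  (* the law is N(0, (r - s) |xi|^2): normal_prob takes the standard deviation *)
  cw_gaussian : forall s r xi (U : set R),
    t <= s -> s < r -> r <= T -> xi != 0 -> measurable U ->
    P (increment s r xi @^-1` U) =
      normal_prob 0 (Num.sqrt (r - s) * `|xi|) U;
  cw_independent : forall s r xi (U : set R) (A : set Omega),
    t <= s -> s < r -> r <= T -> measurable U -> wiener_filtration t s A ->
    (P (A `&` increment s r xi @^-1` U)
     = P A * P (increment s r xi @^-1` U))%E }.

Variable H : completeNormedModType R.
Variable E : set Xi.

(* The L_2(Xi, H)-valued elementary process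
   1_(lo, hi](r) 1_ev(w) <xi, .> h. *)
Record elementary := Elementary {
  el_lo : R; el_hi : R; el_ev : set Omega; el_xi : Xi; el_h : H }.

(* classical equality, only used to write e \in es for es : seq elementary *)
HB.instance Definition _ := gen_eqMixin elementary.

Definition elementary_ok (t s : R) (e : elementary) : Prop :=
  [/\ t <= el_lo e, el_lo e <= el_hi e, el_hi e <= s
    & wiener_filtration t (el_lo e) (el_ev e)].

Definition elementary_eval (e : elementary) (r : R) (w : Omega) (xi : Xi) : H :=
  ((\1_(`]el_lo e, el_hi e]) r : R) * (\1_(el_ev e) w : R) * ipXi (el_xi e) xi)
    *: el_h e.

Definition elementary_integral (e : elementary) (w : Omega) : H :=
  ((\1_(el_ev e) w : R) * increment (el_lo e) (el_hi e) (el_xi e) w)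
    *: el_h e.

Definition step_eval (es : seq elementary) (r : R) (w : Omega) (xi : Xi) : H :=
  \sum_(e <- es) elementary_eval e r w xi.

Definition step_integral (es : seq elementary) (w : Omega) : H :=
  \sum_(e <- es) elementary_integral e w.

(* I is (a version of) the Ito integral over [t, s] of the L_2(Xi, H)-valued
   process Phi, square integrable on [t, s] x Omega: the L^2-limit of the
   integrals of sums of elementary processes approximating Phi. *)
Definition is_ito_integral (t s : R) (Phi : R -> Omega -> Xi -> H)
    (I : Omega -> H) : Prop :=
  [/\ forall xi, progressive t s (wiener_filtration t) (fun r w => Phi r w xi),
      borel_measurable I
    & exists en : nat -> seq elementary,
      [/\ forall n e, e \in en n -> elementary_ok t s e,
          (\int[P]_w \int[mu]_(r in `[t, s])
             HS_norm2 E (fun xi => (Phi r w xi - step_eval (en n) r w xi)%R))%E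
            @[n --> \oo] --> 0%E
        & (\int[P]_w (`|I w - step_integral (en n) w| ^+ 2)%:E)%E
            @[n --> \oo] --> 0%E ] ].

Variable Lambda : completeNormedModType R.

Definition admissible (p t T : R) (Lambda0 : set Lambda)
    (a : R -> Omega -> Lambda) : Prop :=
  [/\ progressive t T (wiener_filtration t) a,
      forall s w, t <= s <= T -> Lambda0 (a s w)
    & (\int[P]_w \int[mu]_(s in `[t, T]) (`|a s w| `^ p)%:E < +oo)%E ].

(* Solutions are taken among the processes that are square integrable on
   [t, T] x Omega, so that for coefficients of linear growth and controls as in
   [admissible] the integrand of the Ito integral is square integrable. *)
Definition mild_solution (S : R -> {linear H -> H}) (b : H -> Lambda -> H)
    (sigma : H -> Lambda -> Xi -> H) (t T : R) (x : H)
    (a : R -> Omega -> Lambda) (X : R -> Omega -> H) : Prop :=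
  [/\ progressive t T (wiener_filtration t) X,
      {ae P, forall w, {within `[t, T], continuous (fun s => X s w)}},
      (\int[P]_w \int[mu]_(s in `[t, T]) (`|X s w| ^+ 2)%:E < +oo)%E
    & forall s, t <= s <= T -> exists I1 I2 : Omega -> H,
      [/\ {ae P, forall w, is_bochner_integral `[t, s]
                   (fun r => S (s - r) (b (X r w) (a r w))) (I1 w)},
          is_ito_integral t s
            (fun r w xi => S (s - r) (sigma (X r w) (a r w) xi)) I2
        & {ae P, forall w, X s w = S (s - t) x + I1 w + I2 w} ] ].

Definition cost (l : H -> Lambda -> R) (g : H -> R) (t T : R)
    (a : R -> Omega -> Lambda) (X : R -> Omega -> H) : \bar R :=
  (\int[P]_w ((\int[mu]_(s in `[t, T]) (l (X s w) (a s w))%:E)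
               + (g (X T w))%:E))%E.

(* X x a stands for X(.; t, x, a). *)
Definition value (p t T : R) (Lambda0 : set Lambda) (l : H -> Lambda -> R)
    (g : H -> R) (X : H -> (R -> Omega -> Lambda) -> R -> Omega -> H) (x : H) :
    \bar R :=
  ereal_inf [set cost l g t T a (X x a) | a in admissible p t T Lambda0].

End Processes.

Definition ereal_convex (R : realType) (V : lmodType R) (f : V -> \bar R) : Prop :=
  forall x y (k : R), 0 <= k <= 1 ->
    (f (k *: x + (1 - k) *: y)%R <= k%:E * f x + (1 - k)%:E * f y)%E.

(* Main.v *)
Require Import Defs.
From HB Require Import structures.
From mathcomp Require Import all_boot all_order all_algebra.
From mathcomp Require Import all_classical all_reals all_analysis.
From mathcomp Require Import measurable_realfun lra ring.
Set Implicit Arguments.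
Unset Strict Implicit.
Unset Printing Implicit Defensive.
Import Order.TTheory GRing.Theory Num.Theory.
Import numFieldNormedType.Exports.
Local Open Scope classical_set_scope.
Local Open Scope ring_scope.

(* Let k in [0, 1] and let X1, X2 be the solutions for the data (x1, a1),
   (x2, a2).  As b and sigma are affine, k X1 + (1 - k) X2 is again a mild
   solution, for the initial point k x1 + (1 - k) x2 and the control
   k a1 + (1 - k) a2.  Affine continuous maps are Lipschitz, and
   |x|_{-1} <= C |x|, so b and sigma are Lipschitz in x for the norm of H; mild
   solutions are therefore unique, by a second moment estimate and Gronwall's
   lemma, and k X1 + (1 - k) X2 is a version of the solution for the averaged
   data.  Convexity of l and g bounds its cost by the average of the two costs,
   and it remains to take the infimum over a1 and a2.

   The second moment estimate for the stochastic integral is derived from the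
   definition: the centred, independent Gaussian increments of W give the
   covariances of elementary integrals, and Parseval's identity compares the
   resulting Gram sums with Hilbert-Schmidt norms. *)

(** * Measurability with respect to a system of sets *)

(** Costs are extended reals, so comparing them requires integrability. For the terminal cost this
    means a second moment at time [T], which square integrability over [[t, T] x Omega] does not
    contain; it is extracted from the mild equation and the linear growth of [b] and [sigma], while
    [2 < p] supplies second moments of the controls. Linearity and contractivity of the semigroup
    strip it from both integrands. The drift integral is not known to be measurable in [w], so it is
    estimated path by path, and the stochastic integral in mean. Uniqueness gives equality almost
    surely at each fixed time; Tonelli's theorem turns this into equality at almost every time on
    almost every path, enough for the running cost, and the terminal time is treated apart. Sums and
    pairs of vector-valued measurable maps are measurable because separability makes every open set
    of a product a countable union of boxes. Passing to infima divides by the weights, so the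
    weights 0 and 1, and the case of no admissible control, are separated. *)

Lemma separable_dense_seq (R : realType) (V : normedModType R) :
  separable V -> exists u : nat -> V, forall x e, 0 < e -> exists n, `|x - u n| < e.
Proof.
move=> [D cD dD].
have D0 : D !=set0.
  by have [x [_ Dx]] := dD setT (ex_intro _ 0 I) openT; exists x.
have [u uD] : exists u : nat -> V, D `<=` range u.
  case: D0 => x0 Dx0; have /pcard_leTP/unsquash := cD => f.
  exists (fun n => 'pinv_(fun=> x0) D f n) => x Dx.
  by exists (f x) => //; rewrite pinvKV ?inE //; exact: in1W inj.
exists u => x e e0.
have [y [/= xy Dy]] : (ball x e) `&` D !=set0.
  by apply: dD; [exists x; exact: ballxx | exact: ball_open].
by have [n _ un] := uD _ Dy; exists n; rewrite un; move: xy; rewrite -ball_normE.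
Qed.

Section SetSystemMeasurability.
Variables (T : Type) (D : set T) (M : set (set T)).
Hypothesis sM : sigma_algebra D M.

(** The system [M] is a parameter, so that the same lemmas serve the measurable subsets of a domain
    and the progressive sigma-algebra of a time slab. Testing open sets only makes composition with
    continuous maps immediate. *)
Definition smeasurable (E : topologicalType) (f : T -> E) : Prop :=
  forall U, open U -> M (D `&` f @^-1` U).

Lemma smeasurable_borel (E : topologicalType) (f : T -> E) :
  smeasurable f -> forall U, <<s @open E >> U -> M (D `&` f @^-1` U).
Proof.
case: sM => M0 MC MU mf.
apply: (@smallest_sub _ _ _ [set U | M (D `&` f @^-1` U)]) => //; split.
- by rewrite /= preimage_set0 setI0.
- move=> A /= /MC; rewrite setTD; congr M.
  by apply/seteqP; split=> x /=; tauto.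
- by move=> A /= /MU; rewrite preimage_bigcup setI_bigcupr.
Qed.

Lemma sigma_algebraI2 A B : A `<=` D -> B `<=` D -> M A -> M B -> M (A `&` B).
Proof.
case: sM => M0 MC MU AD BD MA MB.
(* De Morgan's law inside [D], for the sequence equal to [A] at index 0 and to [B] afterwards. *)
have -> : A `&` B = D `\` \bigcup_n (D `\` (if n is 0%N then A else B)).
  apply/seteqP; split=> [x [Ax Bx]|x [Dx nx]].
    by split; [exact: AD | move=> [[|n] _ [_]]].
  split; apply: contrapT => h; apply: nx; first by exists 0%N.
  by exists 1%N.
by apply/MC/MU => -[|n]; exact: MC.
Qed.

Lemma sigma_algebra_countType (I : countType) (A : I -> set T) :
  (forall i, M (A i)) -> M (\bigcup_i A i).
Proof.
case: sM => M0 MC MU MA.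
have -> : \bigcup_i A i =
    \bigcup_n (if @unpickle I n is Some i then A i else set0).
  apply/seteqP; split=> x [i _ Ai]; first by exists (pickle i); rewrite ?pickleK.
  by move: Ai; case: unpickle => // j Aj; exists j.
by apply: MU => n; case: unpickle.
Qed.

Lemma smeasurable_comp (E F : topologicalType) (phi : E -> F) (f : T -> E) :
  continuous phi -> smeasurable f -> smeasurable (phi \o f).
Proof.
by move=> /continuousP cphi mf U /cphi /mf.
Qed.

(** Meant for the running cost [l], whose continuity is given only for controls in [Lambda0]. *)
Lemma smeasurable_within (E F : topologicalType) (A : set E) (phi : E -> F)
    (f : T -> E) : (forall x, D x -> A (f x)) ->
  {within A, continuous phi} -> smeasurable f -> smeasurable (phi \o f).
Proof.
move=> fA /continuousP cphi mf U /cphi /open_subspaceP [V oV VU].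
rewrite (_ : D `&` _ = D `&` f @^-1` V); first exact: mf.
apply/seteqP; split=> x /= [Dx Ux]; split=> //.
  have [] : (V `&` A) (f x) by rewrite VU; split=> //; exact: fA.
  by [].
have [] : (from_subspace A phi @^-1` U `&` A) (f x).
  by rewrite -VU; split=> //; exact: fA.
by [].
Qed.

Lemma smeasurable_cst (E : topologicalType) (c : E) : smeasurable (fun _ : T => c).
Proof.
case: sM => M0 MC MU U oU; have [Uc|Uc] := pselect (U c).
  rewrite (_ : D `&` _ = D `\` set0); first exact: MC.
  by apply/seteqP; split=> x /=; tauto.
by rewrite (_ : D `&` _ = set0) //; apply/seteqP; split=> x // -[].
Qed.

Variable R : realType.

(** An open set of the product is the union of the countably many boxes it contains whose centres
    run through dense sequences and whose radii are [1 / (n + 1)]; the preimage of a box is an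
    intersection of two known sets. *)
Lemma smeasurable_pair (E F : normedModType R) (f : T -> E) (g : T -> F) :
  separable E -> separable F ->
  smeasurable f -> smeasurable g -> smeasurable (fun x => (f x, g x)).
Proof.
move=> /separable_dense_seq [u hu] /separable_dense_seq [v hv] mf mg V oV.
pose B (i : nat * nat * nat) :=
  ball (u i.1.1) i.2.+1%:R^-1 `*` ball (v i.1.2) i.2.+1%:R^-1 : set (E * F).
have VE : V = \bigcup_i (if `[< B i `<=` V >] then B i else set0).
  apply/seteqP; split=> [[x y] Vxy|[x y] [i _]]; last first.
    by case: asboolP => // BV /BV.
  have [e /= e0 eV] : exists2 e : R, 0 < e & ball (x, y) e `<=` V.
    by apply/nbhs_ballP; exact: open_nbhs_nbhs.
  (* Half of [e], because two points of a box are compared through its centre, at the cost of two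
     radii. *)
  have [k ke] : exists k, k.+1%:R^-1 < e / 2.
    have := near_infty_natSinv_lt (PosNum (divr_gt0 e0 (ltr0n _ 2))).
    by case=> k _ hk; exists k; exact: (hk k (leqnn k)).
  have k0 : 0 < k.+1%:R^-1 :> R by rewrite invr_gt0 ltr0n.
  have [n hn] := hu x _ k0; have [m hm] := hv y _ k0.
  exists (n, m, k) => //; rewrite ifT; last first.
    apply/asboolP => -[x' y'] [/=]; rewrite -!ball_normE /= => hx hy.
    apply: eV; split=> /=; rewrite -ball_normE /=.
      rewrite (splitr e) -(subrKA (u n)).
      apply: le_lt_trans (ler_normD _ _) _.
      by apply: ltrD; [exact: lt_trans ke | exact: lt_trans ke].
    rewrite (splitr e) -(subrKA (v m)).
    apply: le_lt_trans (ler_normD _ _) _.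
    by apply: ltrD; [exact: lt_trans ke | exact: lt_trans ke].
  by split=> /=; rewrite -ball_normE /= distrC.
rewrite VE preimage_bigcup setI_bigcupr; apply: sigma_algebra_countType => i.
case: asboolP => _; last by rewrite preimage_set0 setI0; case: sM.
rewrite (_ : _ `&` _ = (D `&` f @^-1` ball (u i.1.1) i.2.+1%:R^-1) `&`
                       (D `&` g @^-1` ball (v i.1.2) i.2.+1%:R^-1)).
  apply: sigma_algebraI2; [exact: subIsetl|exact: subIsetl| |].
    by apply: mf; exact: ball_open.
  by apply: mg; exact: ball_open.
by apply/seteqP; split=> x /=; rewrite /B /=; tauto.
Qed.

Lemma smeasurable_lin (E : normedModType R) (k : R) (f g : T -> E) : separable E ->
  smeasurable f -> smeasurable g -> smeasurable (fun x => k *: f x + g x).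
Proof.
move=> sE mf mg.
apply: (@smeasurable_comp _ _ (fun z : E * E => k *: z.1 + z.2)
  (fun x => (f x, g x))); last exact: smeasurable_pair.
by move=> z; apply: cvgD; [apply: cvgZr; exact: cvg_fst|exact: cvg_snd].
Qed.

End SetSystemMeasurability.

Lemma sigma_algebra_measurable_in d (T : measurableType d) (D : set T) :
  measurable D -> sigma_algebra D [set A | measurable A /\ A `<=` D].
Proof.
move=> mD; split.
- by split=> //; exact: measurable0.
- by move=> A [mA AD]; split; [exact: measurableD | exact: subDsetl].
- move=> A hA; split; first by apply: bigcup_measurable => k _; case: (hA k).
  by apply: bigcup_sub => k _; case: (hA k).
Qed.

Lemma smeasurable_measurable_fun d (T : measurableType d) (R : realType)
    (D : set T) (M : set (set T)) (f : T -> R) :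
  M `<=` measurable -> smeasurable D M f -> measurable_fun D f.
Proof.
move=> MM mf mD.
apply: (measurability _ (RGenOInfty.measurableE R)) => //.
by move=> _ [_ [x ->] <-]; apply/MM/mf; exact: interval_open.
Qed.

(** * Inner products and Hilbert-Schmidt norms *)

Section InnerProduct.
Variables (R : realType) (H : completeNormedModType R).
Variable ip : {dot H for (@idfun R)}.
Hypothesis hH : norm_from_dot ip.

Lemma ipC x y : ip x y = ip y x.
Proof. by rewrite (@hermC _ false idfun _ ip) expr0 mul1r. Qed.

Lemma ipDl x y z : ip (x + y) z = ip x z + ip y z.
Proof. exact: linearDl. Qed.

Lemma ipZl k x z : ip (k *: x) z = k * ip x z.
Proof. exact: linearZl_LR. Qed.

Lemma ipDr x y z : ip z (x + y) = ip z x + ip z y.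
Proof. by rewrite ipC ipDl !(ipC z). Qed.

Lemma ipZr k x z : ip z (k *: x) = k * ip z x.
Proof. by rewrite ipC ipZl (ipC z). Qed.

Lemma ip0l x : ip 0 x = 0.
Proof. by rewrite -(scale0r 0) ipZl mul0r. Qed.

Lemma ip0r x : ip x 0 = 0.
Proof. by rewrite ipC ip0l. Qed.

Lemma ipNl x y : ip (- x) y = - ip x y.
Proof. by rewrite -scaleN1r ipZl mulN1r. Qed.

Lemma ipBl x y z : ip (x - y) z = ip x z - ip y z.
Proof. by rewrite ipDl ipNl. Qed.

Lemma ipBr x y z : ip z (x - y) = ip z x - ip z y.
Proof. by rewrite ipC ipBl !(ipC z). Qed.

Lemma ip_suml (I : Type) (r : seq I) (F : I -> H) z :
  ip (\sum_(i <- r) F i) z = \sum_(i <- r) ip (F i) z.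
Proof.
elim/big_rec2 : _ => [|i _ y _ <-]; first exact: ip0l.
by rewrite ipDl.
Qed.

Lemma ip_sumr (I : Type) (r : seq I) (F : I -> H) z :
  ip z (\sum_(i <- r) F i) = \sum_(i <- r) ip z (F i).
Proof. by rewrite ipC ip_suml; apply: eq_bigr => i _; rewrite ipC. Qed.

Lemma ip_norm x : ip x x = `|x| ^+ 2.
Proof. by rewrite hH. Qed.

(** Cauchy-Schwarz, from the nonnegative square of [|y|^2 x - <x, y> y]; this multiple of the
    projection error avoids a division. *)
Lemma ip_le x y : `|ip x y| <= `|x| * `|y|.
Proof.
have [->|y0] := eqVneq y 0; first by rewrite ip0r !normr0 mulr0.
have ny : 0 < `|y| by rewrite normr_gt0.
rewrite -(@ler_pXn2r _ 2) ?nnegrE ?mulr_ge0 // real_normK ?num_real //.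
have : 0 <= ip (`|y| ^+ 2 *: x - ip x y *: y) (`|y| ^+ 2 *: x - ip x y *: y).
  by rewrite ip_norm sqr_ge0.
rewrite !(ipBl, ipBr, ipZl, ipZr) !ip_norm (ipC y x) => h.
have h2 : 0 <= `|y| ^+ 2 * (`|x| ^+ 2 * `|y| ^+ 2 - ip x y ^+ 2) by nra.
by rewrite exprMn -subr_ge0; move: h2; rewrite pmulr_rge0 // exprn_gt0.
Qed.

Lemma continuous_ipl y : continuous (ip ^~ y : H -> R).
Proof.
move=> x; apply/cvgrPdist_le => e e0; near=> z.
rewrite -ipBl; apply: le_trans (ip_le _ _) _.
rewrite (@le_trans _ _ (`|x - z| * (`|y| + 1))) ?ler_wpM2l ?lerDl //.
by rewrite -ler_pdivlMr ?ltr_wpDl //; near: z; apply: cvgr_dist_le;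
  [exact: cvg_id | rewrite divr_gt0 // ltr_wpDl].
Unshelve. all: by end_near. Qed.

Lemma sqr_norm_lin k x y :
  `|k *: x + y| ^+ 2 = k ^+ 2 * `|x| ^+ 2 + (k * ip x y) *+ 2 + `|y| ^+ 2.
Proof. by rewrite -!ip_norm !(ipDl, ipDr, ipZl, ipZr) (ipC y x); ring. Qed.

Lemma sqr_normD x y : `|x + y| ^+ 2 = `|x| ^+ 2 + (ip x y) *+ 2 + `|y| ^+ 2.
Proof. by rewrite -[x in LHS]scale1r sqr_norm_lin !mul1r expr1n mul1r. Qed.

Lemma sqr_normB x y : `|x - y| ^+ 2 = `|x| ^+ 2 - (ip x y) *+ 2 + `|y| ^+ 2.
Proof. by rewrite sqr_normD normrN ipC ipNl (ipC y) mulNrn. Qed.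

End InnerProduct.

Lemma sqr_norm_le2 (R : realType) (V : normedModType R) (k : R) (x y : V) :
  `|k *: x + y| ^+ 2 <= 2 * k ^+ 2 * `|x| ^+ 2 + 2 * `|y| ^+ 2.
Proof.
apply: (@le_trans _ _ ((`|k| * `|x| + `|y|) ^+ 2)).
  by rewrite ler_pXn2r ?nnegrE ?addr_ge0 ?mulr_ge0 // -normrZ ler_normD.
rewrite -(real_normK (num_real k)).
have := sqr_ge0 (`|k| * `|x| - `|y|); nra.
Qed.

(** * Expansions in an orthonormal basis *)

Section Parseval.
Variables (R : realType) (H : completeNormedModType R).
Variable ip : {dot H for (@idfun R)}.
Hypothesis hH : norm_from_dot ip.
Variable E : set H.
Hypothesis hE : orthonormal_basis ip E.
Hypothesis sepH : separable H.

(** Distinct basis vectors are at distance [sqrt 2], so no two of them lie within [1 / 2] of the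
    same point of a dense sequence. *)
Lemma orthonormal_countable : countable E.
Proof.
case: hE => E1 E0 _; case: (separable_dense_seq sepH) => u hu.
have /choice [f hf] : forall x : H, exists n, `|x - u n| < 2^-1.
  by move=> x; apply: hu; rewrite invr_gt0.
have finj : {in E &, injective f}.
  move=> e e' /set_mem Ee /set_mem Ee' fe; apply: contrapT => /eqP ee'.
  have h : `|e - e'| < 1.
    rewrite -(subrKA (u (f e))) (splitr 1) mul1r.
    apply: le_lt_trans (ler_normD _ _) _.
    by rewrite ltrD //= {1}fe distrC.
  have : `|e - e'| ^+ 2 < 1 by rewrite expr_lt1.
  by rewrite (sqr_normB hH) (E0 e e') // !hH !E1 // mul0rn subr0; lra.
by apply/countable_injP; exists f.
Qed.

(** Indexing by a subset [P] of the naturals covers finite and infinite bases at once. *)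
Lemma countable_enum : exists (P : pred nat) (u : nat -> H),
  set_bij [set n | P n] E u.
Proof.
have /countable_injP [f fi] := orthonormal_countable.
pose P n := `[< exists2 e, E e & f e = n >].
have /choice [u hu] : forall n, exists e, P n -> E e /\ f e = n.
  move=> n; have [/asboolP [e Ee fe]|nP] := boolP (P n); first by exists e.
  by exists 0.
have Pf e : E e -> P (f e) by move=> Ee; apply/asboolP; exists e.
exists P, u; split.
- by move=> n /= /hu [].
- move=> n m /set_mem /= /hu [_ hn] /set_mem /= /hu [_ hm] e.
  by rewrite -hn -hm e.
- move=> e Ee; exists (f e); first exact: Pf.
  have [Eu fu] := hu _ (Pf e Ee).
  by apply: fi => //; exact: mem_set.
Qed.

Variables (P : pred nat) (u : nat -> H).
Hypothesis uE : set_bij [set n | P n] E u.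

(** Padding with the zero vector outside [P] gives a total sequence, and the padding contributes
    nothing to the sums below. *)
Definition onseq n : H := if P n then u n else 0.
Local Notation v := onseq.

Lemma onseqE n m : ip (v n) (v m) = ((n == m) && P n)%:R.
Proof.
case: hE => E1 E0 _; case: uE => uP ui _; rewrite /onseq.
have [Pn|nPn] := boolP (P n); last by rewrite andbF ip0l.
rewrite andbT; have [<-|nm] := eqVneq n m; first by rewrite Pn E1 //; exact: uP.
case: ifP => Pm; last by rewrite ip0r.
rewrite E0 //; [exact: uP|exact: uP|].
by apply: contra_neq nm => /ui; apply; exact: mem_set.
Qed.

Lemma onseq_comb x z n m :
  ip (\sum_(n <= k < m) ip (v k) x *: v k) (\sum_(n <= k < m) ip (v k) z *: v k)
  = \sum_(n <= k < m) ip (v k) x * ip (v k) z.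
Proof.
rewrite ip_suml; apply: eq_big_nat => k /andP[nk km].
rewrite ipZl ip_sumr; congr (_ * _).
rewrite (bigD1_seq k) ?iota_uniq //=; last by rewrite mem_index_iota nk.
rewrite big1 ?addr0 => [|j jk].
  rewrite ipZr onseqE eqxx /=; have [_|nPk] := boolP (P k); first by rewrite mulr1.
  by rewrite /onseq (negbTE nPk) ip0l mul0r.
by rewrite ipZr onseqE eq_sym (negbTE jk) mulr0.
Qed.

Lemma bessel x n : \sum_(0 <= k < n) ip (v k) x ^+ 2 <= `|x| ^+ 2.
Proof.
have h := onseq_comb x x 0 n.
have : 0 <= `|x - \sum_(0 <= k < n) ip (v k) x *: v k| ^+ 2 by rewrite sqr_ge0.
rewrite (sqr_normB hH) [X in _ + X]hH h ip_sumr.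
rewrite [X in _ - X *+ 2](_ : _ = \sum_(0 <= k < n) ip (v k) x * ip (v k) x).
  by rewrite mulr2n opprD addrA subrK subr_ge0.
by apply: eq_bigr => k _; rewrite ipZr (ipC ip x).
Qed.

(** Bessel's inequality makes the squared coefficients summable, hence the partial sums Cauchy.
    Their limit has the coefficients of [x], and the totality of [E] identifies it with [x]. *)
Lemma onseq_cvg x : series (fun k => ip (v k) x *: v k) @ \oo --> x.
Proof.
have c1 : cvgn (series (fun k => ip (v k) x ^+ 2)).
  apply: nondecreasing_is_cvgn.
    by apply: nondecreasing_series => n _; rewrite sqr_ge0.
  by exists (`|x| ^+ 2) => _ [n _ <-]; exact: bessel.
have c2 : cvgn (series (fun k => ip (v k) x *: v k)).
  apply: cauchy_cvg; apply/cauchy_seriesP => e e0.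
  have /cvg_cauchy /cauchy_seriesP := c1.
  move=> /(_ (e ^+ 2) (exprn_gt0 _ e0)); apply: filterS => -[n m] /= h.
  rewrite -(@ltr_pXn2r _ 2) ?nnegrE ?(ltW e0) //.
  by rewrite hH onseq_comb; apply: le_lt_trans h; exact: ler_norm.
set y := limn (series (fun k => ip (v k) x *: v k)).
have yE m : P m -> ip y (v m) = ip x (v m).
  move=> Pm.
  have : (fun n => ip (series (fun k => ip (v k) x *: v k) n) (v m)) @ \oo
     --> ip y (v m).
    by apply: (cvg_comp _ (ip ^~ (v m)) c2); exact: continuous_ipl.
  move=> /cvg_lim <- //; apply: lim_near_cst => //; near=> n.
  have mn : (m < n)%N by near: n; exact: nbhs_infty_gt.
  rewrite /series /= ip_suml (bigD1_seq m) ?iota_uniq //=; last first.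
    by rewrite mem_index_iota.
  rewrite big1 ?addr0 => [|j jk].
    by rewrite ipZl onseqE eqxx Pm mulr1 (ipC ip x).
  by rewrite ipZl onseqE (negbTE jk) mulr0.
suff xy : x = y by rewrite [X in _ --> X]xy.
apply/eqP; rewrite -subr_eq0; apply/eqP; case: hE => _ _; apply => e Ee.
case: uE => _ _ /(_ e Ee) [n /= Pn <-].
by have := yE n Pn; rewrite /onseq Pn (ipC ip (u n)) ipBl => ->; rewrite subrr.
Unshelve. all: by end_near. Qed.

Lemma parseval x z :
  series (fun k => ip (v k) x * ip (v k) z) @ \oo --> ip x z.
Proof.
rewrite (_ : series _ =
    (ip ^~ z) \o series (fun k => ip (v k) x *: v k)).
  apply: cvg_comp; [exact: onseq_cvg|exact: continuous_ipl].
apply/funext => n.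
by rewrite /series /= ip_suml; apply: eq_bigr => k _; rewrite ipZl.
Qed.

Section HilbertSchmidtNorm.
Variable K : completeNormedModType R.

(** Turns the sum over the set [E] into a series, for which termwise comparison, additivity and
    measurability are at hand. *)
Lemma HS_norm2E (T : H -> K) :
  HS_norm2 E T = (\sum_(0 <= n <oo | P n) (`|T (u n)| ^+ 2)%:E)%E.
Proof.
rewrite nneseries_esum; last by move=> n _; rewrite lee_fin sqr_ge0.
by rewrite /HS_norm2 (reindex_esum [set n | P n] _ u).
Qed.

Variable ipK : {dot K for (@idfun R)}.
Hypothesis hK : norm_from_dot ipK.

Section FiniteRank.
Variables (I : Type) (r : seq I) (c : I -> R) (x : I -> H) (h : I -> K).

Let T (y : H) := \sum_(i <- r) (c i * ip (x i) y) *: h i.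
Let q := \sum_(i <- r) \sum_(j <- r) c i * c j * ip (x i) (x j) * ipK (h i) (h j).

(* The squared norms of a finite-rank operator are expanded bilinearly and summed
   with Parseval's identity for the vectors [x i]. *)
Lemma finite_rank_cvg : series (fun n => `|T (v n)| ^+ 2) @ \oo --> q.
Proof.
rewrite (_ : series _ = (fun n => \sum_(i <- r) \sum_(j <- r)
   (c i * c j * ipK (h i) (h j)) *
   series (fun k => ip (v k) (x i) * ip (v k) (x j)) n)).
  apply: cvg_big => //; [exact: add_continuous|move=> i _].
  apply: cvg_big => //; [exact: add_continuous|move=> j _].
  rewrite [X in _ --> X]mulrAC; apply: cvgM; [exact: cvg_cst|exact: parseval].
apply/funext => n; rewrite /series /=.
under [RHS]eq_bigr do under eq_bigr do rewrite mulr_sumr.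
under [RHS]eq_bigr do rewrite exchange_big /=.
rewrite [RHS]exchange_big /=; apply: eq_bigr => k _.
rewrite hK /T ip_suml; apply: eq_bigr => i _.
rewrite ip_sumr; apply: eq_bigr => j _.
by rewrite ipZl ipZr (ipC ip (x i)) (ipC ip (x j)); ring.
Qed.

Lemma finite_rank_gram_ge0 : 0 <= q.
Proof.
rewrite -(cvg_lim _ finite_rank_cvg) //; apply: limr_ge.
  by apply/cvg_ex; eexists; exact: finite_rank_cvg.
by apply: nearW => n; rewrite /series /=; apply: sumr_ge0 => k _; rewrite sqr_ge0.
Qed.

Lemma finite_rank_gram_le : (q%:E <= HS_norm2 E T)%E.
Proof.
have cv := finite_rank_cvg.
have T0 : T 0 = 0 by rewrite /T big1 // => i _; rewrite ip0r mulr0 scale0r.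
rewrite -(cvg_lim _ cv) // -EFin_lim; last by apply/cvg_ex; eexists; exact: cv.
rewrite HS_norm2E; apply: lime_le.
  by apply/cvg_ex; eexists; apply: cvg_EFin; [exact: nearW|exact: cv].
apply: nearW => n /=; rewrite /series /= -sumEFin.
apply: le_trans (nneseries_lim_ge n _); last first.
  by move=> k _; rewrite lee_fin sqr_ge0.
(* Indices outside [P] carry the padding vector, where [T] vanishes. *)
rewrite [leRHS]big_mkcond /=; apply: lee_sum => k _; rewrite /onseq.
by case: ifP => // _; rewrite T0 normr0 expr0n.
Qed.

End FiniteRank.

End HilbertSchmidtNorm.
End Parseval.

(** * Integrals on a time interval times a probability space *)

Section IntegralBounds.
Local Open Scope ereal_scope.

Section IntegralFacts.
Context d (T : measurableType d) (R : realType).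
Variable mu : {measure set T -> \bar R}.

(* No measurability is assumed: the integral of a nonnegative function is a
   supremum over the simple functions below it. *)
Lemma ge0_integral_mono (D : set T) (f g : T -> \bar R) :
  (forall x, D x -> 0 <= f x) -> (forall x, D x -> f x <= g x) ->
  \int[mu]_(x in D) f x <= \int[mu]_(x in D) g x.
Proof.
move=> f0 fg; have g0 x : D x -> 0 <= g x.
  by move=> Dx; apply: le_trans (f0 _ Dx) (fg _ Dx).
rewrite !ge0_integralE //; apply: le_ereal_sup => _ [h hf <-]; exists h => // x.
apply: le_trans (hf x) _; rewrite !patchE; case: ifPn => // /set_mem; exact: fg.
Qed.

Lemma ge0_le_integralD (D : set T) (f g h : T -> \bar R) : measurable D ->
  (forall x, D x -> 0 <= f x) -> (forall x, D x -> 0 <= g x) ->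
  (forall x, D x -> 0 <= h x) ->
  measurable_fun D g -> measurable_fun D h ->
  (forall x, D x -> f x <= g x + h x) ->
  \int[mu]_(x in D) f x <= \int[mu]_(x in D) g x + \int[mu]_(x in D) h x.
Proof.
move=> mD f0 g0 h0 mg mh fgh; rewrite -ge0_integralD //.
exact: ge0_integral_mono.
Qed.

Lemma ge0_le_integral_lin (D : set T) (f g h : T -> \bar R) (a b : R) : measurable D ->
  (forall x, D x -> 0 <= f x) -> (forall x, D x -> 0 <= g x) ->
  (forall x, D x -> 0 <= h x) ->
  measurable_fun D g -> measurable_fun D h -> (0 <= a)%R -> (0 <= b)%R ->
  (forall x, D x -> f x <= a%:E * g x + b%:E * h x) ->
  \int[mu]_(x in D) f x <=
    a%:E * \int[mu]_(x in D) g x + b%:E * \int[mu]_(x in D) h x.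
Proof.
move=> mD f0 g0 h0 mg mh a0 b0 fgh; rewrite -!ge0_integralZl_EFin //.
apply: ge0_le_integralD => //.
- by move=> x Dx; rewrite mule_ge0 ?g0 // lee_fin.
- by move=> x Dx; rewrite mule_ge0 ?h0 // lee_fin.
- exact: measurable_funeM.
- exact: measurable_funeM.
Qed.

Lemma integral_double_sum (D : set T) (I J : Type) (p : seq I) (q : seq J)
    (c : I -> J -> R) (f : I -> J -> T -> R) : measurable D ->
  (forall i j, mu.-integrable D (EFin \o f i j)) ->
  \int[mu]_(x in D) (\sum_(i <- p) \sum_(j <- q) c i j * f i j x)%R%:E =
  (\sum_(i <- p) \sum_(j <- q) c i j * (\int[mu]_(x in D) f i j x)%R)%R%:E.
Proof.
move=> mD intf.
have intc i j : mu.-integrable D (fun x => (c i j)%:E * (f i j x)%:E).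
  by apply: integrableZl => //; exact: intf.
transitivity (\int[mu]_(x in D) \sum_(i <- p) \sum_(j <- q) ((c i j)%:E * (f i j x)%:E)).
  apply: eq_integral => x _; rewrite -sumEFin; apply: eq_bigr => i _.
  by rewrite -sumEFin; apply: eq_bigr => j _; rewrite EFinM.
rewrite integral_sum // => [|i]; last exact: integrable_sum.
rewrite -sumEFin; apply: eq_bigr => i _; rewrite integral_sum //.
rewrite -sumEFin; apply: eq_bigr => j _; rewrite EFinM.
rewrite (integralZl mD (intf i j)); congr (_ * _).
by rewrite /Rintegral fineK //; exact: (integrable_fin_num mD (intf i j)).
Qed.

(** Cauchy-Schwarz against the constant 1, by integrating [2 m f <= f^2 + m^2] and choosing the best
    multiplier [m]. *)
Lemma sqr_integral_le (D : set T) (f : T -> R) (c : R) : measurable D ->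
  (0 < c)%R -> mu D <= c%:E -> measurable_fun D f -> (forall x, D x -> 0 <= f x)%R ->
  (\int[mu]_(x in D) (f x)%:E) ^+ 2 <= c%:E * \int[mu]_(x in D) (f x ^+ 2)%:E.
Proof.
move=> mD c0 Dc mf f0.
have mf2 : measurable_fun D (fun x => (f x ^+ 2)%:E).
  by apply/measurable_EFinP; exact: measurable_funX.
have B0 : 0 <= \int[mu]_(x in D) (f x ^+ 2)%:E.
  by apply: integral_ge0 => x _; rewrite lee_fin sqr_ge0.
have A0 : 0 <= \int[mu]_(x in D) (f x)%:E.
  by apply: integral_ge0 => x Dx; rewrite lee_fin f0.
move: B0; case BE : (\int[mu]_(x in D) (f x ^+ 2)%:E) => [B| |] // B0; last first.
  by rewrite mulry gtr0_sg // mul1e leey.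
rewrite lee_fin in B0.
have key (m : R) : (0 <= m)%R ->
    (2 * m)%:E * \int[mu]_(x in D) (f x)%:E <= (B + m ^+ 2 * c)%:E.
  move=> m0.
  rewrite -ge0_integralZl_EFin ?mulr_ge0 //; last exact/measurable_EFinP.
  rewrite EFinD -BE.
  apply: (@le_trans _ _ (\int[mu]_(x in D) (f x ^+ 2)%:E + \int[mu]_(x in D) (m ^+ 2)%:E)).
    apply: ge0_le_integralD => //.
    - by move=> x Dx; rewrite mule_ge0 // lee_fin ?mulr_ge0 // f0.
    - by move=> x Dx; rewrite lee_fin sqr_ge0.
    - by move=> x Dx; rewrite lee_fin sqr_ge0.
    - move=> x Dx; rewrite -EFinM -EFinD lee_fin.
      have := sqr_ge0 (f x - m); nra.
  apply: leeD2l; rewrite integral_cst // [leRHS]EFinM.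
  by apply: lee_wpmul2l => //; rewrite lee_fin sqr_ge0.
(* The multiplier 1 already bounds the integral of [f]; finiteness is needed before the optimal
   multiplier can be named. *)
have Afin : \int[mu]_(x in D) (f x)%:E \is a fin_num.
  rewrite ge0_fin_numE //; apply: (@le_lt_trans _ _ (B + c)%:E); last exact: ltry.
  have := key 1%R ler01; rewrite mulr1 expr1n mul1r; apply: le_trans.
  rewrite -[leLHS]mul1e lee_wpmul2r // lee_fin; lra.
rewrite -(fineK Afin) in A0 key *.
set A := fine _ in A0 key *.
rewrite lee_fin in A0.
(* [A / c] minimises [B + m^2 c - 2 m A] over [m]. *)
have := key (A / c)%R (divr_ge0 A0 (ltW c0)).
rewrite expe2 -!EFinM !lee_fin => h.
have : (2 * (A / c) * A * c <= (B + (A / c) ^+ 2 * c) * c)%R by rewrite ler_pM2r.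
rewrite (_ : (2 * (A / c) * A * c)%R = 2 * A ^+ 2)%R; last by field; rewrite gt_eqF.
rewrite (_ : ((B + (A / c) ^+ 2 * c) * c = c * B + A ^+ 2)%R); last first.
  by field; rewrite gt_eqF.
by rewrite -expr2; lra.
Qed.

Lemma ge0_integral_eq0_ae (D : set T) (f : T -> \bar R) : measurable D ->
  measurable_fun D f -> (forall x, D x -> 0 <= f x) ->
  \int[mu]_(x in D) f x = 0 -> {ae mu, forall x, D x -> f x = 0}.
Proof.
move=> mD mf f0 If.
have := ae_eq_integral_abs mu mD mf.
rewrite (eq_integral f); last by move=> x /set_mem Dx; rewrite gee0_abs // f0.
by move=> [/(_ If) + _]; exact.
Qed.

End IntegralFacts.

(** * Iterated integrals over a time slab *)

Section DoubleIntegral.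
Context d (Omega : measurableType d) (R : realType).
Variable P : probability Omega R.
Local Notation mu := (@lebesgue_measure R).

Definition slab (t s : R) : set (R * Omega) := `[t, s]%classic `*` setT.

Lemma measurable_slab t s : measurable (slab t s).
Proof. exact: measurableX. Qed.

Variables (t s : R) (F : R -> Omega -> \bar R).
Hypothesis F0 : forall r w, 0 <= F r w.
Hypothesis mF : measurable_fun (slab t s) (fun z => F z.1 z.2).

(** [F] is measurable on the slab only, while Tonelli's theorem is applied on the whole product;
    hence the extension by zero. *)
Let G := (fun z : R * Omega => F z.1 z.2) \_ (slab t s).

Let mG : measurable_fun setT G.
Proof. by apply/(measurable_restrictT _ (measurable_slab t s)). Qed.

Let G0 z : 0 <= G z.
Proof. by rewrite /G patchE; case: ifP. Qed.

Let GE r w : G (r, w) = (F ^~ w \_ `[t, s]) r.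
Proof.
rewrite /G !patchE; congr (if _ then _ else _).
by apply/idP/idP => /set_mem; rewrite /slab /= => h; apply/mem_set; case: h.
Qed.

Lemma dint_prod : \int[P]_w \int[mu]_(r in `[t, s]) F r w =
  \int[(mu \x P)%E]_(z in slab t s) F z.1 z.2.
Proof.
rewrite [RHS]integral_mkcond -/G; have -> := fubini_tonelli2 (m1 := mu) (m2 := P) G mG G0.
apply: eq_integral => w _; rewrite integral_mkcond /fubini_G.
by apply: eq_integral => r _; rewrite GE.
Qed.

Lemma measurable_inner :
  measurable_fun setT (fun w => \int[mu]_(r in `[t, s]) F r w).
Proof.
rewrite (_ : (fun w => _) = fubini_G mu G).
  exact: measurable_fun_fubini_tonelli_G.
apply/funext => w; rewrite integral_mkcond /fubini_G.
by apply: eq_integral => r _; rewrite GE.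
Qed.

Let FGE r : (t <= r <= s)%R -> \int[P]_w F r w = fubini_F P G r.
Proof.
move=> trs; rewrite /fubini_F; apply: eq_integral => w _.
by rewrite GE patchE mem_set //= in_itv.
Qed.

Lemma measurable_outer :
  measurable_fun `[t, s]%classic (fun r => \int[P]_w F r w).
Proof.
apply: (eq_measurable_fun (fubini_F P G)).
  by move=> r /set_mem /=; rewrite in_itv /= => /FGE ->.
apply: measurable_funS (measurable_fun_fubini_tonelli_F G _ _) => //.
Qed.

Lemma dint_swap : \int[P]_w \int[mu]_(r in `[t, s]) F r w =
  \int[mu]_(r in `[t, s]) \int[P]_w F r w.
Proof.
rewrite dint_prod [LHS]integral_mkcond -/G.
have -> := fubini_tonelli1 (m1 := mu) (m2 := P) G mG G0.
rewrite [RHS]integral_mkcond; apply: eq_integral => r _.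
rewrite patchE; case: ifPn => [/set_mem /=|/negP h].
  by rewrite in_itv /= => /FGE ->.
rewrite /fubini_F integral0_eq // => w _; rewrite GE patchE.
by case: ifPn => // /h.
Qed.

Lemma measurable_section r : (t <= r <= s)%R -> measurable_fun setT (F r).
Proof.
move=> trs.
have -> : F r = fun w => G (r, w).
  by apply/funext => w; rewrite GE patchE mem_set //= in_itv.
by apply: measurableT_comp mG _; exact: pair1_measurable.
Qed.

Lemma measurable_path w : measurable_fun `[t, s]%classic (F ^~ w).
Proof.
apply: (eq_measurable_fun (fun r => G (r, w))).
  by move=> r hr; rewrite GE patchE hr.
apply: (@measurable_funS _ _ _ _ setT) => //.
by apply: measurableT_comp mG _; exact: pair2_measurable.
Qed.

End DoubleIntegral.

Section DoubleIntegralLe.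
Context d (Omega : measurableType d) (R : realType).
Variable P : probability Omega R.
Local Notation mu := (@lebesgue_measure R).

(** The pointwise bound is asked for times in [[t, s]] only, which matters for integrands containing
    [S (s - r)], contractive for [r <= s]. *)
Lemma dint_le_lin (t s : R) (F G K : R -> Omega -> \bar R) (a b : R) :
  (forall r w, 0 <= F r w) -> (forall r w, 0 <= G r w) -> (forall r w, 0 <= K r w) ->
  measurable_fun (slab t s) (fun z => G z.1 z.2) ->
  measurable_fun (slab t s) (fun z => K z.1 z.2) -> (0 <= a)%R -> (0 <= b)%R ->
  (forall r w, (t <= r <= s)%R -> F r w <= a%:E * G r w + b%:E * K r w) ->
  \int[P]_w \int[mu]_(r in `[t, s]) F r w <=
    a%:E * (\int[P]_w \int[mu]_(r in `[t, s]) G r w) +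
    b%:E * (\int[P]_w \int[mu]_(r in `[t, s]) K r w).
Proof.
move=> F0 G0 K0 mG mK a0 b0 FGK.
apply: ge0_le_integral_lin => //.
- by move=> w _; apply: integral_ge0 => r _.
- by move=> w _; apply: integral_ge0 => r _.
- by move=> w _; apply: integral_ge0 => r _.
- exact: measurable_inner.
- exact: measurable_inner.
- move=> w _; apply: ge0_le_integral_lin => //.
  + exact: measurable_path.
  + exact: measurable_path.
  + by move=> r /=; rewrite in_itv /= => trs; exact: FGK.
Qed.

Lemma dint_mono (t s : R) (F G : R -> Omega -> \bar R) :
  (forall r w, (t <= r <= s)%R -> 0 <= F r w <= G r w) ->
  \int[P]_w \int[mu]_(r in `[t, s]) F r w <= \int[P]_w \int[mu]_(r in `[t, s]) G r w.
Proof.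
move=> FG; apply: ge0_integral_mono => w _.
  by apply: integral_ge0 => r /=; rewrite in_itv /= => /(FG _ w) /andP[].
by apply: ge0_integral_mono => r /=; rewrite in_itv /= => /(FG _ w) /andP[].
Qed.

End DoubleIntegralLe.

End IntegralBounds.

(** * Bochner integral *)

Definition measurable_in d (T : measurableType d) (D : set T)
    (E : topologicalType) (f : T -> E) : Prop :=
  smeasurable D [set A | measurable A /\ A `<=` D] f.

Section MeasurableIn.
Context d (T : measurableType d) (R : realType).
Variable D : set T.
Hypothesis mD : measurable D.

Let sD := sigma_algebra_measurable_in mD.

Lemma measurable_inP (E : topologicalType) (f : T -> E) :
  (forall U, open U -> measurable (D `&` f @^-1` U)) <-> measurable_in D f.
Proof.
split=> h U oU; last by case: (h U oU).
by split; [exact: h | exact: subIsetl].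
Qed.

Lemma measurable_in_fun (f : T -> R) : measurable_in D f -> measurable_fun D f.
Proof. by apply: smeasurable_measurable_fun => A []. Qed.

Lemma measurable_in_norm (V : normedModType R) (f : T -> V) :
  measurable_in D f -> measurable_fun D (fun x => `|f x|).
Proof.
move=> mf; apply: measurable_in_fun.
by apply: (smeasurable_comp _ mf); exact: norm_continuous.
Qed.

Lemma measurable_in_lin (V : normedModType R) (k : R) (f g : T -> V) :
  separable V -> measurable_in D f -> measurable_in D g ->
  measurable_in D (fun x => k *: f x + g x).
Proof. exact: smeasurable_lin. Qed.

Lemma measurable_in_sub (V : normedModType R) (f g : T -> V) :
  separable V -> measurable_in D f -> measurable_in D g ->
  measurable_in D (fun x => f x - g x).
Proof.
move=> sV mf mg.
rewrite (_ : (fun x => _) = fun x => -1 *: g x + f x).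
  exact: measurable_in_lin.
by apply/funext => x; rewrite scaleN1r addrC.
Qed.

Lemma measurable_in_cst (V : topologicalType) (c : V) : measurable_in D (fun=> c).
Proof. exact: smeasurable_cst. Qed.

Lemma measurable_in_indic (V : normedModType R) (A : set T) (c : V) : measurable A ->
  measurable_in D (fun x => (\1_A x : R) *: c).
Proof.
move=> mA.
apply: (@smeasurable_comp _ _ _ R V (fun a => a *: c) (\1_A : T -> R)).
  by move=> a; apply: cvgZl; exact: cvg_id.
move=> U oU; split; last exact: subIsetl.
have : measurable_fun setT (\1_A : T -> R) by exact: measurable_indic.
move=> /(_ measurableT U); rewrite setTI => mAU.
by apply: measurableI => //; apply: mAU; exact: open_measurable.
Qed.

End MeasurableIn.

Section Bochner.
Variables (R : realType) (H : completeNormedModType R).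
Variable ip : {dot H for (@idfun R)}.
Hypothesis hH : norm_from_dot ip.
Hypothesis sepH : separable H.
Local Notation mu := (@lebesgue_measure R).
Variable D : set R.
Hypothesis mD : measurable D.
Hypothesis finD : (mu D < +oo)%E.

Lemma measurable_simple_eval (f : seq (set R * H)) :
  (forall Ay, Ay \in f -> measurable Ay.1) -> measurable_in D (simple_eval f).
Proof.
elim: f => [|[A y] f ih] mf; rewrite /simple_eval.
  under eq_fun do rewrite big_nil; exact: measurable_in_cst.
under eq_fun do rewrite big_cons /= -[X in X + _]scale1r.
apply: measurable_in_lin => //.
  by apply: measurable_in_indic => //; apply: (mf (A, y)); rewrite mem_head.
by apply: ih => Ay hAy; apply: mf; rewrite in_cons hAy orbT.
Qed.

(** Pairing with a fixed vector reduces vector integrals to scalar ones, and overlapping sets in the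
    list cause no difficulty. Since [mu D] is finite, [fine] loses no information on the measures
    involved. *)
Lemma simple_integral_ip (f : seq (set R * H)) (h : H) :
  (forall Ay, Ay \in f -> measurable Ay.1) ->
  mu.-integrable D (fun r => (ip (simple_eval f r) h)%:E) /\
  (\int[mu]_(r in D) (ip (simple_eval f r) h)%:E)%E = (ip (simple_integral D f) h)%:E.
Proof.
elim: f => [|[A y] f ih] mf; rewrite /simple_eval /simple_integral.
  under eq_fun do rewrite big_nil ip0l.
  by rewrite big_nil ip0l integral0; split => //; exact: integrable0.
have mA : measurable A by apply: (mf (A, y)); rewrite mem_head.
have [i1 e1] : mu.-integrable D (fun r => (ip (simple_eval f r) h)%:E) /\
  (\int[mu]_(r in D) (ip (simple_eval f r) h)%:E)%E = (ip (simple_integral D f) h)%:E.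
  by apply: ih => Ay hAy; apply: mf; rewrite in_cons hAy orbT.
have E1 r : (ip (\sum_(Ay <- (A, y) :: f) (\1_(Ay.1) r : R) *: Ay.2) h)%:E =
    ((ip y h)%:E * (\1_A r)%:E + (ip (simple_eval f r) h)%:E)%E.
  by rewrite big_cons ipDl ipZl EFinD mulrC EFinM.
have iA : mu.-integrable D (fun r => (\1_A r)%:E).
  have finDA : (mu (D `&` A) < +oo)%E.
    by apply: le_lt_trans finD; apply: le_measure; rewrite ?inE //; exact: measurableI.
  apply/integrableP; split; first by apply/measurable_EFinP; exact: measurable_indic.
  by under eq_integral do rewrite gee0_abs ?lee_fin //; rewrite integral_indic // setIC.
have i2 : mu.-integrable D (fun r => (ip y h)%:E * (\1_A r)%:E)%E.
  exact: integrableZl.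
under eq_fun do rewrite E1; split.
  exact: integrableD.
rewrite integralD // e1 big_cons ipDl EFinD; congr (_ + _)%E.
rewrite integralZl // integral_indic // ipZl EFinM muleC setIC fineK //.
rewrite ge0_fin_numE //; apply: le_lt_trans finD.
by apply: le_measure; rewrite ?inE //; exact: measurableI.
Qed.

(* Testing against the integral itself avoids making the sets disjoint. *)
Lemma simple_integral_le (f : seq (set R * H)) :
  (forall Ay, Ay \in f -> measurable Ay.1) ->
  (`|simple_integral D f|%:E <= \int[mu]_(r in D) `|simple_eval f r|%:E)%E.
Proof.
move=> mf; set y := simple_integral D f.
have mN : measurable_fun D (fun r => `|simple_eval f r|).
  by apply: measurable_in_norm; exact: measurable_simple_eval.
have [->|y0] := eqVneq y 0.
  by rewrite normr0; apply: integral_ge0 => r _; rewrite lee_fin.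
have ny : 0 < `|y| by rewrite normr_gt0.
have [iy ey] := simple_integral_ip y mf.
have : (`|y|%:E * `|y|%:E <= `|y|%:E * \int[mu]_(r in D) `|simple_eval f r|%:E)%E.
  rewrite -EFinM -expr2 hH -/y -ey.
  apply: le_trans (lee_abs _) _.
  have h := le_abse_integral mu mD (measurable_int mu iy); apply: le_trans h _.
  rewrite -ge0_integralZl_EFin //; last exact/measurable_EFinP.
  apply: ge0_integral_mono => r _ //=.
  by rewrite -EFinM lee_fin mulrC; exact: ip_le.
by rewrite lee_pmul2l.
Qed.

(** The bound for simple functions passes to the limit, after [|f_n| <= |f - f_n| + |f|] under the
    integral. *)
Lemma bochner_integral_le (f : R -> H) (y : H) :
  is_bochner_integral D f y -> (`|y|%:E <= \int[mu]_(r in D) `|f r|%:E)%E.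
Proof.
case=> /measurable_inP mf [fn [mfn cf cy]].
have cN : (fun n => `|simple_integral D (fn n)|%:E) @ \oo --> `|y|%:E.
  apply: cvg_EFin; first exact: nearW.
  by apply: cvg_comp cy _; exact: norm_continuous.
have cR : ((fun n => \int[mu]_(r in D) `|f r - simple_eval (fn n) r|%:E +
      \int[mu]_(r in D) `|f r|%:E) @ \oo --> 0 + \int[mu]_(r in D) `|f r|%:E)%E.
  by apply: cvgeD => //; exact: cvg_cst.
rewrite -[leRHS]add0e -(cvg_lim _ cN) // -(cvg_lim _ cR) //.
apply: lee_lim; [by apply/cvg_ex; eexists; exact: cN|by apply/cvg_ex; eexists; exact: cR|].
apply: nearW => n; apply: le_trans (simple_integral_le (mfn n)) _.
apply: ge0_le_integralD => //.
- apply/measurable_EFinP; apply: measurable_in_norm.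
  by apply: measurable_in_sub => //; exact: (measurable_simple_eval (mfn n)).
- by apply/measurable_EFinP; exact: measurable_in_norm.
- move=> r _; rewrite -EFinD lee_fin -{1}(subrK (f r) (simple_eval (fn n) r)).
  by apply: le_trans (ler_normD _ _) _; rewrite distrC.
Qed.

Lemma bochner_integral_lin (k : R) (f g : R -> H) (y z : H) :
  is_bochner_integral D f y -> is_bochner_integral D g z ->
  is_bochner_integral D (fun r => k *: f r + g r) (k *: y + z).
Proof.
case=> /measurable_inP mf [fn [mfn cf cy]].
case=> /measurable_inP mg [gn [mgn cg cz]].
split; first by apply/measurable_inP; exact: measurable_in_lin.
(* As lists need not describe disjoint sets, the combination is approximated by the scaled first
   list followed by the second. *)
pose hn n := [seq (Ay.1, k *: Ay.2) | Ay <- fn n] ++ gn n.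
have hE n r : simple_eval (hn n) r = k *: simple_eval (fn n) r + simple_eval (gn n) r.
  rewrite /simple_eval big_cat big_map /= scaler_sumr; congr (_ + _).
  by apply: eq_bigr => Ay _; rewrite !scalerA mulrC.
exists hn; split.
- move=> n Ay; rewrite mem_cat => /orP[/mapP [Bz hB ->]|]; last exact: mgn.
  exact: (mfn n Bz hB).
- have c : ((fun n => `|k|%:E * \int[mu]_(r in D) `|f r - simple_eval (fn n) r|%:E +
      \int[mu]_(r in D) `|g r - simple_eval (gn n) r|%:E) @ \oo --> `|k|%:E * 0 + 0)%E.
    by apply: cvgeD => //; exact: cvgeZl.
  rewrite mule0 adde0 in c.
  apply: (squeeze_cvge _ (cvg_cst 0%E) c).
  apply: nearW => n; rewrite integral_ge0 //=.
  have m1 : measurable_fun D (fun r => `|f r - simple_eval (fn n) r|%:E).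
    apply/measurable_EFinP; apply: measurable_in_norm.
    by apply: measurable_in_sub => //; exact: (measurable_simple_eval (mfn n)).
  rewrite -ge0_integralZl_EFin //; apply: ge0_le_integralD => //.
  + exact: measurable_funeM.
  + apply/measurable_EFinP; apply: measurable_in_norm.
    by apply: measurable_in_sub => //; exact: (measurable_simple_eval (mgn n)).
  + move=> r _; rewrite -EFinM -EFinD lee_fin hE -normrZ.
    apply: le_trans (ler_normD _ _).
    by rewrite scalerBr addrACA opprD.
- have -> : (fun n => simple_integral D (hn n)) =
      (fun n => k *: simple_integral D (fn n) + simple_integral D (gn n)).
    apply/funext => n; rewrite /simple_integral big_cat big_map /= scaler_sumr.
    by congr (_ + _); apply: eq_bigr => Ay _; rewrite !scalerA mulrC.
  by apply: cvgD => //; apply: cvgZr.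
Qed.

End Bochner.

(** * Gaussian increments *)

Section Independence.
Context d (Omega : measurableType d) (R : realType) (P : probability Omega R).

(** On rectangles the joint law of [G] and [Y] is the product of the marginal laws, hence it is that
    product on all measurable sets; Fubini's theorem then factors the integral of [u v]. *)
Lemma independent_integralM (G Y : Omega -> R) :
  measurable_fun setT G -> measurable_fun setT Y ->
  (forall A B : set R, measurable A -> measurable B ->
     P (G @^-1` A `&` Y @^-1` B) = P (G @^-1` A) * P (Y @^-1` B))%E ->
  P.-integrable setT (EFin \o G) -> P.-integrable setT (EFin \o Y) ->
  P.-integrable setT (fun w => (G w * Y w)%:E) /\
  (\int[P]_w (G w * Y w)%:E = (\int[P]_w (G w)%:E) * (\int[P]_w (Y w)%:E))%E.
Proof.
move=> mG mY ind iG iY.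
pose g : {RV P >-> R} := HB.pack G (isMeasurableFun.Build _ _ _ _ G mG).
pose y : {RV P >-> R} := HB.pack Y (isMeasurableFun.Build _ _ _ _ Y mY).
pose Z w := (G w, Y w).
have mZ : measurable_fun setT Z by exact: measurable_fun_pair.
pose z : {RV P >-> (R * R)%type} := HB.pack Z (isMeasurableFun.Build _ _ _ _ Z mZ).
pose m1 := distribution P g; pose m2 := distribution P y; pose m' := distribution P z.
have mE X : measurable X -> (m1 \x m2)%E X = m' X.
  apply: product_measure_unique => A B mA mB.
  by rewrite /m' /m1 /m2 /distribution /pushforward /= -ind.
pose h (p : R * R) := (p.1 * p.2)%:E.
have mh : measurable_fun setT h.
  by apply/measurable_EFinP; apply: measurable_funM;
    [exact: measurable_fst|exact: measurable_snd].
have fin1 : (\int[m1]_u `|u%:E| < +oo)%E.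
  rewrite (ge0_integral_distribution g (f := fun u => `|u%:E|%E)) //.
    by case/integrableP: iG.
  by apply: measurableT_comp => //; exact/measurable_EFinP.
have fin2 : (\int[m2]_u `|u%:E| < +oo)%E.
  rewrite (ge0_integral_distribution y (f := fun u => `|u%:E|%E)) //.
    by case/integrableP: iY.
  by apply: measurableT_comp => //; exact/measurable_EFinP.
have i1 : m1.-integrable setT EFin by apply/integrableP; split => //; exact/measurable_EFinP.
have i2 : m2.-integrable setT EFin by apply/integrableP; split => //; exact/measurable_EFinP.
have ih : (m1 \x m2)%E.-integrable setT h.
  apply/(integrable12ltyP m1 m2 mh).
  under eq_integral => u _.
    under eq_integral do rewrite /h /= normrM EFinM.
    rewrite ge0_integralZl_EFin //; first over.
    by apply: measurableT_comp => //; exact/measurable_EFinP.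
  rewrite ge0_integralZr //.
  - apply: lte_mul_pinfty => //; first exact: integral_ge0.
    by rewrite ge0_fin_numE //; exact: integral_ge0.
  - by apply: measurableT_comp => //; exact/measurable_EFinP.
  - exact: integral_ge0.
have ip : P.-integrable setT (h \o Z).
  apply/integrableP; split; first exact: measurableT_comp.
  rewrite -(ge0_integral_distribution z (f := fun p => `|h p|%E)) //; last first.
    exact: measurableT_comp.
  rewrite -/m' (eq_measure_integral (m1 \x m2)%E); first by case/integrableP: ih.
  by move=> A mA _; exact/esym/mE.
split; first exact: ip.
have -> : (\int[P]_w (G w * Y w)%:E = \int[m']_p h p)%E.
  by rewrite (integral_distribution (X := z) mh ip).
rewrite (eq_measure_integral (m1 \x m2)%E); last by move=> A mA _; exact/esym/mE.
rewrite -integral12_prod_meas1 // /fubini_F.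
under eq_integral => u _.
  under eq_integral do rewrite /h /= EFinM.
  rewrite integralZl //; over.
have fin2' := integrable_fin_num measurableT i2.
rewrite -(fineK fin2') integralZr // fineK //.
by rewrite (integral_distribution (X := g) (f := EFin)) //
  (integral_distribution (X := y) (f := EFin)).
Qed.

End Independence.

(** * Second moment of a centred normal law *)

Section GaussianMoment.
Variable R : realType.
Local Notation mu := (@lebesgue_measure R).
Import Radon_Nikodym_SigmaFinite.

(** The change of variables is made with the Radon-Nikodym derivative, which equals the explicit
    density almost everywhere because both have the same integral over every measurable set. *)
Lemma normal_prob_density (s : R) (f : R -> \bar R) :
  measurable_fun setT f -> (forall x, 0 <= f x)%E ->
  (\int[normal_prob 0%R s]_x f x = \int[mu]_x (f x * (normal_pdf 0 s x)%:E))%E.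
Proof.
move=> mf f0.
have dom := normal_prob_dominates (0%R : R) s.
rewrite -(change_of_variables dom f0 measurableT mf).
have mpdf : measurable_fun setT (fun x => (normal_pdf (0:R) s x)%:E).
  by apply/measurable_EFinP; exact: measurable_normal_pdf.
apply: ae_eq_integral => //.
- by apply: emeasurable_funM => //; exact: measurable_int (f_integrable dom).
- exact: emeasurable_funM.
- apply: ae_eqe_mul2l.
  apply: integral_ae_eq => //; first exact: f_integrable.
  by move=> A _ mA; rewrite -f_integral.
Qed.

(** With [y = x^2 / (4 s^2)] this is [y exp (- y) <= 1] times [exp (- y)]: half of the Gaussian
    exponent absorbs the factor [x^2]. *)
Lemma sqr_expR_le (s x : R) : s != 0 ->
  x ^+ 2 * expR (- x ^+ 2 / (s ^+ 2 *+ 2)) <=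
  4 * s ^+ 2 * expR (- x ^+ 2 / ((2 * s ^+ 2) *+ 2)).
Proof.
move=> s0.
set y := x ^+ 2 / (4 * s ^+ 2).
have y0 : 0 <= y by rewrite divr_ge0 ?sqr_ge0 // mulr_ge0 ?sqr_ge0.
have -> : - x ^+ 2 / (s ^+ 2 *+ 2) = - y + - y.
  by rewrite /y; field.
have -> : - x ^+ 2 / ((2 * s ^+ 2) *+ 2) = - y.
  by rewrite /y; field.
rewrite (_ : x ^+ 2 = 4 * s ^+ 2 * y); last by rewrite /y; field.
rewrite -[leLHS]mulrA; apply: ler_wpM2l.
  by rewrite mulr_ge0 ?sqr_ge0.
rewrite expRD mulrA ler_piMl ?expR_ge0 // expRN ler_pdivrMr ?expR_gt0 // mul1r.
by apply: le_trans (expR_ge1Dx y); rewrite lerDr.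
Qed.

Lemma normal_second_moment_lty (s : R) : 0 < s ->
  (\int[normal_prob 0%R s]_x (x ^+ 2)%:E < +oo)%E.
Proof.
move=> s0; have s0' : s != 0 by rewrite gt_eqF.
(* Doubling the variance leaves half of the exponent. [K] combines the factor [4 s^2] with the ratio
   of the two normalising constants, so the second moment is at most [K] times a total mass of 1. *)
pose s2 := Num.sqrt 2 * s : R.
have s20 : s2 != 0 by rewrite mulf_neq0 // gt_eqF // sqrtr_gt0.
have s2E : s2 ^+ 2 = 2 * s ^+ 2 by rewrite /s2 exprMn sqr_sqrtr.
pose K := 4 * s ^+ 2 * normal_peak s / normal_peak s2.
have K0 : 0 <= K.
  apply: divr_ge0; last exact: normal_peak_ge0.
  by apply: mulr_ge0; [rewrite mulr_ge0 ?sqr_ge0|exact: normal_peak_ge0].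
rewrite normal_prob_density //; last 2 first.
- by apply/measurable_EFinP; exact: measurable_funX.
- by move=> x; rewrite lee_fin sqr_ge0.
have mp2 : measurable_fun setT (fun x => (normal_pdf (0:R) s2 x)%:E).
  by apply/measurable_EFinP; exact: measurable_normal_pdf.
apply: (@le_lt_trans _ _ (\int[mu]_x (K%:E * (normal_pdf 0 s2 x)%:E))%E).
  apply: ge0_integral_mono => x _.
    by rewrite mule_ge0 // lee_fin ?sqr_ge0 // normal_pdf_ge0.
  rewrite -!EFinM lee_fin !normal_pdfE //= /K.
  rewrite [leRHS]mulrA divfK; last by rewrite gt_eqF // normal_peak_gt0.
  rewrite [leLHS]mulrCA [X in _ <= X * _]mulrC -[leRHS]mulrA.
  apply: ler_wpM2l; first exact: normal_peak_ge0.
  rewrite /normal_fun !subr0 s2E.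
  exact: sqr_expR_le.
rewrite ge0_integralZl_EFin // => [|x _]; last by rewrite lee_fin normal_pdf_ge0.
by rewrite integral_normal_pdf mule1 ltry.
Qed.

End GaussianMoment.

(** * Square integrable random variables *)

Section SquareIntegrable.
Context d (Omega : measurableType d) (R : realType) (P : probability Omega R).
Implicit Types X Y : Omega -> R.

Definition sqr_integrable X : Prop :=
  measurable_fun setT X /\ (\int[P]_w (X w ^+ 2)%:E < +oo)%E.

Definition l2_dot X Y : R := \int[P]_w (X w * Y w).

Lemma sqr_integrable_mul X Y : sqr_integrable X -> sqr_integrable Y ->
  P.-integrable setT (fun w => (X w * Y w)%:E).
Proof.
move=> [mX fX] [mY fY]; apply/integrableP; split.
  by apply/measurable_EFinP; exact: measurable_funM.
have m2 (Z : Omega -> R) : measurable_fun setT Z -> measurable_fun setT (fun w => (Z w ^+ 2)%:E).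
  by move=> mZ; apply/measurable_EFinP; exact: measurable_funX.
apply: (@le_lt_trans _ _ (\int[P]_w (X w ^+ 2)%:E + \int[P]_w (Y w ^+ 2)%:E)%E).
  apply: ge0_le_integralD => //; try exact: m2;
    try by move=> w _; rewrite lee_fin sqr_ge0.
  move=> w _; rewrite -EFinD lee_fin normrM.
  rewrite -(real_normK (num_real (X w))) -(real_normK (num_real (Y w))).
  by have := sqr_ge0 (`|X w| - `|Y w|); have := normr_ge0 (X w);
    have := normr_ge0 (Y w); nra.
exact: lte_add_pinfty.
Qed.

Lemma sqr_integrable_cst (c : R) : sqr_integrable (fun=> c).
Proof.
split; first exact: measurable_cst.
have /integrableP[_] := finite_measure_integrable_cst P (c ^+ 2) measurableT.
by under eq_integral do rewrite gee0_abs ?lee_fin ?sqr_ge0 //.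
Qed.

Lemma sqr_integrable_int X : sqr_integrable X -> P.-integrable setT (EFin \o X).
Proof.
move=> hX; have := sqr_integrable_mul hX (sqr_integrable_cst 1).
by under eq_fun do rewrite mulr1.
Qed.

Lemma sqr_integrable_lin (k : R) X Y : sqr_integrable X -> sqr_integrable Y ->
  sqr_integrable (fun w => k * X w + Y w).
Proof.
move=> [mX fX] [mY fY]; split.
  by apply: measurable_funD => //; exact: measurable_funM.
have m2 (Z : Omega -> R) : measurable_fun setT Z -> measurable_fun setT (fun w => (Z w ^+ 2)%:E).
  by move=> mZ; apply/measurable_EFinP; exact: measurable_funX.
apply: (@le_lt_trans _ _ (\int[P]_w ((2 * k ^+ 2)%:E * (X w ^+ 2)%:E) +
    \int[P]_w (2%:E * (Y w ^+ 2)%:E))%E).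
  apply: ge0_le_integralD => //.
  - by move=> w _; rewrite lee_fin sqr_ge0.
  - move=> w _; rewrite -EFinM lee_fin; apply: mulr_ge0; last exact: sqr_ge0.
    by apply: mulr_ge0 => //; exact: sqr_ge0.
  - by move=> w _; rewrite mule_ge0 // lee_fin sqr_ge0.
  - by apply: measurable_funeM; exact: m2.
  - by apply: measurable_funeM; exact: m2.
  - by move=> w _; rewrite -!EFinM -EFinD lee_fin; have := sqr_ge0 (k * X w - Y w); nra.
have k0 : 0 <= 2 * k ^+ 2 by apply: mulr_ge0 => //; exact: sqr_ge0.
rewrite !ge0_integralZl_EFin //; try exact: m2;
  try by move=> w _; rewrite lee_fin sqr_ge0.
by apply: lte_add_pinfty; apply: lte_mul_pinfty.
Qed.

Lemma sqr_integrableD X Y : sqr_integrable X -> sqr_integrable Y ->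
  sqr_integrable (fun w => X w + Y w).
Proof.
move=> hX hY; have := sqr_integrable_lin 1 hX hY.
by under eq_fun do rewrite mul1r.
Qed.

Lemma sqr_integrable_indic (A : set Omega) X : measurable A -> sqr_integrable X ->
  sqr_integrable (fun w => \1_A w * X w).
Proof.
move=> mA [mX fX]; split; first by apply: measurable_funM => //; exact: measurable_indic.
apply: le_lt_trans fX; apply: ge0_integral_mono => w _; rewrite lee_fin ?sqr_ge0 //.
rewrite exprMn ler_piMl ?sqr_ge0 // indicE; case: (_ \in _); by rewrite ?expr1n ?expr0n.
Qed.

Lemma l2_dotC X Y : l2_dot X Y = l2_dot Y X.
Proof. by apply: eq_Rintegral => w _; rewrite mulrC. Qed.

Lemma l2_dotDl X X' Y : sqr_integrable X -> sqr_integrable X' -> sqr_integrable Y ->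
  l2_dot (fun w => X w + X' w) Y = l2_dot X Y + l2_dot X' Y.
Proof.
move=> hX hX' hY; rewrite /l2_dot; under eq_Rintegral do rewrite mulrDl.
by rewrite RintegralD //; exact: sqr_integrable_mul.
Qed.

Lemma l2_dotDr X Y Y' : sqr_integrable X -> sqr_integrable Y -> sqr_integrable Y' ->
  l2_dot X (fun w => Y w + Y' w) = l2_dot X Y + l2_dot X Y'.
Proof. by move=> *; rewrite l2_dotC l2_dotDl // !(l2_dotC X). Qed.

Lemma ae_eq_Rint (f g : Omega -> R) :
  measurable_fun setT f -> measurable_fun setT g ->
  {ae P, forall w, f w = g w} -> \int[P]_w f w = \int[P]_w g w.
Proof.
move=> mf mg fg; congr fine; apply: ae_eq_integral => //.
- exact/measurable_EFinP.
- exact/measurable_EFinP.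
- by apply: filterS fg => w -> .
Qed.

End SquareIntegrable.

(** * Increments of the cylindrical Wiener process and their covariances *)

Section WienerProcess.
Context (R : realType) d (Omega : measurableType d) (P : probability Omega R).
Hypothesis complP : measure_is_complete P.
Variables (Xi : completeNormedModType R) (ipXi : {dot Xi for (@idfun R)}).
Hypothesis hXi : norm_from_dot ipXi.
Variables (W : R -> Xi -> Omega -> R) (t T : R).
Hypothesis hW : cylindrical_wiener P W t T.
Local Notation F := (wiener_filtration P W t).
Local Notation D := (increment W).

Let gens (s : R) : set (set Omega) :=
  [set A | exists r xi (U : set R),
         [/\ t <= r <= s, measurable U & A = W r xi @^-1` U]]
      `|` [set N | P.-negligible N].

(** [Omega] with the sigma-algebra at time [s]: adaptedness becomes [measurable_fun], with all its
    closure properties. *)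
Definition filtered_space (s : R) := g_sigma_algebraType (gens s).

(** The generators include all negligible sets, and these are measurable by completeness of [P]. *)
Lemma filtration_measurable s : s <= T -> F s `<=` measurable.
Proof.
move=> sT; apply: smallest_sub; first exact: sigma_algebra_measurable.
move=> A [[r [xi [U [/andP[tr rs] mU ->]]]]|]; last exact: complP.
rewrite -[X in measurable X]setTI; apply: (cw_measurable hW) => //.
by rewrite tr (le_trans rs).
Qed.

Lemma filtration_mono s s' : s <= s' -> F s `<=` F s'.
Proof.
move=> ss'; apply: sub_smallest2r; first exact: smallest_sigma_algebra.
apply: setSU => A [r [xi [U [/andP[tr rs] mU ->]]]].
by exists r, xi, U; split => //; rewrite tr (le_trans rs).
Qed.

Definition adapted (s : R) (G : Omega -> R) : Prop :=
  measurable_fun setT (G : filtered_space s -> R).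

Lemma adapted_measurable s G : s <= T -> adapted s G -> measurable_fun setT G.
Proof.
move=> sT mG _ U mU; rewrite setTI; apply: (filtration_measurable sT).
by have := mG measurableT U mU; rewrite setTI.
Qed.

Lemma adapted_W s r xi : t <= r <= s -> adapted s (W r xi).
Proof.
move=> trs _ U mU; rewrite setTI; apply: sub_sigma_algebra; left.
by exists r, xi, U.
Qed.

Lemma adapted_increment s r xi : t <= s <= r -> adapted r (D s r xi).
Proof.
move=> /andP[ts sr]; apply: measurable_funB.
  by apply: adapted_W; rewrite (le_trans ts) /=.
by apply: adapted_W; rewrite ts.
Qed.

Lemma adapted_indic s A : F s A -> adapted s (\1_A).
Proof. by move=> FA; apply: (@measurable_indic _ (filtered_space s)). Qed.

Lemma adapted_mono s s' G : s <= s' -> adapted s G -> adapted s' G.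
Proof.
move=> ss' mG _ U mU; rewrite setTI; apply: (filtration_mono ss').
by have := mG measurableT U mU; rewrite setTI.
Qed.

Lemma increment_linear s r k xi eta : t <= s -> s <= r -> r <= T ->
  {ae P, forall w, D s r (k *: xi + eta) w = k * D s r xi w + D s r eta w}.
Proof.
move=> ts sr rT.
have h1 := cw_linear hW (s := s) k xi eta.
have h2 := cw_linear hW (s := r) k xi eta.
rewrite ts (le_trans sr rT) in h1; rewrite rT (le_trans ts sr) in h2.
apply: filterS2 (h1 isT) (h2 isT) => w e1 e2.
by rewrite /increment e1 e2; ring.
Qed.

Lemma measurable_increment s r xi : t <= s -> s <= r -> r <= T ->
  measurable_fun setT (D s r xi).
Proof.
move=> ts sr rT; apply: (@adapted_measurable r) => //.
by apply: adapted_increment; rewrite ts.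
Qed.

Lemma increment0 s xi w : D s s xi w = 0.
Proof. by rewrite /increment subrr. Qed.

Lemma increment_split s m r xi w : D s r xi w = D s m xi w + D m r xi w.
Proof. by rewrite /increment; ring. Qed.

Lemma increment_zero s r : t <= s -> s <= r -> r <= T ->
  {ae P, forall w, D s r 0 w = 0}.
Proof.
move=> ts sr rT; have := increment_linear 1 0 0 ts sr rT.
apply: filterS => w; rewrite scaler0 addr0 mul1r => h.
by apply: (@addrI _ (D s r 0 w)); rewrite addr0 -h.
Qed.

Lemma integral_increment s r xi (f : R -> \bar R) : t <= s -> s < r -> r <= T ->
  xi != 0 -> measurable_fun setT f -> (forall x, 0 <= f x)%E ->
  (\int[P]_w f (D s r xi w) =
   \int[normal_prob 0%R (Num.sqrt (r - s) * `|xi|)]_x f x)%E.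
Proof.
move=> ts sr rT xi0 mf f0.
have mD := measurable_increment xi ts (ltW sr) rT.
have mD' : measurable_fun setT (D s r xi : Omega -> measurableTypeR R) by exact: mD.
pose X : {RV P >-> measurableTypeR R} :=
  HB.pack (D s r xi : Omega -> measurableTypeR R)
    (isMeasurableFun.Build _ _ _ _ _ mD').
rewrite -(ge0_integral_distribution X mf f0).
apply: (eq_measure_integral (normal_prob 0%R (Num.sqrt (r - s) * `|xi|))).
by move=> U mU _; exact: (cw_gaussian hW).
Qed.

(* The value is 1, but this is never needed. *)
Definition gauss_var : R := fine (\int[normal_prob 0%R (1 : R)]_x (x ^+ 2)%:E)%E.

Lemma gauss_var_ge0 : 0 <= gauss_var.
Proof. by apply: fine_ge0; apply: integral_ge0 => x _; rewrite lee_fin sqr_ge0. Qed.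

(** The Gaussian law is given for [s < r] and [xi != 0]; in the two degenerate cases the increment
    vanishes, identically or almost everywhere. *)
Lemma sqr_integrable_increment s r xi : t <= s -> s <= r -> r <= T ->
  sqr_integrable P (D s r xi).
Proof.
move=> ts sr rT; split; first exact: measurable_increment.
move: sr; rewrite le_eqVlt => /predU1P[<-|sr].
  by under eq_integral do rewrite increment0 expr0n /=; rewrite integral0 ltry.
have [->|xi0] := eqVneq xi 0.
  rewrite (ge0_ae_eq_integral (g := fun=> 0%E)) //.
  - by rewrite integral0 ltry.
  - apply/measurable_EFinP; apply: measurable_funX.
    exact: measurable_increment (ltW sr) rT.
  - by move=> w _; rewrite lee_fin sqr_ge0.
  - apply: filterS (increment_zero ts (ltW sr) rT) => w -> _.
    by rewrite expr0n.
rewrite (integral_increment (f := fun x => (x ^+ 2)%:E)) //.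
- apply: normal_second_moment_lty.
  by rewrite mulr_gt0 ?sqrtr_gt0 ?subr_gt0 ?normr_gt0.
- by apply/measurable_EFinP; exact: measurable_funX.
- by move=> x; rewrite lee_fin sqr_ge0.
Qed.

(** The identity changes sign, so this transfer to the law rests on integrability, which the second
    moment provides. *)
Lemma integral_increment_mean s r xi : t <= s -> s < r -> r <= T -> xi != 0 ->
  (\int[P]_w (D s r xi w)%:E =
   \int[normal_prob 0%R (Num.sqrt (r - s) * `|xi|)]_x x%:E)%E.
Proof.
move=> ts sr rT xi0.
have mD := measurable_increment xi ts (ltW sr) rT.
have mD' : measurable_fun setT (D s r xi : Omega -> measurableTypeR R) by exact: mD.
pose X : {RV P >-> measurableTypeR R} :=
  HB.pack (D s r xi : Omega -> measurableTypeR R)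
    (isMeasurableFun.Build _ _ _ _ _ mD').
have iX : P.-integrable setT (EFin \o X).
  exact: (sqr_integrable_int (sqr_integrable_increment xi ts (ltW sr) rT)).
have mE : measurable_fun setT (EFin : measurableTypeR R -> \bar R) by exact/measurable_EFinP.
have := integral_distribution (X := X) mE iX; rewrite /= => <-.
apply: (eq_measure_integral (normal_prob 0%R (Num.sqrt (r - s) * `|xi|))).
by move=> U mU _; exact: (cw_gaussian hW).
Qed.

Lemma increment_scale s r k xi : t <= s -> s <= r -> r <= T ->
  {ae P, forall w, D s r (k *: xi) w = k * D s r xi w}.
Proof.
move=> ts sr rT.
have := increment_linear k xi 0 ts sr rT; have := increment_zero ts sr rT.
by apply: filterS2 => w e0; rewrite addr0 e0 addr0.
Qed.

(* [W(-xi) = - W(xi)] and both have the same law. *)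
Lemma increment_mean s r xi : t <= s -> s <= r -> r <= T ->
  (\int[P]_w (D s r xi w)%:E)%E = 0%E.
Proof.
move=> ts; rewrite le_eqVlt => /predU1P[<-|sr] rT.
  by under eq_integral do rewrite increment0; rewrite integral0.
have mD eta : measurable_fun setT (fun w => (D s r eta w)%:E).
  by apply/measurable_EFinP; exact: measurable_increment (ltW sr) rT.
have [->|xi0] := eqVneq xi 0.
  rewrite (ae_eq_integral (fun=> 0%E)) ?integral0 //.
  by apply: filterS (increment_zero ts (ltW sr) rT) => w -> _.
have iX := sqr_integrable_int (sqr_integrable_increment xi ts (ltW sr) rT).
have e : (\int[P]_w (D s r xi w)%:E = - \int[P]_w (D s r xi w)%:E)%E.
  rewrite {1}(integral_increment_mean ts sr rT xi0) -normrN.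
  rewrite -(integral_increment_mean ts sr rT) ?oppr_eq0 //.
  rewrite -mulN1e -(integralZl measurableT iX); apply: ae_eq_integral => //.
    by apply: measurable_funeM; exact: mD.
  by apply: filterS (increment_scale (-1) xi ts (ltW sr) rT) => w;
    rewrite scaleN1r => -> _.
have := integrable_fin_num measurableT iX => fI.
move: e; rewrite /comp -(fineK fI) /comp -EFinN => -[] h; congr EFin; lra.
Qed.

(* The law of [W(k xi) = k W(xi)] shows that the second moment of the centred
   normal law is proportional to its variance parameter. *)
Lemma increment_variance s r xi : t <= s -> s <= r -> r <= T ->
  (\int[P]_w (D s r xi w ^+ 2)%:E)%E = (gauss_var * (r - s) * `|xi| ^+ 2)%:E.
Proof.
move=> ts; rewrite le_eqVlt => /predU1P[<-|sr] rT.
  under eq_integral do rewrite increment0 expr0n /=.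
  by rewrite integral0 subrr mulr0 mul0r.
have mD eta : measurable_fun setT (fun w => (D s r eta w ^+ 2)%:E).
  apply/measurable_EFinP; apply: measurable_funX.
  exact: measurable_increment (ltW sr) rT.
have [->|xi0] := eqVneq xi 0.
  rewrite (ae_eq_integral (fun=> 0%E)) ?integral0 //.
    by rewrite normr0 expr0n mulr0.
  by apply: filterS (increment_zero ts (ltW sr) rT) => w -> _; rewrite expr0n.
set sg := Num.sqrt (r - s) * `|xi|.
have sg0 : 0 < sg by rewrite mulr_gt0 ?sqrtr_gt0 ?subr_gt0 ?normr_gt0.
(* The increment in the direction [sg^-1 *: xi] has standard deviation 1, so its second moment is
   [gauss_var]. *)
have k0 : sg^-1 *: xi != 0 by rewrite scaler_eq0 negb_or invr_eq0 gt_eqF.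
have m2 : measurable_fun setT (fun x : R => (x ^+ 2)%:E).
  by apply/measurable_EFinP; exact: measurable_funX.
have p2 (x : R) : (0 <= (x ^+ 2)%:E)%E by rewrite lee_fin sqr_ge0.
have e1 := integral_increment ts sr rT k0 m2 p2.
have sgE : Num.sqrt (r - s) * `|sg^-1 *: xi| = 1.
  by rewrite normrZ gtr0_norm ?invr_gt0 // mulrCA -/sg mulVf // gt_eqF.
rewrite sgE in e1.
have e2 : (\int[P]_w (D s r (sg^-1 *: xi) w ^+ 2)%:E =
    (sg ^- 2)%:E * \int[P]_w (D s r xi w ^+ 2)%:E)%E.
  rewrite -ge0_integralZl_EFin //; last by rewrite invr_ge0 sqr_ge0.
  apply: ae_eq_integral => //; first exact: measurable_funeM.
  apply: filterS (increment_scale sg^-1 xi ts (ltW sr) rT) => w -> _.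
  by rewrite exprMn exprVn EFinM.
have fin : (\int[normal_prob 0%R (1 : R)]_x (x ^+ 2)%:E)%E \is a fin_num.
  rewrite ge0_fin_numE; last by apply: integral_ge0 => x _; rewrite lee_fin sqr_ge0.
  exact: normal_second_moment_lty.
have e3 : (gauss_var%:E = (sg ^- 2)%:E * \int[P]_w (D s r xi w ^+ 2)%:E)%E.
  by rewrite /gauss_var fineK // -e1 e2.
have -> : gauss_var * (r - s) * `|xi| ^+ 2 = sg ^+ 2 * gauss_var.
  by rewrite /sg exprMn sqr_sqrtr ?subr_ge0 ?(ltW sr) //; ring.
by rewrite EFinM e3 muleA -EFinM divff ?mul1e // sqrf_eq0 gt_eqF.
Qed.

(** [phi] is the identity where orthogonality is derived and the square where variances are
    computed. *)
Lemma independent_increment s r xi G (phi : R -> R) : t <= s -> s < r -> r <= T ->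
  adapted s G -> measurable_fun setT phi ->
  P.-integrable setT (EFin \o G) ->
  P.-integrable setT (fun w => (phi (D s r xi w))%:E) ->
  (\int[P]_w (G w * phi (D s r xi w))%:E =
   (\int[P]_w (G w)%:E) * (\int[P]_w (phi (D s r xi w))%:E))%E.
Proof.
move=> ts sr rT aG mphi iG iY.
apply: (independent_integralM _ _ _ iG iY).2.
- exact: adapted_measurable (ltW (lt_le_trans sr rT)) aG.
- by apply: measurableT_comp => //; exact: measurable_increment (ltW sr) rT.
- move=> A B mA mB.
  have mB' : measurable (phi @^-1` B).
    by have := mphi measurableT B mB; rewrite setTI.
  have FA : F s (G @^-1` A) by have := aG measurableT A mA; rewrite setTI.
  exact: (cw_independent hW xi ts sr rT mB' FA).
Qed.

(** [X] times the indicator of [A] is known at time [s], so it factors out of the expectation, and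
    the remaining increment is centred. *)
Lemma l2_dot_future s r xi X A : t <= s -> s <= r -> r <= T ->
  adapted s X -> sqr_integrable P X -> F s A ->
  l2_dot P X (fun w => \1_A w * D s r xi w) = 0.
Proof.
move=> ts; rewrite le_eqVlt => /predU1P[<-|sr] rT aX hX FA; rewrite /l2_dot.
  under eq_Rintegral do rewrite increment0 !mulr0.
  by rewrite /Rintegral integral0.
have sT := ltW (lt_le_trans sr rT).
have mA := filtration_measurable sT FA.
rewrite /Rintegral; under eq_integral do rewrite mulrCA mulrA.
have hAX := sqr_integrable_indic mA hX.
rewrite (independent_increment (phi := id)) // ?increment_mean ?(ltW sr) ?mule0 //.
- by apply: measurable_funM => //; exact: adapted_indic.
- exact: sqr_integrable_int.
- exact: (sqr_integrable_int (sqr_integrable_increment xi ts (ltW sr) rT)).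
Qed.

Lemma indic_increment_variance s r xi C : t <= s -> s <= r -> r <= T -> F s C ->
  \int[P]_w (\1_C w * D s r xi w ^+ 2) =
  gauss_var * fine (P C) * (r - s) * `|xi| ^+ 2.
Proof.
move=> ts; rewrite le_eqVlt => /predU1P[<-|sr] rT FC; rewrite /Rintegral.
  under eq_integral do rewrite increment0 expr0n mulr0 /=.
  by rewrite integral0 subrr mulr0 mul0r.
have mC : measurable C by apply: (filtration_measurable (ltW (lt_le_trans sr rT))).
have [mD fD] := sqr_integrable_increment xi ts (ltW sr) rT.
rewrite (independent_increment (phi := fun x => x ^+ 2)) //.
- rewrite increment_variance ?(ltW sr) // integral_indic // setIT.
  by rewrite fineM ?fin_num_measure //=; ring.
- exact: adapted_indic.
- exact: integrable_indic.
- apply/integrableP; split; first by apply/measurable_EFinP; exact: measurable_funX.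
  by under eq_integral do rewrite gee0_abs ?lee_fin ?sqr_ge0 //.
Qed.

(** Polarisation of the variance formula, through the almost sure additivity of the increments in
    the direction. *)
Lemma indic_increment_covariance s r xi eta C : t <= s -> s <= r -> r <= T -> F s C ->
  \int[P]_w (\1_C w * (D s r xi w * D s r eta w)) =
  gauss_var * fine (P C) * (r - s) * ipXi xi eta.
Proof.
move=> ts sr rT FC.
have mC : measurable C by apply: (filtration_measurable (le_trans sr rT)).
have mI : measurable_fun setT (\1_C : Omega -> R) by exact: measurable_indic.
have mD z := measurable_increment z ts sr rT.
pose q z w := \1_C w * D s r z w ^+ 2.
have iq z : P.-integrable setT (EFin \o q z).
  have h := sqr_integrable_increment z ts sr rT.
  have := sqr_integrable_mul (sqr_integrable_indic mC h) h.
  by under eq_fun do rewrite -mulrA -expr2.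
have i1 : P.-integrable setT (EFin \o (fun w => q (xi + eta) w - q xi w)).
  exact: (integrableB measurableT (iq (xi + eta)) (iq xi)).
have i2 : P.-integrable setT (EFin \o (fun w => q (xi + eta) w - q xi w - q eta w)).
  exact: (integrableB measurableT i1 (iq eta)).
rewrite (ae_eq_Rint (g := fun w => 2^-1 * (q (xi + eta) w - q xi w - q eta w))).
- rewrite (RintegralZl _ measurableT i2) (RintegralB measurableT i1 (iq eta)).
  rewrite (RintegralB measurableT (iq (xi + eta)) (iq xi)).
  rewrite !indic_increment_variance //.
  by rewrite (sqr_normD hXi) ?mulr2n; field.
- by apply: measurable_funM => //; exact: measurable_funM.
- apply: measurable_funM => //; apply/measurable_EFinP; exact: measurable_int i2.
- have := increment_linear 1 xi eta ts sr rT.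
  by apply: filterS => w; rewrite scale1r mul1r /q => ->; field.
Qed.

(** The scalar factor of an elementary integral, whose vector factor is [el_h]. *)
Definition cut_increment (A : set Omega) s r xi w : R := \1_A w * D s r xi w.
Local Notation J := cut_increment.

Lemma cut_increment_split A s m r xi : J A s r xi = fun w => J A s m xi w + J A m r xi w.
Proof. by apply/funext => w; rewrite /cut_increment (increment_split s m) mulrDr. Qed.

Lemma cut_increment_sqr A s r xi : t <= s -> s <= r -> r <= T -> F s A ->
  sqr_integrable P (J A s r xi).
Proof.
move=> ts sr rT FA; apply: sqr_integrable_indic.
  exact: (filtration_measurable (le_trans sr rT)).
exact: sqr_integrable_increment.
Qed.

Lemma cut_increment_adapted A s r xi : t <= s -> s <= r -> F s A -> adapted r (J A s r xi).
Proof.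
move=> ts sr FA; apply: measurable_funM.
  by apply: adapted_indic; exact: filtration_mono FA.
by apply: adapted_increment; rewrite ts.
Qed.

Lemma cut_increment_future A B s r s' r' xi eta :
  t <= s -> s <= r -> r <= s' -> s' <= r' -> r' <= T ->
  F s A -> F s' B -> l2_dot P (J A s r xi) (J B s' r' eta) = 0.
Proof.
move=> ts sr rs' sr' rT FA FB.
have ts' : t <= s' by rewrite (le_trans ts) // (le_trans sr).
apply: l2_dot_future => //.
  by apply: adapted_mono rs' _; exact: cut_increment_adapted.
by apply: cut_increment_sqr => //; rewrite (le_trans rs') // (le_trans sr').
Qed.

Lemma cut_increment_present A B s r xi eta : t <= s -> s <= r -> r <= T -> F s A -> F s B ->
  l2_dot P (J A s r xi) (J B s r eta) =
  gauss_var * fine (P (A `&` B)) * (r - s) * ipXi xi eta.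
Proof.
move=> ts sr rT FA FB; rewrite -indic_increment_covariance //.
  by apply: eq_Rintegral => w _; rewrite indicI /cut_increment /=; ring.
have [_ _ hU] := smallest_sigma_algebra setT (gens s).
exact: (@measurableI _ (filtered_space s)).
Qed.

(** Cutting both intervals at [s2] and at the smaller right end [p] leaves one common piece, []s2,
    p]]. Every other pair of pieces lies one after the other in time and is orthogonal. *)
Lemma cut_increment_covariance_le A1 A2 s1 r1 s2 r2 xi1 xi2 : t <= s1 -> s1 <= r1 -> r1 <= T ->
  s2 <= r2 -> r2 <= T -> F s1 A1 -> F s2 A2 -> s1 <= s2 ->
  l2_dot P (J A1 s1 r1 xi1) (J A2 s2 r2 xi2) =
  gauss_var * fine (P (A1 `&` A2)) *
  fine (lebesgue_measure (`]s1, r1] `&` `]s2, r2])) * ipXi xi1 xi2.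
Proof.
move=> ts1 sr1 rT1 sr2 rT2 F1 F2 s12.
have [r1s2|s2r1] := leP r1 s2.
  rewrite cut_increment_future // (_ : _ `&` `]s2, r2] = set0) ?measure0 ?mulr0 ?mul0r //.
  apply/seteqP; split=> x //= []; rewrite !in_itv /= => /andP[_ xr1] /andP[s2x _].
  by have := lt_le_trans s2x (le_trans xr1 r1s2); rewrite ltxx.
set p := Num.min r1 r2.
have sp : s2 <= p by rewrite le_min sr2 (ltW s2r1).
have pr1 : p <= r1 by rewrite ge_min lexx.
have pr2 : p <= r2 by rewrite ge_min lexx orbT.
have pT := le_trans pr1 rT1.
have ts2 := le_trans ts1 s12.
have s1p := le_trans s12 sp.
have -> : `]s1, r1] `&` `]s2, r2] = `]s2, p]%classic :> set R.
  apply/seteqP; split=> x /=; rewrite !in_itv /= /p le_min.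
    by move=> [/andP[_ ->] /andP[-> ->]].
  by move=> /andP[s2x /andP[-> ->]]; rewrite s2x (le_lt_trans s12 s2x).
have F12 := filtration_mono s12 F1.
have F1p := filtration_mono s1p F1.
have F2p := filtration_mono sp F2.
rewrite (cut_increment_split A1 s1 s2) (cut_increment_split A1 s2 p r1).
rewrite (cut_increment_split A2 s2 p).
have q1 : sqr_integrable P (J A1 s1 s2 xi1) by apply: cut_increment_sqr => //; exact: le_trans pT.
have q2 : sqr_integrable P (J A1 s2 p xi1) by exact: cut_increment_sqr.
have q3 : sqr_integrable P (J A1 p r1 xi1) by apply: cut_increment_sqr => //; exact: le_trans sp.
have q4 : sqr_integrable P (J A2 s2 p xi2) by exact: cut_increment_sqr.
have q5 : sqr_integrable P (J A2 p r2 xi2) by apply: cut_increment_sqr => //; exact: le_trans sp.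
have q23 := sqr_integrableD q2 q3.
rewrite l2_dotDl ?l2_dotDr //; last exact: sqr_integrableD.
rewrite !l2_dotDl // (cut_increment_present _ _ ts2) //.
rewrite (cut_increment_future _ _ ts1 s12 (lexx s2) sp pT) //.
rewrite (cut_increment_future _ _ ts1 s12 sp pr2 rT2) //.
rewrite (cut_increment_future _ _ ts2 sp (lexx p) pr2 rT2) //.
rewrite (l2_dotC _ (J A1 p r1 xi1) (J A2 s2 p xi2)).
rewrite (cut_increment_future _ _ ts2 sp (lexx p) pr1 rT1) //.
(* Both of these pieces start at [p], but [p] is one of the right ends, so one of them is empty. *)
have -> : l2_dot P (J A1 p r1 xi1) (J A2 p r2 xi2) = 0.
  have zJ A z : J A p p z = cst 0 by apply/funext => w; rewrite /cut_increment increment0 mulr0.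
  have z0 : l2_dot P (cst 0) (J A2 p r2 xi2) = 0.
    rewrite /l2_dot; under eq_Rintegral do rewrite mul0r.
    by rewrite /Rintegral integral0.
  have z1 : l2_dot P (J A1 p r1 xi1) (cst 0) = 0.
    rewrite /l2_dot; under eq_Rintegral do rewrite mulr0.
    by rewrite /Rintegral integral0.
  have [e|e] : p = r1 \/ p = r2 by rewrite /p; case: leP; [left|right].
    by rewrite -{1}e zJ.
  by rewrite -{1}e zJ.
rewrite lebesgue_measure_itv /= lte_fin.
case: ltP => [|ps]; first by rewrite !addr0 !add0r.
by rewrite (_ : p = s2) ?subrr ?mulr0 ?mul0r ?addr0 //; apply/eqP; rewrite eq_le ps.
Qed.

Lemma elementary_covariance A1 A2 s1 r1 s2 r2 xi1 xi2 :
  t <= s1 -> s1 <= r1 -> r1 <= T -> t <= s2 -> s2 <= r2 -> r2 <= T ->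
  F s1 A1 -> F s2 A2 ->
  l2_dot P (J A1 s1 r1 xi1) (J A2 s2 r2 xi2) =
  gauss_var * fine (P (A1 `&` A2)) *
  fine (lebesgue_measure (`]s1, r1] `&` `]s2, r2])) * ipXi xi1 xi2.
Proof.
move=> ts1 sr1 rT1 ts2 sr2 rT2 F1 F2.
have [s12|/ltW s21] := leP s1 s2; first exact: cut_increment_covariance_le.
rewrite l2_dotC setIC (setIC `]s1, r1]%classic) (ipC ipXi).
exact: cut_increment_covariance_le.
Qed.

End WienerProcess.

(** * Ito integral *)

Section HilbertSchmidtNorm2.
Variables (R : realType) (Xi H : completeNormedModType R).
Variable ipXi : {dot Xi for (@idfun R)}.
Hypothesis hXi : norm_from_dot ipXi.
Hypothesis sepXi : separable Xi.
Variable E : set Xi.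
Hypothesis hE : orthonormal_basis ipXi E.
Implicit Types f g : Xi -> H.

Lemma HS_norm2_ge0 f : (0 <= HS_norm2 E f)%E.
Proof. by apply: esum_ge0 => e _; rewrite lee_fin sqr_ge0. Qed.

Lemma HS_norm2_le f g : (forall xi, `|f xi| <= `|g xi|) -> (HS_norm2 E f <= HS_norm2 E g)%E.
Proof.
move=> fg; apply: le_esum => e _; rewrite lee_fin.
by rewrite ler_pXn2r ?nnegrE.
Qed.

Lemma HS_norm2_lin (k : R) f g :
  (HS_norm2 E (fun xi => (k *: f xi + g xi)%R) <=
   (2 * k ^+ 2)%:E * HS_norm2 E f + 2%:E * HS_norm2 E g)%E.
Proof.
have [P [u uE]] := countable_enum hXi hE sepXi.
have k0 : 0 <= 2 * k ^+ 2 by apply: mulr_ge0 => //; exact: sqr_ge0.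
rewrite !(HS_norm2E uE) -!nneseriesZl //.
rewrite -nneseriesD.
- apply: lee_nneseries => [n _ _|n Pn]; first by rewrite lee_fin sqr_ge0.
  by rewrite -!EFinM -EFinD lee_fin; exact: sqr_norm_le2.
- by move=> n _ _; rewrite mule_ge0 // lee_fin sqr_ge0.
- by move=> n _ _; rewrite mule_ge0 // lee_fin sqr_ge0.
Qed.

Lemma HS_norm2Z (k : R) f :
  (HS_norm2 E (fun xi => (k *: f xi)%R) = (k ^+ 2)%:E * HS_norm2 E f)%E.
Proof.
have [P [u uE]] := countable_enum hXi hE sepXi.
rewrite !(HS_norm2E uE) -nneseriesZl.
- apply: eq_eseriesr => n Pn.
  by rewrite normrZ exprMn real_normK ?num_real // EFinM.
- by move=> n _; rewrite lee_fin sqr_ge0.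
Qed.

Lemma measurable_HS_norm2 d (S : measurableType d) (D : set S) (Phi : S -> Xi -> H) :
  measurable D -> (forall xi, measurable_in D (fun z => Phi z xi)) ->
  measurable_fun D (fun z => HS_norm2 E (Phi z)).
Proof.
move=> mD mPhi.
have [P [u uE]] := countable_enum hXi hE sepXi.
under eq_fun do rewrite (HS_norm2E uE).
apply: ge0_emeasurable_sum => [n z _ _|n _]; first by rewrite lee_fin sqr_ge0.
apply/measurable_EFinP; apply: measurable_funX.
by apply: measurable_in_norm; exact: mPhi.
Qed.

End HilbertSchmidtNorm2.

(** * Progressive measurability *)

Section Progressive.
Context (R : realType) d (Omega : measurableType d) (P : probability Omega R).
Hypothesis complP : measure_is_complete P.
Variables (Xi : completeNormedModType R).
Variables (W : R -> Xi -> Omega -> R) (t T : R).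
Hypothesis hW : cylindrical_wiener P W t T.
Local Notation F := (wiener_filtration P W t).

(** The sigma-algebra written out in [progressive], named so that it can serve as the system [M] of
    [smeasurable]. *)
Definition progressive_sets (s : R) : set (set (R * Omega)) :=
  <<s slab t s,
      [set C | exists I G, [/\ measurable I, I `<=` `[t, s], F s G & C = I `*` G]] >>.

Lemma progressiveP (s : R) (V : topologicalType) (Y : R -> Omega -> V) :
  progressive t s F Y <-> forall r, t <= r <= s ->
    smeasurable (slab t r) (progressive_sets r) (fun z => Y z.1 z.2).
Proof.
split=> h r trs U hU.
  apply: h => //; exact: sub_sigma_algebra.
by apply: smeasurable_borel (h r trs) _ hU; exact: smallest_sigma_algebra.
Qed.

Lemma progressive_sets_measurable s : s <= T -> progressive_sets s `<=` measurable.
Proof.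
move=> sT.
suff h : progressive_sets s `<=` [set A | measurable A /\ A `<=` slab t s].
  by move=> A /h [].
apply: smallest_sub; first exact: (sigma_algebra_measurable_in (measurable_slab t s)).
move=> C [I [G [mI Its FG ->]]]; split.
  by apply: measurableX => //; exact: (filtration_measurable complP hW sT).
by move=> z [/= /Its ? _]; split.
Qed.

(** Joint measurability on the slab is the form in which progressive processes meet Tonelli's
    theorem. *)
Lemma progressive_measurable s (V : topologicalType) (Y : R -> Omega -> V) :
  t <= s -> s <= T -> progressive t s F Y -> measurable_in (slab t s) (fun z => Y z.1 z.2).
Proof.
move=> ts sT /progressiveP /(_ s) hY U oU; split; last exact: subIsetl.
by apply: (progressive_sets_measurable sT); apply: hY; rewrite ?ts ?lexx.
Qed.

Lemma progressive_lin s (V : normedModType R) (k : R) (Y Z : R -> Omega -> V) :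
  separable V -> progressive t s F Y -> progressive t s F Z ->
  progressive t s F (fun r w => k *: Y r w + Z r w).
Proof.
move=> sV /progressiveP hY /progressiveP hZ; apply/progressiveP => r trs.
apply: smeasurable_lin => //; [exact: smallest_sigma_algebra|exact: hY|exact: hZ].
Qed.

Lemma progressive_le s s' (V : topologicalType) (Y : R -> Omega -> V) :
  s <= s' -> progressive t s' F Y -> progressive t s F Y.
Proof.
move=> ss' hY r /andP[tr rs]; apply: hY.
by rewrite tr (le_trans rs).
Qed.

Lemma borel_measurableP (V : topologicalType) (I : Omega -> V) :
  borel_measurable I <-> measurable_in setT I.
Proof.
split=> h U hU.
  by split=> //; rewrite setTI; apply: h; exact: sub_sigma_algebra.
by have [] := smeasurable_borel (sigma_algebra_measurable_in measurableT) h hU;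
  rewrite setTI.
Qed.

Lemma progressive_section s (V : topologicalType) (Y : R -> Omega -> V) :
  t <= s -> s <= T -> progressive t s F Y -> borel_measurable (Y s).
Proof.
move=> ts sT /(progressive_measurable ts sT) hY; apply/borel_measurableP => U oU.
split=> //; have [mA _] := hY U oU.
rewrite (_ : _ `&` _ = xsection (slab t s `&` (fun z => Y z.1 z.2) @^-1` U) s).
  exact: measurable_xsection.
apply/seteqP; split=> w /=; rewrite /xsection /= inE.
  by move=> [_ UY]; split=> //; split=> //=; rewrite in_itv /= ts lexx.
by move=> [].
Qed.

End Progressive.

Section ItoIntegral.
Context (R : realType) d (Omega : measurableType d) (P : probability Omega R).
Hypothesis complP : measure_is_complete P.
Variables (Xi H : completeNormedModType R).
Variables (ipXi : {dot Xi for (@idfun R)}) (ip : {dot H for (@idfun R)}).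
Hypotheses (hXi : norm_from_dot ipXi) (hH : norm_from_dot ip).
Hypotheses (sepXi : separable Xi) (sepH : separable H).
Variable E : set Xi.
Hypothesis hE : orthonormal_basis ipXi E.
Variables (W : R -> Xi -> Omega -> R) (t T : R).
Hypothesis hW : cylindrical_wiener P W t T.
Local Notation F := (wiener_filtration P W t).
Local Notation mu := (@lebesgue_measure R).
Implicit Types (e : elementary Omega Xi H) (es : seq (elementary Omega Xi H)).

Variable s : R.
Hypotheses (ts : t <= s) (sT : s <= T).

Let J e := cut_increment W (el_ev e) (el_lo e) (el_hi e) (el_xi e).

Lemma elementary_ok_sqr e : elementary_ok P W t s e -> sqr_integrable P (J e).
Proof.
case=> tl lh hs Fe; apply: (cut_increment_sqr complP hW) => //.
exact: le_trans sT.
Qed.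

Lemma elementary_ok_measurable e : elementary_ok P W t s e -> measurable (el_ev e).
Proof.
case=> tl lh hs; apply: (filtration_measurable complP hW).
by rewrite (le_trans lh) // (le_trans hs).
Qed.

Lemma measurable_step_eval es xi :
  (forall e, e \in es -> elementary_ok P W t s e) ->
  measurable_in (slab t s) (fun z => step_eval ipXi es z.1 z.2 xi).
Proof.
elim: es => [|e es ih] ok; rewrite /step_eval.
  under eq_fun do rewrite big_nil; apply: measurable_in_cst; exact: measurable_slab.
have oke : elementary_ok P W t s e by apply: ok; rewrite mem_head.
under eq_fun do rewrite big_cons -[X in X + _]scale1r.
apply: measurable_in_lin => //; first exact: measurable_slab.
  rewrite (_ : (fun z => _) = (fun z => (\1_(`]el_lo e, el_hi e] `*` el_ev e) z : R) *:
      (ipXi (el_xi e) xi *: el_h e))).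
    apply: measurable_in_indic; first exact: measurable_slab.
    by apply: measurableX => //; exact: elementary_ok_measurable.
  apply/funext => z; rewrite /elementary_eval scalerA; congr (_ * _ *: _).
  by rewrite !indicE in_setX; case: (_ \in _); case: (_ \in _); rewrite ?mulr1 ?mulr0.
by apply: ih => e' he'; apply: ok; rewrite in_cons he' orbT.
Qed.

Lemma measurable_step_integral es :
  (forall e, e \in es -> elementary_ok P W t s e) ->
  measurable_in setT (step_integral W es).
Proof.
elim: es => [|e es ih] ok; rewrite /step_integral.
  under eq_fun do rewrite big_nil; exact: measurable_in_cst.
have oke : elementary_ok P W t s e by apply: ok; rewrite mem_head.
under eq_fun do rewrite big_cons -[X in X + _]scale1r.
apply: measurable_in_lin => //.
  rewrite /elementary_integral -/(J e).
  apply: (@smeasurable_comp _ _ _ R H (fun a => a *: el_h e) (J e)).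
    by move=> a; apply: cvgZl; exact: cvg_id.
  move=> U oU; split => //; have [mJ _] := elementary_ok_sqr oke.
  by apply: mJ => //; exact: open_measurable.
by apply: ih => e' he'; apply: ok; rewrite in_cons he' orbT.
Qed.

(* The Ito isometry, as an inequality and up to the constant [gauss_var]. *)
Lemma step_integral_le es : (forall e, e \in es -> elementary_ok P W t s e) ->
  (\int[P]_w (`|step_integral W es w| ^+ 2)%:E <=
   (gauss_var R)%:E * \int[P]_w \int[mu]_(r in `[t, s])
      HS_norm2 E (step_eval ipXi es r w))%E.
Proof.
move=> ok.
pose n := size es; pose e (i : 'I_n) := tnth (in_tuple es) i.
have eok i : elementary_ok P W t s (e i) by apply: ok; exact: mem_tnth.
pose I i := `]el_lo (e i), el_hi (e i)]%classic.
pose A i := el_ev (e i).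
(* Both sides will be the double sum of [k i j * a i j]: on the left [k] arises from covariances of
   cut increments, on the right as the measure of the rectangle of times and events on which two
   summands are both active. *)
pose a i j := ipXi (el_xi (e i)) (el_xi (e j)) * ip (el_h (e i)) (el_h (e j)).
pose k i j := fine (P (A i `&` A j)) * fine (mu (I i `&` I j)).
have lhs : (\int[P]_w (`|step_integral W es w| ^+ 2)%:E =
    (gauss_var R * \sum_i \sum_j k i j * a i j)%:E)%E.
  have Esq w : `|step_integral W es w| ^+ 2 =
      \sum_i \sum_j ip (el_h (e i)) (el_h (e j)) * (J (e i) w * J (e j) w).
    rewrite hH /step_integral big_tnth ip_suml; apply: eq_bigr => i _.
    rewrite ip_sumr; apply: eq_bigr => j _.
    by rewrite /elementary_integral ipZl ipZr /J /cut_increment /e; ring.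
  under eq_integral do rewrite Esq.
  rewrite integral_double_sum // => [|i j]; last first.
    by apply: sqr_integrable_mul; exact: elementary_ok_sqr.
  congr EFin; rewrite mulr_sumr; apply: eq_bigr => i _.
  rewrite mulr_sumr; apply: eq_bigr => j _.
  have := @elementary_covariance _ _ _ _ complP _ _ hXi _ _ _ hW (A i) (A j)
    (el_lo (e i)) (el_hi (e i)) (el_lo (e j)) (el_hi (e j)) (el_xi (e i)) (el_xi (e j)).
  case: (eok i) => tli lhi his Fi; case: (eok j) => tlj lhj hjs Fj.
  rewrite /l2_dot /J => -> //; try exact: le_trans sT.
  by rewrite /k /a; ring.
pose c r w i : R := (\1_(I i) r : R) * (\1_(A i) w : R).
(* The Gram sum of the step process at a fixed [(r, w)], a finite-rank operator there. It is a
   finite sum of indicators, hence integrable term by term, and it lies below the Hilbert-Schmidt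
   norm. *)
pose Q r w := \sum_i \sum_j c r w i * c r w j *
  ipXi (el_xi (e i)) (el_xi (e j)) * ip (el_h (e i)) (el_h (e j)).
have seE r w : step_eval ipXi es r w = fun xi =>
    \sum_i (c r w i * ipXi (el_xi (e i)) xi) *: el_h (e i).
  by apply/funext => xi; rewrite /step_eval big_tnth.
have [N [u uE]] := countable_enum hXi hE sepXi.
have Q0 r w : 0 <= Q r w by exact: (finite_rank_gram_ge0 hXi hE uE hH).
have QHS r w : ((Q r w)%:E <= HS_norm2 E (step_eval ipXi es r w))%E.
  by rewrite seE; exact: (finite_rank_gram_le hXi hE uE hH).
pose Sij i j : set (R * Omega) := (I i `&` I j) `*` (A i `&` A j).
have mA i : measurable (A i) by exact: elementary_ok_measurable.
have mI i : measurable (I i) by exact: measurable_itv.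
have mS i j : measurable (Sij i j).
  by apply: measurableX; apply: measurableI.
have QE z : Q z.1 z.2 = \sum_i \sum_j a i j * (\1_(Sij i j) z : R).
  apply: eq_bigr => i _; apply: eq_bigr => j _; rewrite /a /c !indicE !in_setX !in_setI.
  by case: (_ \in I i); case: (_ \in I j); case: (_ \in A i); case: (_ \in A j);
    rewrite /=; ring.
have IJ i j : I i `&` I j `<=` `[t, s].
  move=> r [/= + _]; case: (eok i) => tl _ hs _; rewrite /I /= !in_itv /= => /andP[lr rh].
  by rewrite (le_trans tl (ltW lr)) (le_trans rh hs).
have Ifin i j : (mu (I i `&` I j) < +oo)%E.
  apply: (@le_lt_trans _ _ (mu `[t, s])).
    by apply: le_measure; rewrite ?inE; [apply: measurableI; exact: mI|exact: measurable_itv|exact: IJ].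
  by rewrite /= lebesgue_measure_itv /=; case: ifP => _; rewrite ?ltry.
have S_meas i j : (mu \x P)%E (Sij i j) = (k i j)%:E.
  rewrite product_measure1E; [|apply: measurableI; exact: mI|apply: measurableI; exact: mA].
  have f1 : mu (I i `&` I j) \is a fin_num by rewrite ge0_fin_numE.
  have f2 : P (A i `&` A j) \is a fin_num.
    by apply: fin_num_measure; apply: measurableI; exact: mA.
  by rewrite /k mulrC EFinM; congr (_ * _)%E; rewrite fineK.
have SD i j : Sij i j `&` slab t s = Sij i j.
  by apply/setIidPl => z [/IJ ? _]; split.
have iS i j : (mu \x P)%E.-integrable (slab t s) (EFin \o (\1_(Sij i j) : R * Omega -> R)).
  apply/integrableP; split.
    by apply/measurable_EFinP; apply: measurable_indic; exact: mS.
  under eq_integral do rewrite gee0_abs ?lee_fin //.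
  rewrite integral_indic; [|exact: measurable_slab|exact: mS].
  by rewrite SD [X in (X < _)%E](S_meas i j) ltry.
have rhs : (\int[P]_w \int[mu]_(r in `[t, s]) (Q r w)%:E =
    (\sum_i \sum_j k i j * a i j)%:E)%E.
  have mQ : measurable_fun (slab t s) (fun z => (Q z.1 z.2)%:E).
    apply/measurable_EFinP; under eq_fun do rewrite QE.
    apply: measurable_sum => i; apply: measurable_sum => j.
    by apply: measurable_funM => //; apply: measurable_indic; exact: mS.
  rewrite (dint_prod _ _ mQ) //.
  under eq_integral do rewrite QE.
  rewrite integral_double_sum //; last exact: measurable_slab.
  congr EFin; apply: eq_bigr => i _; apply: eq_bigr => j _.
  rewrite /Rintegral integral_indic; [|exact: measurable_slab|exact: mS].
  by rewrite SD [X in fine X](S_meas i j) mulrC.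
rewrite lhs EFinM -rhs; apply: lee_wpmul2l; first by rewrite lee_fin gauss_var_ge0.
by apply: dint_mono => r w _; rewrite lee_fin Q0 QHS.
Qed.

Lemma measurable_ito_integrand (Phi : R -> Omega -> Xi -> H) :
  (forall xi, progressive t s F (fun r w => Phi r w xi)) ->
  measurable_fun (slab t s) (fun z => HS_norm2 E (Phi z.1 z.2)).
Proof.
move=> pPhi; apply: (measurable_HS_norm2 hXi sepXi hE); first exact: measurable_slab.
by move=> xi; exact: (progressive_measurable complP hW ts sT (pPhi xi)).
Qed.

Lemma measurable_step_error (Phi : R -> Omega -> Xi -> H) es :
  (forall xi, progressive t s F (fun r w => Phi r w xi)) ->
  (forall e, e \in es -> elementary_ok P W t s e) ->
  measurable_fun (slab t s)
    (fun z => HS_norm2 E (fun xi => Phi z.1 z.2 xi - step_eval ipXi es z.1 z.2 xi)).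
Proof.
move=> pPhi ok; apply: (measurable_HS_norm2 hXi sepXi hE); first exact: measurable_slab.
move=> xi; apply: measurable_in_sub => //; first exact: measurable_slab.
  exact: (progressive_measurable complP hW ts sT (pPhi xi)).
exact: measurable_step_eval.
Qed.

Lemma measurable_integral_error (I : Omega -> H) es : borel_measurable I ->
  (forall e, e \in es -> elementary_ok P W t s e) ->
  measurable_fun setT (fun w => (`|I w - step_integral W es w| ^+ 2)%:E).
Proof.
move=> /borel_measurableP mI ok; apply/measurable_EFinP; apply: measurable_funX.
apply: measurable_in_norm => //; apply: measurable_in_sub => //.
exact: measurable_step_integral.
Qed.

(** The step approximation is inserted once in the integral and once in the integrand, each time at
    the cost of a factor 2; this is the 4. Both error terms vanish in the limit. *)
Lemma ito_integral_le (Phi : R -> Omega -> Xi -> H) (I : Omega -> H) :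
  is_ito_integral P ipXi W E t s Phi I ->
  (\int[P]_w (`|I w| ^+ 2)%:E <=
   (4 * gauss_var R)%:E * \int[P]_w \int[mu]_(r in `[t, s]) HS_norm2 E (Phi r w))%E.
Proof.
case=> pPhi mI [en [ok c1 c2]].
have g0 := gauss_var_ge0 R.
set B := (\int[P]_w \int[mu]_(r in `[t, s]) HS_norm2 E (Phi r w))%E.
pose a n := (\int[P]_w (`|I w - step_integral W (en n) w| ^+ 2)%:E)%E.
pose b n := (\int[P]_w \int[mu]_(r in `[t, s])
  HS_norm2 E (fun xi => (Phi r w xi - step_eval ipXi (en n) r w xi)%R))%E.
have cv : ((fun n => 2%:E * a n + 2%:E * ((gauss_var R)%:E * (2%:E * b n + 2%:E * B)))
    @ \oo --> 2%:E * 0 + 2%:E * ((gauss_var R)%:E * (2%:E * 0 + 2%:E * B)))%E.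
  apply: cvgeD; first by rewrite mule0.
    exact: cvgeZl.
  do 2 apply: cvgeZl => //; apply: cvgeD; first by rewrite mule0.
    exact: cvgeZl.
  exact: cvg_cst.
have <- : (2%:E * 0 + 2%:E * ((gauss_var R)%:E * (2%:E * 0 + 2%:E * B)) =
    (4 * gauss_var R)%:E * B)%E.
  rewrite !mule0 !add0e !muleA -!EFinM; congr ((_)%:E * _)%E; ring.
apply: cvge_ge cv; apply: nearW => n.
have stepM : measurable_fun setT (fun w => (`|step_integral W (en n) w| ^+ 2)%:E).
  apply/measurable_EFinP; apply: measurable_funX; apply: measurable_in_norm => //.
  exact: measurable_step_integral (ok n).
apply: (@le_trans _ _ (2%:E * a n + 2%:E *
    \int[P]_w (`|step_integral W (en n) w| ^+ 2)%:E)%E).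
  apply: ge0_le_integral_lin => //; try by move=> w _; rewrite lee_fin sqr_ge0.
    exact: measurable_integral_error (ok n).
  move=> w _; rewrite -!EFinM -EFinD lee_fin.
  have := sqr_norm_le2 1 (I w - step_integral W (en n) w) (step_integral W (en n) w).
  by rewrite scale1r subrK expr1n mulr1.
apply: leeD2l; apply: lee_wpmul2l => //.
apply: le_trans (step_integral_le (ok n)) _; apply: lee_wpmul2l => //.
apply: dint_le_lin => //; try by move=> r w; exact: HS_norm2_ge0.
- exact: measurable_step_error pPhi (ok n).
- exact: measurable_ito_integrand.
- move=> r w _.
  have := HS_norm2_lin hXi sepXi hE (-1)
    (fun xi => Phi r w xi - step_eval ipXi (en n) r w xi) (Phi r w).
  rewrite sqrrN expr1n mulr1; apply: le_trans; apply: HS_norm2_le => xi.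
  by rewrite scaleN1r opprB subrK.
Qed.

Lemma ito_integral_lin (k : R) (Phi Psi : R -> Omega -> Xi -> H) (I K : Omega -> H) :
  is_ito_integral P ipXi W E t s Phi I -> is_ito_integral P ipXi W E t s Psi K ->
  is_ito_integral P ipXi W E t s (fun r w xi => k *: Phi r w xi + Psi r w xi)
    (fun w => k *: I w + K w).
Proof.
case=> pPhi mI [en [eok e1 e2]] [pPsi mK [fn [fok f1 f2]]]; split.
- by move=> xi; apply: progressive_lin.
- by apply/borel_measurableP; apply: measurable_in_lin => //; exact/borel_measurableP.
pose scale_el e := Elementary (el_lo e) (el_hi e) (el_ev e) (el_xi e) (k *: el_h e).
(* Step processes are lists too: scaling acts on the vectors [el_h], addition is concatenation, and
   neither affects the events or the times. *)
pose gn n := map scale_el (en n) ++ fn n.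
have gE n r w xi : step_eval ipXi (gn n) r w xi =
    k *: step_eval ipXi (en n) r w xi + step_eval ipXi (fn n) r w xi.
  rewrite /step_eval big_cat big_map scaler_sumr; congr (_ + _).
  by apply: eq_bigr => e _; rewrite /elementary_eval /= !scalerA mulrC.
have gI n w : step_integral W (gn n) w =
    k *: step_integral W (en n) w + step_integral W (fn n) w.
  rewrite /step_integral big_cat big_map scaler_sumr; congr (_ + _).
  by apply: eq_bigr => e _; rewrite /elementary_integral /= !scalerA mulrC.
have k0 : 0 <= 2 * k ^+ 2 by apply: mulr_ge0 => //; exact: sqr_ge0.
have lim0 (a b : nat -> \bar R) : (a @ \oo --> 0)%E -> (b @ \oo --> 0)%E ->
    ((fun n => (2 * k ^+ 2)%:E * a n + 2%:E * b n) @ \oo --> 0)%E.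
  move=> ca cb; have : ((fun n => (2 * k ^+ 2)%:E * a n + 2%:E * b n) @ \oo -->
      (2 * k ^+ 2)%:E * 0 + 2%:E * 0)%E.
    by apply: cvgeD; [rewrite !mule0|exact: cvgeZl|exact: cvgeZl].
  by rewrite !mule0 adde0.
exists gn; split.
- move=> n e; rewrite mem_cat => /orP[/mapP[e' he' ->]|]; last exact: fok.
  by case: (eok _ _ he').
- apply: (squeeze_cvge _ (cvg_cst 0%E) (lim0 _ _ e1 f1)); apply: nearW => n.
  apply/andP; split.
    by apply: integral_ge0 => w _; apply: integral_ge0 => r _; exact: HS_norm2_ge0.
  apply: dint_le_lin => //; try by move=> r w; exact: HS_norm2_ge0.
  + exact: measurable_step_error pPhi (eok n).
  + exact: measurable_step_error pPsi (fok n).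
  + move=> r w _; apply: le_trans (HS_norm2_lin hXi sepXi hE k _ _).
    apply: HS_norm2_le => xi; rewrite gE scalerBr opprD addrACA //.
- apply: (squeeze_cvge _ (cvg_cst 0%E) (lim0 _ _ e2 f2)); apply: nearW => n.
  apply/andP; split; first by apply: integral_ge0 => w _; rewrite lee_fin sqr_ge0.
  apply: ge0_le_integral_lin => //; try by move=> w _; rewrite lee_fin sqr_ge0.
  + exact: measurable_integral_error (eok n).
  + exact: measurable_integral_error (fok n).
  + move=> w _; rewrite -!EFinM -EFinD lee_fin gI.
    apply: le_trans (sqr_norm_le2 k _ _).
    by rewrite scalerBr opprD addrACA.
Qed.

End ItoIntegral.

(** * Affine Lipschitz maps and a Gronwall lemma *)

Section AffineMaps.
Variable R : realType.

Lemma affine_scale0 (U V : lmodType R) (f : U -> V) : affine f ->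
  forall k x, f (k *: x) - f 0 = k *: (f x - f 0).
Proof.
move=> af k x; have := af k x 0; rewrite scaler0 addr0 => ->.
by rewrite scalerBr scalerBl scale1r addrA addrAC addrK.
Qed.

(** [x - y] is the midpoint of [2 x] and [- 2 y], and homogeneity of [f - f 0] removes the
    factors. *)
Lemma affine_sub (U V : lmodType R) (f : U -> V) : affine f ->
  forall x y, f x - f y = f (x - y) - f 0.
Proof.
move=> af x y.
have h := af 2^-1 (2 *: x) (2 *: - y).
have half : 1 - 2^-1 = 2^-1 :> R by field.
rewrite half !scalerA mulVf ?pnatr_eq0 // !scale1r in h.
have -> : f (x - y) - f 0 =
    2^-1 *: (f (2 *: x) - f 0) + 2^-1 *: (f ((- 2) *: y) - f 0).
  rewrite h !scalerBr addrACA -opprD -scalerDl scalerN scaleNr.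
  by rewrite (_ : 2^-1 + 2^-1 = 1) ?scale1r //; field.
rewrite !(affine_scale0 af) !scalerA mulVf ?pnatr_eq0 // mulrN mulVf ?pnatr_eq0 //.
by rewrite scale1r scaleN1r opprB addrA subrK.
Qed.

(** Continuity at 0 bounds [f - f 0] by 1 on a ball of radius [dl]; by homogeneity and additivity
    the bound spreads to all differences. *)
Lemma affine_continuous_lipschitz (U V : normedModType R) (f : U -> V) :
  affine f -> continuous f ->
  exists2 K : R, 0 <= K & forall x y, `|f x - f y| <= K * `|x - y|.
Proof.
move=> af cf.
have /cvgrPdist_le /(_ 1 ltr01) := cf 0.
move=> /nbhs_ballP [dl /= dl0 hdl].
exists (2 / dl) => [|x y]; first by rewrite divr_ge0 // ltW.
rewrite affine_sub //; set z := x - y.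
have [z0|z0] := eqVneq z 0; first by rewrite z0 subrr !normr0 mulr0.
have nz : 0 < `|z| by rewrite normr_gt0.
(* Brings [z] to norm [dl / 2], strictly inside the ball; this is the origin of the constant
   [2 / dl]. *)
pose c := dl / 2 / `|z|.
have c0 : 0 < c by rewrite !divr_gt0.
have : `|f 0 - f (c *: z)| <= 1.
  apply: hdl; rewrite -ball_normE /= sub0r normrN normrZ gtr0_norm //.
  by rewrite /c divfK ?gt_eqF // ltr_pdivrMr // mulr_natr mulr2n ltrDl.
rewrite distrC affine_scale0 // normrZ gtr0_norm // => h.
rewrite -(ler_pM2l c0); apply: le_trans h _.
by rewrite /c le_eqVlt; apply/orP; left; apply/eqP; field; rewrite !gt_eqF.
Qed.

End AffineMaps.

Section HSLipschitz.
Variables (R : realType) (Xi H : completeNormedModType R).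
Variable ipXi : {dot Xi for (@idfun R)}.
Hypothesis hXi : norm_from_dot ipXi.
Hypothesis sepXi : separable Xi.
Variable E : set Xi.
Hypothesis hE : orthonormal_basis ipXi E.

(** The same rescaling for the squared Hilbert-Schmidt norm, which is homogeneous of degree two;
    hence the squared constant. *)
Lemma HS_affine_lipschitz (U : normedModType R) (f : U -> Xi -> H) :
  (forall xi, affine (fun z => f z xi)) -> HS_continuous E f ->
  exists2 K : R, 0 <= K & forall x y,
    (HS_norm2 E (fun xi => (f x xi - f y xi)%R) <= (K * `|x - y| ^+ 2)%:E)%E.
Proof.
move=> af cf.
have h1 : \forall z \near (0 : U), (HS_norm2 E (fun xi => (f z xi - f 0 xi)%R) < 1)%E.
  apply: (cf 0 [set x | (x < 1)%E]); apply: open_nbhs_nbhs; split.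
    exact: open_ereal_lt_ereal.
  by rewrite /= lte_fin.
move: h1 => /nbhs_ballP [dl /= dl0 hdl].
exists ((2 / dl) ^+ 2) => [|x y]; first by rewrite sqr_ge0.
have -> : (fun xi => f x xi - f y xi) = (fun xi => f (x - y) xi - f 0 xi).
  by apply/funext => xi; exact: (affine_sub (af xi)).
set z := x - y.
have [z0|z0] := eqVneq z 0.
  rewrite z0 (_ : (fun xi => _) = (fun xi => 0 *: (f 0 xi))); last first.
    by apply/funext => xi; rewrite subrr scale0r.
  by rewrite (HS_norm2Z hXi sepXi hE) expr0n mul0e normr0 expr0n mulr0.
have nz : 0 < `|z| by rewrite normr_gt0.
pose c := dl / 2 / `|z|.
have c0 : 0 < c by rewrite !divr_gt0.
have : (HS_norm2 E (fun xi => (f (c *: z) xi - f 0 xi)%R) < 1)%E.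
  apply: hdl; rewrite -ball_normE /= sub0r normrN normrZ gtr0_norm //.
  by rewrite /c divfK ?gt_eqF // ltr_pdivrMr // mulr_natr mulr2n ltrDl.
have -> : (fun xi => f (c *: z) xi - f 0 xi) = (fun xi => c *: (f z xi - f 0 xi)).
  by apply/funext => xi; exact: (affine_scale0 (af xi)).
rewrite (HS_norm2Z hXi sepXi hE) => h.
have c20 : 0 < c ^+ 2 by rewrite exprn_gt0.
rewrite -(@lee_pmul2l _ (c ^+ 2)%:E) // ?lte_fin //.
apply: le_trans (ltW h) _; rewrite -EFinM lee_fin.
by rewrite /c le_eqVlt; apply/orP; left; apply/eqP; field; rewrite !gt_eqF.
Qed.

End HSLipschitz.

Section Gronwall.
Variable R : realType.
Local Notation mu := (@lebesgue_measure R).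
Local Open Scope ereal_scope.

Lemma lebesgue_measure_itvcc_le (a b c : R) : (0 <= c)%R -> (b - a <= c)%R ->
  mu `[a, b] <= c%:E.
Proof.
move=> c0 abc; rewrite lebesgue_measure_itv /= lte_fin.
by case: ltP => _; rewrite ?lee_fin // -EFinD lee_fin.
Qed.

(* Gronwall's lemma, by steps of length [1 / (2 K)]: if [u] vanishes up to time
   [q] then its integral [I] over the next step satisfies [I <= I / 2]. *)
Lemma gronwall_zero (t T K : R) (u : R -> \bar R) : (0 < K)%R ->
  measurable_fun `[t, T] u ->
  (forall s, (t <= s <= T)%R -> 0 <= u s) ->
  \int[mu]_(s in `[t, T]) u s < +oo ->
  (forall s, (t <= s <= T)%R -> u s <= K%:E * \int[mu]_(r in `[t, s]) u r) ->
  forall s, (t <= s <= T)%R -> u s = 0.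
Proof.
move=> K0 mu_ u0 ufin hu.
pose dl := (2 * K)^-1%R.
have dl0 : (0 < dl)%R by rewrite invr_gt0 mulr_gt0.
have uI s : (t <= s)%R -> (s <= T)%R -> 0 <= \int[mu]_(r in `[t, s]) u r.
  move=> ts sT; apply: integral_ge0 => r /=; rewrite in_itv /= => /andP[tr rs].
  by apply: u0; rewrite tr (le_trans rs).
have sub s : (s <= T)%R -> `[t, s] `<=` `[t, T]%classic.
  by move=> sT r /=; rewrite !in_itv /= => /andP[-> rs]; rewrite (le_trans rs).
(* Induction on the number of steps, the claim at stage [n] being that [u] vanishes up to
   [t + n dl]. *)
suff step n s : (t <= s <= T)%R -> (s <= t + n%:R * dl)%R -> u s = 0.
  move=> s tsT; have [n hn] : exists n : nat, (s - t <= n%:R * dl)%R.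
    exists (Num.bound ((s - t) / dl)); rewrite -ler_pdivrMr // ltW // archi_boundP //.
    by apply: divr_ge0; [rewrite subr_ge0; case/andP: tsT|exact: ltW].
  by apply: (step n) => //; rewrite -lerBlDl.
elim: n s => [|n ih] s /andP[ts sT] sn.
  have -> : s = t by apply/eqP; rewrite eq_le ts andbT; rewrite mul0r addr0 in sn.
  apply/eqP; rewrite eq_le u0 ?lexx ?(le_trans ts) // andbT.
  have := hu t; rewrite lexx (le_trans ts sT) set_itv1 => /(_ isT).
  by rewrite integral_set1 mule0.
(* The induction hypothesis covers [[t, q]], and the rest [[q, s]] has length at most [dl]. *)
set q := Num.min s (t + n%:R * dl)%R.
have qs : (q <= s)%R by rewrite ge_min lexx.
have tq : (t <= q)%R by rewrite le_min ts lerDl mulr_ge0 // ltW.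
have sq : (s - q <= dl)%R.
  have [e|e] : q = s \/ q = (t + n%:R * dl)%R.
    by rewrite /q; case: (leP s (t + n%:R * dl)%R); [left|right].
  - by rewrite e subrr ltW.
  - by rewrite e; move: sn; rewrite -natr1 mulrDl mul1r; lra.
set I := \int[mu]_(r in `[t, s]) u r.
have Ifin : I \is a fin_num.
  rewrite ge0_fin_numE ?uI //; apply: le_lt_trans ufin.
  by apply: ge0_subset_integral => //; exact: sub.
have uI2 r : (t <= r <= s)%R -> u r <= K%:E * I.
  move=> /andP[tr rs]; apply: le_trans (hu r _) _; first by rewrite tr (le_trans rs).
  apply: lee_wpmul2l; first by rewrite lee_fin ltW.
  apply: ge0_subset_integral => //.
  - by apply: measurable_funS mu_ => //; exact: sub.
  - move=> x /=; rewrite in_itv /= => /andP[tx xs].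
    by apply: u0; rewrite tx (le_trans xs).
  - by move=> x /=; rewrite !in_itv /= => /andP[-> xr]; rewrite (le_trans xr).
have I0 : I <= (2^-1)%:E * I.
  apply: (@le_trans _ _ (\int[mu]_(r in `[t, s]) ((\1_`[q, s] r)%:E * (K%:E * I)))).
    apply: ge0_integral_mono => r /=; rewrite in_itv /= => /andP[tr rs].
      by apply: u0; rewrite tr (le_trans rs).
    rewrite indicE; case: (boolP (r \in _)) => [_|]; first by rewrite mul1e uI2 ?tr.
    rewrite notin_setE /= in_itv /= rs andbT => /negP; rewrite -ltNge => rq.
    rewrite mul0e ih //; first by rewrite tr (le_trans rs).
    by rewrite (le_trans (ltW rq)) // ge_min lexx orbT.
  rewrite ge0_integralZr //; last first.
  - by rewrite mule_ge0 ?uI // lee_fin ltW.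
  - by apply/measurable_EFinP; exact: measurable_indic.
  rewrite integral_indic // (_ : _ `&` _ = `[q, s]%classic); last first.
    apply/seteqP; split=> r /=; rewrite !in_itv /=; first by case.
    by move=> /andP[qr ->]; rewrite qr (le_trans tq).
  rewrite muleA; apply: lee_wpmul2r; first exact: uI.
  rewrite (_ : 2^-1 = dl * K)%R; last by rewrite /dl; field; rewrite gt_eqF.
  rewrite EFinM; apply: lee_wpmul2r; first by rewrite lee_fin ltW.
  by apply: lebesgue_measure_itvcc_le => //; exact: ltW.
have Iz : I = 0.
  move: I0 (uI s ts sT); rewrite -/I -(fineK Ifin) -EFinM !lee_fin => h1 h2.
  by congr EFin; lra.
apply/eqP; rewrite eq_le u0 ?ts // andbT.
by rewrite (le_trans (uI2 s _)) ?ts ?lexx // Iz mule0.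
Qed.

End Gronwall.

(** * Mild solutions *)

(** At a given time the mild equation holds only outside a null set. Discarding that set is what
    calls for measurability of [f] here. *)
Lemma ae_ge0_le_integral_lin d (T : measurableType d) (R : realType)
    (mu : {measure set T -> \bar R}) (f g h : T -> \bar R) (a b : R) :
  (forall x, 0 <= f x)%E -> (forall x, 0 <= g x)%E -> (forall x, 0 <= h x)%E ->
  measurable_fun setT f -> measurable_fun setT g -> measurable_fun setT h ->
  (0 <= a)%R -> (0 <= b)%R ->
  {ae mu, forall x, f x <= a%:E * g x + b%:E * h x}%E ->
  (\int[mu]_x f x <= a%:E * \int[mu]_x g x + b%:E * \int[mu]_x h x)%E.
Proof.
move=> f0 g0 h0 mf mg mh a0 b0 fgh.
have r0 x : (0 <= a%:E * g x + b%:E * h x)%E.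
  by rewrite adde_ge0 // mule_ge0 // lee_fin.
apply: (@le_trans _ _ (\int[mu]_x (a%:E * g x + b%:E * h x))%E).
  apply: ae_ge0_le_integral => //.
    by apply: emeasurable_funD; exact: measurable_funeM.
  by apply: filterS fgh => x + _.
by apply: ge0_le_integral_lin.
Qed.

(* Reduces convex combinations to the combinations [k *: x + y] of the lemmas on
   integrals and processes. *)
Lemma conv_combE (R : realType) (V : lmodType R) (k : R) (x y : V) :
  k *: x + (1 - k) *: y = k *: (-1 *: y + x) + y.
Proof.
rewrite scaleN1r scalerDr scalerN scalerBl scale1r addrA addrAC.
by rewrite [in RHS](addrC (- _)).
Qed.

Section MildSolution.
Context (R : realType) d (Omega : measurableType d) (P : probability Omega R).
Hypothesis complP : measure_is_complete P.
Variables (Xi H Lambda : completeNormedModType R).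
Variables (ipXi : {dot Xi for (@idfun R)}) (ip : {dot H for (@idfun R)}).
Hypotheses (hXi : norm_from_dot ipXi) (hH : norm_from_dot ip).
Hypotheses (sepXi : separable Xi) (sepH : separable H) (sepL : separable Lambda).
Variable E : set Xi.
Hypothesis hE : orthonormal_basis ipXi E.
Variables (W : R -> Xi -> Omega -> R) (t T : R).
Hypothesis tT : t <= T.
Hypothesis hW : cylindrical_wiener P W t T.
Local Notation F := (wiener_filtration P W t).
Local Notation mu := (@lebesgue_measure R).
Variable S : R -> {linear H -> H}.
Hypothesis contrS : forall s x, 0 <= s -> `|S s x| <= `|x|.
Variables (b : H -> Lambda -> H) (sigma : H -> Lambda -> Xi -> H).
Local Notation mild := (mild_solution P ipXi W E S b sigma t T).
Implicit Types (X Y : R -> Omega -> H) (a : R -> Omega -> Lambda).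

(** The constant [T - t + 1] bounds the length of [[t, s]] uniformly in [s] and stays positive when
    [t = T]. *)
Lemma bochner_sqr_le s (f : R -> H) (y : H) : t <= s <= T ->
  is_bochner_integral `[t, s] f y ->
  ((`|y| ^+ 2)%:E <= (T - t + 1)%:E * \int[mu]_(r in `[t, s]) (`|f r| ^+ 2)%:E)%E.
Proof.
move=> /andP[ts sT] hy.
have fin : (mu `[t, s] < +oo)%E.
  by rewrite /= lebesgue_measure_itv /=; case: ifP => _; rewrite ?ltry.
have mf : measurable_fun `[t, s]%classic (fun r => `|f r|).
  by case: hy => /measurable_inP hf _; apply: measurable_in_norm => //; exact: hf.
have c0 : 0 < T - t + 1 by rewrite ltr_wpDl ?subr_ge0.
have cm : (mu `[t, s]%classic <= (T - t + 1)%:E)%E.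
  by apply: lebesgue_measure_itvcc_le; [exact: ltW|lra].
have mI : measurable (`[t, s]%classic : set R) by exact: measurable_itv.
have h2 := sqr_integral_le (mu := mu) mI c0 cm mf (fun r _ => normr_ge0 _).
apply: le_trans h2.
have h := bochner_integral_le hH sepH mI fin hy.
by rewrite expr2 EFinM expe2; apply: lee_pmul => //; rewrite lee_fin.
Qed.

Section Uniqueness.
Variables (Kb Ks : R).
Hypotheses (Kb0 : 0 <= Kb) (Ks0 : 0 <= Ks).
Hypothesis bL : forall x y l, `|b x l - b y l| <= Kb * `|x - y|.
Hypothesis sL : forall x y l,
  (HS_norm2 E (fun xi => (sigma x l xi - sigma y l xi)%R) <= (Ks * `|x - y| ^+ 2)%:E)%E.

Lemma measurable_sqr_norm s X : t <= s -> s <= T -> progressive t T F X ->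
  measurable_fun (slab t s) (fun z => (`|X z.1 z.2| ^+ 2)%:E).
Proof.
move=> ts sT pX; apply/measurable_EFinP; apply: measurable_funX.
apply: measurable_in_norm.
exact: (progressive_measurable complP hW ts sT (progressive_le sT pX)).
Qed.

(** The initial terms cancel and the contractions drop out, leaving Lipschitz differences of [b] and
    [sigma]. The drift part is dominated path by path by a measurable function of [w]; the
    stochastic part is bounded in mean. *)
Lemma mild_solution_diff x a X Y s : mild x a X -> mild x a Y -> t <= s <= T ->
  (\int[P]_w (`|-1 *: Y s w + X s w| ^+ 2)%:E <=
   (2 * (T - t + 1) * Kb ^+ 2 + 2 * (4 * gauss_var R) * Ks)%:E *
   \int[P]_w \int[mu]_(r in `[t, s]) (`|-1 *: Y r w + X r w| ^+ 2)%:E)%E.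
Proof.
move=> [pX _ _ hX] [pY _ _ hY] tsT; have /andP[ts sT] := tsT.
have [I1 [I2 [hI1 hI2 eX]]] := hX s tsT; have [J1 [J2 [hJ1 hJ2 eY]]] := hY s tsT.
pose Z r w := -1 *: Y r w + X r w.
have pZ : progressive t T F Z by exact: progressive_lin.
set q := (\int[P]_w \int[mu]_(r in `[t, s]) (`|Z r w| ^+ 2)%:E)%E.
have mZ := measurable_sqr_norm ts sT pZ.
have Z0 r w : (0 <= (`|Z r w| ^+ 2)%:E)%E by rewrite lee_fin sqr_ge0.
have q0 : (0 <= q)%E by apply: integral_ge0 => w _; apply: integral_ge0.
have c0 : 0 <= T - t + 1 by rewrite addr_ge0 ?subr_ge0.
have sr r : t <= r <= s -> 0 <= s - r by move=> /andP[_ rs]; rewrite subr_ge0.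
pose D2 w := -1 *: J2 w + I2 w.
have hD2 := ito_integral_lin complP hXi sepXi sepH hE hW ts sT (-1) hJ2 hI2.
have e2 : (\int[P]_w (`|D2 w| ^+ 2)%:E <= (4 * gauss_var R)%:E * (Ks%:E * q))%E.
  apply: le_trans (ito_integral_le complP hXi hH sepXi sepH hE hW ts sT hD2) _.
  apply: lee_wpmul2l; first by rewrite lee_fin mulr_ge0 // gauss_var_ge0.
  (* The comparison of double integrals has two terms on the right; the second one gets the
     coefficient zero. *)
  apply: (@le_trans _ _ (Ks%:E * q + 0%:E * q)%E); last by rewrite mul0e adde0.
  apply: dint_le_lin => //.
    by move=> r w; exact: HS_norm2_ge0.
  move=> r w trs; rewrite mul0e adde0 -EFinM.
  have -> : `|Z r w| = `|X r w - Y r w| by rewrite /Z scaleN1r addrC.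
  apply: le_trans (sL (X r w) (Y r w) (a r w)).
  apply: HS_norm2_le => xi; rewrite scaleN1r addrC -linearB; exact: contrS (sr r trs).
have e1 : {ae P, forall w, ((`|-1 *: J1 w + I1 w| ^+ 2)%:E <=
    (T - t + 1)%:E * ((Kb ^+ 2)%:E * \int[mu]_(r in `[t, s]) (`|Z r w| ^+ 2)%:E))%E}.
  apply: filterS2 hJ1 hI1 => w h1 h2.
  have fin : (mu `[t, s] < +oo)%E.
    by rewrite /= lebesgue_measure_itv /=; case: ifP => _; rewrite ?ltry.
  have mI : measurable (`[t, s]%classic : set R) by exact: measurable_itv.
  have h3 := bochner_integral_lin sepH mI (-1) h1 h2.
  apply: le_trans (bochner_sqr_le tsT h3) _; apply: lee_wpmul2l.
    by rewrite lee_fin.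
  rewrite -ge0_integralZl_EFin ?sqr_ge0 //; last first.
    exact: (measurable_path (F := fun r w => (`|Z r w| ^+ 2)%:E) mZ w).
  apply: ge0_integral_mono => r /=; rewrite in_itv /= => trs.
    by rewrite lee_fin sqr_ge0.
  rewrite -EFinM lee_fin -exprMn ler_pXn2r ?nnegrE ?mulr_ge0 //.
  have -> : `|Z r w| = `|X r w - Y r w| by rewrite /Z scaleN1r addrC.
  apply: le_trans (bL _ _ (a r w)).
  rewrite scaleN1r addrC -linearB; exact: contrS (sr r trs).
have mD2 : measurable_fun setT (fun w => (`|D2 w| ^+ 2)%:E).
  case: hD2 => _ /borel_measurableP mD2 _; apply/measurable_EFinP.
  by apply: measurable_funX; exact: measurable_in_norm.
have -> : ((2 * (T - t + 1) * Kb ^+ 2 + 2 * (4 * gauss_var R) * Ks)%:E * q =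
    (2 * (T - t + 1) * Kb ^+ 2)%:E * q + 2%:E * ((4 * gauss_var R)%:E * (Ks%:E * q)))%E.
  rewrite EFinD ge0_muleDl ?lee_fin ?mulr_ge0 ?gauss_var_ge0 ?sqr_ge0 //.
  by rewrite !muleA -!EFinM.
apply: (@le_trans _ _ ((2 * (T - t + 1) * Kb ^+ 2)%:E * q +
    2%:E * \int[P]_w (`|D2 w| ^+ 2)%:E)%E); last first.
  by apply: leeD2l; apply: lee_wpmul2l.
have Kb2 := sqr_ge0 Kb.
apply: ae_ge0_le_integral_lin => //.
- by move=> w; apply: integral_ge0.
- by apply: (measurable_section (F := fun r w => (`|Z r w| ^+ 2)%:E) mZ); rewrite ts lexx.
- exact: (measurable_inner Z0 mZ).
- by rewrite !mulr_ge0.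
- have aeZ : {ae P, forall w, -1 *: Y s w + X s w = (-1 *: J1 w + I1 w) + D2 w}.
    apply: filterS2 eX eY => w -> ->; rewrite /D2.
    by rewrite !scaleN1r !opprD addrACA [X in X + _]addrACA addNr add0r.
  apply: filterS2 e1 aeZ => w h1 ->.
  apply: (@le_trans _ _ (2%:E * (`|-1 *: J1 w + I1 w| ^+ 2)%:E + 2%:E * (`|D2 w| ^+ 2)%:E)%E).
    rewrite -!EFinM -EFinD lee_fin.
    by have := sqr_norm_le2 1 (-1 *: J1 w + I1 w) (D2 w); rewrite scale1r expr1n mulr1.
  apply: leeD2r; rewrite -(mulrA 2) [X in (_ <= X * _)%E]EFinM -muleA; apply: lee_wpmul2l => //.
  by rewrite [X in (_ <= X * _)%E]EFinM -muleA.
Qed.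

(** Gronwall's lemma for the second moment of the difference as a function of time. Its integral is
    finite because square integrability is part of being a mild solution. *)
Lemma mild_solution_unique x a X Y : mild x a X -> mild x a Y ->
  forall s, t <= s <= T -> (\int[P]_w (`|-1 *: Y s w + X s w| ^+ 2)%:E = 0)%E.
Proof.
move=> hX hY.
pose Z r w := -1 *: Y r w + X r w.
have pZ : progressive t T F Z by case: hX hY => pX _ _ _ [pY _ _ _]; exact: progressive_lin.
have Z0 r w : (0 <= (`|Z r w| ^+ 2)%:E)%E by rewrite lee_fin sqr_ge0.
have mZ s : t <= s <= T -> measurable_fun (slab t s) (fun z => (`|Z z.1 z.2| ^+ 2)%:E).
  by move=> /andP[ts sT]; exact: measurable_sqr_norm.
have tTT : t <= T <= T by rewrite tT lexx.
set C := 2 * (T - t + 1) * Kb ^+ 2 + 2 * (4 * gauss_var R) * Ks.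
have C0 : 0 <= C.
  have h1 := sqr_ge0 Kb; have h2 := gauss_var_ge0 R.
  have h3 : 0 <= T - t by rewrite subr_ge0.
  by apply: addr_ge0; rewrite !mulr_ge0 // addr_ge0.
(* [C] may be zero, whereas Gronwall's lemma divides by its constant. *)
apply: (@gronwall_zero _ t T (C + 1)).
- by rewrite ltr_wpDl.
- exact: (measurable_outer P Z0 (mZ T tTT)).
- by move=> s _; apply: integral_ge0.
- rewrite -(dint_swap P Z0 (mZ T tTT)).
  case: hX hY => pX _ fX _ [pY _ fY _].
  apply: (@le_lt_trans _ _ (2%:E * (\int[P]_w \int[mu]_(r in `[t, T]) (`|Y r w| ^+ 2)%:E) +
     2%:E * (\int[P]_w \int[mu]_(r in `[t, T]) (`|X r w| ^+ 2)%:E))%E).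
    apply: dint_le_lin => //; try by move=> r w; rewrite lee_fin sqr_ge0.
    - exact: measurable_sqr_norm.
    - exact: measurable_sqr_norm.
    - move=> r w _; rewrite -!EFinM -EFinD lee_fin.
      by have := sqr_norm_le2 (-1) (Y r w) (X r w); rewrite sqrrN expr1n mulr1.
  by apply: lte_add_pinfty; apply: lte_mul_pinfty.
- move=> s tsT; apply: le_trans (mild_solution_diff hX hY tsT) _.
  rewrite (dint_swap P Z0 (mZ s tsT)); apply: lee_wpmul2r.
    by apply: integral_ge0 => r _; apply: integral_ge0.
  by rewrite lee_fin lerDl.
Qed.

End Uniqueness.

End MildSolution.

Lemma EFin_mul_lty (R : realType) (k : R) (x : \bar R) : 0 <= k -> (x < +oo)%E ->
  (k%:E * x < +oo)%E.
Proof. by move=> k0; apply: lte_mul_pinfty; rewrite ?lee_fin. Qed.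

Lemma EFin_lin_lty (R : realType) (a b : R) (x y : \bar R) : 0 <= a -> 0 <= b ->
  (x < +oo)%E -> (y < +oo)%E -> (a%:E * x + b%:E * y < +oo)%E.
Proof. by move=> a0 b0 xoo yoo; apply: lte_add_pinfty; exact: EFin_mul_lty. Qed.

Section DoubleIntegralFinite.
Context (R : realType) d (Omega : measurableType d) (P : probability Omega R).
Local Notation mu := (@lebesgue_measure R).
Variables (t s T : R).
Hypothesis tsT : t <= s <= T.

Lemma dint_subset (F : R -> Omega -> \bar R) : (forall r w, 0 <= F r w)%E ->
  measurable_fun (slab t T) (fun z => F z.1 z.2) ->
  (\int[P]_w \int[mu]_(r in `[t, s]) F r w <= \int[P]_w \int[mu]_(r in `[t, T]) F r w)%E.
Proof.
move=> F0 mF; have /andP[ts sT] := tsT.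
apply: ge0_integral_mono => w _; first by apply: integral_ge0.
apply: ge0_subset_integral => //.
  exact: (measurable_path (F := F) mF w).
by move=> r /=; rewrite !in_itv /= => /andP[-> rs] /=; exact: le_trans sT.
Qed.

Lemma dint_cst_lty (k : R) : 0 <= k ->
  (\int[P]_w \int[mu]_(r in `[t, s]) k%:E < +oo)%E.
Proof.
move=> k0; have /andP[ts sT] := tsT.
have -> : (\int[mu]_(r in `[t, s]) k%:E = k%:E * mu `[t, s])%E.
  by apply: integral_cst; exact: measurable_itv.
rewrite (_ : integral _ _ _ = k%:E * mu `[t, s] * P setT)%E; last exact: integral_cst.
rewrite probability_setT mule1.
apply: EFin_mul_lty => //.
apply: (@le_lt_trans _ _ (T - t)%:E); last exact: ltry.
by apply: lebesgue_measure_itvcc_le; rewrite ?subr_ge0 ?(le_trans ts) // lerD2r.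
Qed.

End DoubleIntegralFinite.

(** * Convex combinations and second moments of mild solutions *)

Section MildSolutionConvex.
Context (R : realType) d (Omega : measurableType d) (P : probability Omega R).
Hypothesis complP : measure_is_complete P.
Variables (Xi H Lambda : completeNormedModType R).
Variables (ipXi : {dot Xi for (@idfun R)}) (ip : {dot H for (@idfun R)}).
Hypotheses (hXi : norm_from_dot ipXi) (hH : norm_from_dot ip).
Hypotheses (sepXi : separable Xi) (sepH : separable H) (sepL : separable Lambda).
Variable E : set Xi.
Hypothesis hE : orthonormal_basis ipXi E.
Variables (W : R -> Xi -> Omega -> R) (t T : R).
Hypothesis tT : t <= T.
Hypothesis hW : cylindrical_wiener P W t T.
Local Notation F := (wiener_filtration P W t).
Local Notation mu := (@lebesgue_measure R).
Variable S : R -> {linear H -> H}.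
Hypothesis contrS : forall s x, 0 <= s -> `|S s x| <= `|x|.
Variables (b : H -> Lambda -> H) (sigma : H -> Lambda -> Xi -> H).
Local Notation mild := (mild_solution P ipXi W E S b sigma t T).
Implicit Types (X Y : R -> Omega -> H) (a : R -> Omega -> Lambda).

Lemma progressive_conv s (V : normedModType R) (k : R) (Y Z : R -> Omega -> V) :
  separable V -> progressive t s F Y -> progressive t s F Z ->
  progressive t s F (fun r w => k *: Y r w + (1 - k) *: Z r w).
Proof.
move=> sV pY pZ.
rewrite (_ : (fun r w => _) = (fun r w => k *: (-1 *: Z r w + Y r w) + Z r w)).
  by do 2 (apply: progressive_lin => //).
by apply/funext => r; apply/funext => w; rewrite conv_combE.
Qed.

Lemma dint_sqr_conv_lty (k : R) X Y : progressive t T F X -> progressive t T F Y ->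
  (\int[P]_w \int[mu]_(s in `[t, T]) (`|X s w| ^+ 2)%:E < +oo)%E ->
  (\int[P]_w \int[mu]_(s in `[t, T]) (`|Y s w| ^+ 2)%:E < +oo)%E ->
  (\int[P]_w \int[mu]_(s in `[t, T]) (`|k *: X s w + (1 - k) *: Y s w| ^+ 2)%:E < +oo)%E.
Proof.
move=> pX pY fX fY.
apply: (@le_lt_trans _ _ ((2 * k ^+ 2)%:E *
    (\int[P]_w \int[mu]_(r in `[t, T]) (`|X r w| ^+ 2)%:E) +
    (2 * (1 - k) ^+ 2)%:E * (\int[P]_w \int[mu]_(r in `[t, T]) (`|Y r w| ^+ 2)%:E))%E).
  apply: dint_le_lin; try by move=> r w; rewrite lee_fin sqr_ge0.
  - exact: (measurable_sqr_norm complP hW).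
  - exact: (measurable_sqr_norm complP hW).
  - by rewrite mulr_ge0 // sqr_ge0.
  - by rewrite mulr_ge0 // sqr_ge0.
  - move=> r w _; rewrite -!EFinM -EFinD lee_fin.
    apply: le_trans (sqr_norm_le2 _ _ _) _; rewrite lerD2l normrZ exprMn.
    by rewrite real_normK ?num_real // mulrA.
apply: lte_add_pinfty; apply: EFin_mul_lty; [|exact: fX| |exact: fY].
  by apply: mulr_ge0; [exact: ler0n|exact: sqr_ge0].
by apply: mulr_ge0; [exact: ler0n|exact: sqr_ge0].
Qed.

Lemma mild_solution_convex (k : R) x y a c X Y :
  (forall x y l m, b (k *: x + (1 - k) *: y) (k *: l + (1 - k) *: m) =
    k *: b x l + (1 - k) *: b y m) ->
  (forall x y l m xi, sigma (k *: x + (1 - k) *: y) (k *: l + (1 - k) *: m) xi =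
    k *: sigma x l xi + (1 - k) *: sigma y m xi) ->
  mild x a X -> mild y c Y ->
  mild (k *: x + (1 - k) *: y) (fun s w => k *: a s w + (1 - k) *: c s w)
    (fun s w => k *: X s w + (1 - k) *: Y s w).
Proof.
move=> bA sA [pX cX fX hX] [pY cY fY hY]; split.
- exact: progressive_conv.
- apply: filterS2 cX cY => w hx hy s.
  by apply: cvgD; apply: cvgZr; [exact: hx|exact: hy].
- exact: dint_sqr_conv_lty.
- move=> s tsT; have /andP[ts sT] := tsT.
  have [I1 [I2 [hI1 hI2 eX]]] := hX s tsT; have [J1 [J2 [hJ1 hJ2 eY]]] := hY s tsT.
  (* By [conv_combE] these are the convex combinations of the integrals, so the linearity of each
     integral is applied twice. *)
  exists (fun w => k *: (-1 *: J1 w + I1 w) + J1 w).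
  exists (fun w => k *: (-1 *: J2 w + I2 w) + J2 w); split.
  + apply: filterS2 hI1 hJ1 => w h1 h2.
    rewrite (_ : (fun r => _) = (fun r =>
        k *: (-1 *: S (s - r) (b (Y r w) (c r w)) + S (s - r) (b (X r w) (a r w)))
          + S (s - r) (b (Y r w) (c r w)))); last first.
      by apply/funext => r; rewrite bA linearD !linearZ /= conv_combE.
    have mI : measurable (`[t, s]%classic : set R) by exact: measurable_itv.
    by do 2 (apply: (bochner_integral_lin sepH mI) => //).
  + rewrite (_ : (fun r => _) = (fun r w xi =>
        k *: (-1 *: S (s - r) (sigma (Y r w) (c r w) xi)
              + S (s - r) (sigma (X r w) (a r w) xi))
          + S (s - r) (sigma (Y r w) (c r w) xi))); last first.
      apply/funext => r; apply/funext => w; apply/funext => xi.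
      by rewrite sA linearD !linearZ /= conv_combE.
    by do 2 (apply: (ito_integral_lin complP hXi sepXi sepH hE hW ts sT) => //).
  + apply: filterS2 eX eY => w -> ->.
    have -> : S (s - t) (k *: x + (1 - k) *: y) = k *: S (s - t) x + (1 - k) *: S (s - t) y.
      by rewrite linearD !linearZ.
    rewrite -!conv_combE !(scalerDr k) !(scalerDr (1 - k)).
    by rewrite addrACA; congr +%R; rewrite addrACA.
Qed.

Lemma measurable_growth s X a : t <= s -> s <= T ->
  progressive t T F X -> progressive t T F a ->
  measurable_fun (slab t s) (fun z => (1 + `|X z.1 z.2| ^+ 2 + `|a z.1 z.2| ^+ 2)%:E).
Proof.
move=> ts sT pX pa; apply/measurable_EFinP; apply: measurable_funD.
  apply: measurable_funD; first exact: measurable_cst.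
  by apply/measurable_EFinP; exact: (measurable_sqr_norm complP hW ts sT pX).
by apply/measurable_EFinP; exact: (measurable_sqr_norm complP hW ts sT pa).
Qed.

Lemma dint_growth_lty s X a : t <= s <= T ->
  progressive t T F X -> progressive t T F a ->
  (\int[P]_w \int[mu]_(r in `[t, T]) (`|X r w| ^+ 2)%:E < +oo)%E ->
  (\int[P]_w \int[mu]_(r in `[t, T]) (`|a r w| ^+ 2)%:E < +oo)%E ->
  (\int[P]_w \int[mu]_(r in `[t, s]) (1 + `|X r w| ^+ 2 + `|a r w| ^+ 2)%:E < +oo)%E.
Proof.
move=> tsT pX pa fX fa.
have tTT : t <= T <= T by rewrite tT lexx.
have mX := measurable_sqr_norm complP hW tT (lexx T) pX.
have ma := measurable_sqr_norm complP hW tT (lexx T) pa.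
have G0 r w : (0 <= (1 + `|X r w| ^+ 2 + `|a r w| ^+ 2)%:E)%E.
  by rewrite lee_fin !addr_ge0 ?sqr_ge0.
apply: (@le_lt_trans _ _ _ _ _ (dint_subset P tsT G0 (measurable_growth tT (lexx T) pX pa))).
apply: (@le_lt_trans _ _ (1%:E * (\int[P]_w \int[mu]_(r in `[t, T]) (1 + `|X r w| ^+ 2)%:E)
   + 1%:E * (\int[P]_w \int[mu]_(r in `[t, T]) (`|a r w| ^+ 2)%:E))%E).
  apply: dint_le_lin => //; try by move=> r w; rewrite lee_fin ?addr_ge0 ?sqr_ge0.
    by apply/measurable_EFinP; apply: measurable_funD;
      [exact: measurable_cst|exact/measurable_EFinP].
  by move=> r w _; rewrite !mul1e.
rewrite !mul1e; apply: lte_add_pinfty; last exact: fa.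
apply: (@le_lt_trans _ _ (1%:E * (\int[P]_w \int[mu]_(r in `[t, T]) 1%:E)
   + 1%:E * (\int[P]_w \int[mu]_(r in `[t, T]) (`|X r w| ^+ 2)%:E))%E).
  apply: dint_le_lin => //; try by move=> r w; rewrite lee_fin ?addr_ge0 ?sqr_ge0.
  by move=> r w _; rewrite !mul1e.
by rewrite !mul1e; apply: lte_add_pinfty; [exact: (dint_cst_lty P tTT)|exact: fX].
Qed.

Section Moment.
Variable M : R.
Hypothesis M0 : 0 <= M.
Hypothesis bM : forall x l, `|b x l| ^+ 2 <= M * (1 + `|x| ^+ 2 + `|l| ^+ 2).
Hypothesis sM : forall x l,
  (HS_norm2 E (sigma x l) <= (M * (1 + `|x| ^+ 2 + `|l| ^+ 2))%:E)%E.

(** Gives a second moment at each individual time, in particular at [T], where the terminal cost is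
    evaluated; integrability over the slab says nothing about a single time. *)
Lemma mild_solution_moment x a X : progressive t T F a ->
  (\int[P]_w \int[mu]_(s in `[t, T]) (`|a s w| ^+ 2)%:E < +oo)%E ->
  mild x a X -> forall s, t <= s <= T -> (\int[P]_w (`|X s w| ^+ 2)%:E < +oo)%E.
Proof.
move=> pa fa [pX _ fX hX] s tsT; have /andP[ts sT] := tsT.
have [I1 [I2 [hI1 hI2 eX]]] := hX s tsT.
pose G r w := (1 + `|X r w| ^+ 2 + `|a r w| ^+ 2)%:E.
have G0 r w : (0 <= G r w)%E by rewrite lee_fin !addr_ge0 ?sqr_ge0.
have mG : measurable_fun (slab t s) (fun z => G z.1 z.2).
  exact: (measurable_growth ts sT pX pa).
have c0 : 0 <= T - t + 1 by rewrite addr_ge0 ?subr_ge0.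
set q := (\int[P]_w \int[mu]_(r in `[t, s]) G r w)%E.
have qfin : (q < +oo)%E by exact: (dint_growth_lty tsT pX pa fX fa).
have sr r : t <= r <= s -> 0 <= s - r by move=> /andP[_ rs]; rewrite subr_ge0.
have e2 : (\int[P]_w (`|I2 w| ^+ 2)%:E < +oo)%E.
  apply: le_lt_trans (ito_integral_le complP hXi hH sepXi sepH hE hW ts sT hI2) _.
  apply: EFin_mul_lty; first by apply: mulr_ge0; [exact: ler0n|exact: gauss_var_ge0].
  apply: (@le_lt_trans _ _ (M%:E * q + 0%:E * q)%E); last first.
    by rewrite mul0e adde0; exact: EFin_mul_lty.
  apply: dint_le_lin => //; first by move=> r w; exact: HS_norm2_ge0.
  move=> r w trs; rewrite mul0e adde0 -EFinM.
  apply: le_trans (sM (X r w) (a r w)).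
  by apply: HS_norm2_le => xi; exact: contrS (sr r trs).
have e1 : {ae P, forall w, ((`|I1 w| ^+ 2)%:E <=
    (T - t + 1)%:E * (M%:E * \int[mu]_(r in `[t, s]) G r w))%E}.
  apply: filterS hI1 => w h1.
  apply: le_trans (bochner_sqr_le hH sepH tT tsT h1) _; apply: lee_wpmul2l => //.
  rewrite -ge0_integralZl_EFin //; last exact: (measurable_path (F := G) mG w).
  apply: ge0_integral_mono => r /=; rewrite in_itv /= => trs.
    by rewrite lee_fin sqr_ge0.
  rewrite -EFinM lee_fin; apply: le_trans (bM (X r w) (a r w)).
  by rewrite ler_pXn2r ?nnegrE //; exact: contrS (sr r trs).
have mI2 : measurable_fun setT (fun w => (`|I2 w| ^+ 2)%:E).
  case: hI2 => _ /borel_measurableP mI2 _; apply/measurable_EFinP.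
  by apply: measurable_funX; exact: measurable_in_norm.
(* Splitting a sum of three vectors twice puts a 4 before the initial and drift terms and a 2 before
   the stochastic one. The initial term is charged to the summand 1 of [1 + \int G]. *)
pose K := 4 * `|x| ^+ 2 + 4 * (T - t + 1) * M.
have K0 : 0 <= K by rewrite addr_ge0 // ?mulr_ge0 // sqr_ge0.
have mg : measurable_fun setT (fun w => 1 + \int[mu]_(r in `[t, s]) G r w)%E.
  by apply: emeasurable_funD; [exact: measurable_cst|exact: (measurable_inner G0 mG)].
have g0 w : (0 <= \int[mu]_(r in `[t, s]) G r w)%E by apply: integral_ge0.
apply: (@le_lt_trans _ _ (K%:E * (\int[P]_w (1 + \int[mu]_(r in `[t, s]) G r w))
    + 2%:E * \int[P]_w (`|I2 w| ^+ 2)%:E)%E).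
  apply: ae_ge0_le_integral_lin => //.
  - by move=> w; rewrite adde_ge0.
  - by apply: (measurable_section (F := fun r w => (`|X r w| ^+ 2)%:E)
      (measurable_sqr_norm complP hW ts sT pX)); rewrite ts lexx.
  - apply: filterS2 e1 eX => w h1 ->.
    apply: (@le_trans _ _ ((4 * `|x| ^+ 2)%:E + 4%:E * (`|I1 w| ^+ 2)%:E
        + 2%:E * (`|I2 w| ^+ 2)%:E)%E).
      rewrite -!EFinM -!EFinD lee_fin.
      have := sqr_norm_le2 1 (S (s - t) x + I1 w) (I2 w).
      have := sqr_norm_le2 1 (S (s - t) x) (I1 w).
      have : `|S (s - t) x| ^+ 2 <= `|x| ^+ 2.
        by rewrite ler_pXn2r ?nnegrE //; apply: contrS; rewrite subr_ge0.
      rewrite !scale1r expr1n mulr1; lra.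
    apply: leeD2r; rewrite ge0_muleDr // mule1; apply: leeD.
      by rewrite lee_fin lerDl !mulr_ge0.
    apply: (@le_trans _ _ (4%:E * ((T - t + 1)%:E * (M%:E * \int[mu]_(r in `[t, s]) G r w)))%E).
      by apply: lee_wpmul2l.
    rewrite !muleA -!EFinM; apply: lee_wpmul2r => //.
    by rewrite lee_fin lerDr mulr_ge0 ?sqr_ge0.
apply: lte_add_pinfty; apply: EFin_mul_lty => //.
rewrite ge0_integralD //; last exact: (measurable_inner G0 mG).
apply: lte_add_pinfty => //.
rewrite (_ : integral _ _ _ = 1 * P setT)%E; last exact: integral_cst.
by rewrite probability_setT mule1 ltry.
Qed.

End Moment.

End MildSolutionConvex.

(** * Coefficients *)

Lemma norm_sqr_le (R : realType) (V : normedModType R) (x : V) (c : R) :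
  `|x| <= c -> `|x| ^+ 2 <= c ^+ 2.
Proof.
by move=> xc; rewrite ler_pXn2r ?nnegrE //; exact: le_trans (normr_ge0 x) xc.
Qed.

Lemma normm1_le (R : realType) (H : completeNormedModType R)
    (ip : {dot H for (@idfun R)}) (B : {linear H -> H}) :
  norm_from_dot ip -> continuous B ->
  exists2 K : R, 0 <= K & forall x, normm1 ip B x <= K * `|x|.
Proof.
move=> hH cB.
have aB : affine (B : H -> H) by move=> k x y; rewrite linearD !linearZ.
have [K K0 BK] := affine_continuous_lipschitz aB cB.
(* [K + 1] exceeds both [K] and 1, so its square dominates [K] and no square root of [K] appears. *)
exists (K + 1) => [|x]; first by rewrite addr_ge0.
rewrite -(ger0_norm (mulr_ge0 (addr_ge0 K0 ler01) (normr_ge0 x))) -sqrtr_sqr ler_wsqrtr //.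
apply: le_trans (ler_norm _) _; apply: le_trans (ip_le hH _ _) _.
rewrite [leRHS]expr2; apply: ler_pM => //.
  have := BK x 0; rewrite linear0 !subr0 => /le_trans; apply.
  by rewrite ler_wpM2r // lerDl.
by rewrite ler_peMl // lerDr.
Qed.

Section Coefficients.
Variables (R : realType) (Xi H Lambda Hm1 : completeNormedModType R).
Variable ipXi : {dot Xi for (@idfun R)}.
Hypothesis hXi : norm_from_dot ipXi.
Hypothesis sepXi : separable Xi.
Variable E : set Xi.
Hypothesis hE : orthonormal_basis ipXi E.
Variables (iota : {linear H -> Hm1}) (Ci : R).
Hypotheses (Ci0 : 0 <= Ci) (iotaC : forall x, `|iota x| <= Ci * `|x|).

Lemma norm_pair_le x (l : Lambda) : `|(iota x, l)| <= Ci * `|x| + `|l|.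
Proof.
rewrite prod_normE ge_max /=; apply/andP; split.
  by apply: le_trans (iotaC x) _; rewrite lerDl.
by rewrite lerDr mulr_ge0.
Qed.

Lemma norm_pair_sub x y (l : Lambda) : `|(iota x, l) - (iota y, l)| <= Ci * `|x - y|.
Proof.
have -> : (iota x, l) - (iota y, l) = (iota (x - y), 0) by rewrite linearB -(subrr l).
by apply: le_trans (norm_pair_le _ _) _; rewrite normr0 addr0.
Qed.

Lemma affine_pair (V : lmodType R) (f : Hm1 * Lambda -> V) : affine f ->
  forall k x y l m, f (iota (k *: x + (1 - k) *: y), k *: l + (1 - k) *: m) =
    k *: f (iota x, l) + (1 - k) *: f (iota y, m).
Proof. by move=> af k x y l m; rewrite -af linearD !linearZ. Qed.

Lemma drift_lipschitz (bt : Hm1 * Lambda -> H) : affine bt -> continuous bt ->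
  exists2 K : R, 0 <= K &
    forall x y l, `|bt (iota x, l) - bt (iota y, l)| <= K * `|x - y|.
Proof.
move=> af cf; have [K K0 btK] := affine_continuous_lipschitz af cf.
exists (K * Ci) => [|x y l]; first exact: mulr_ge0.
by apply: le_trans (btK _ _) _; rewrite -mulrA ler_wpM2l // norm_pair_sub.
Qed.

Lemma drift_growth (bt : Hm1 * Lambda -> H) : affine bt -> continuous bt ->
  exists2 M : R, 0 <= M &
    forall x l, `|bt (iota x, l)| ^+ 2 <= M * (1 + `|x| ^+ 2 + `|l| ^+ 2).
Proof.
move=> af cf; have [K K0 btK] := affine_continuous_lipschitz af cf.
set u := `|bt 0|; have u0 : 0 <= u by exact: normr_ge0.
(* From [(u + v + w)^2 <= 3 (u^2 + v^2 + w^2)], applied to the bound [|bt 0| + K Ci |x| + K |l|]. *)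
exists (3 * (u ^+ 2 + (K * Ci) ^+ 2 + K ^+ 2)) => [|x l].
  by rewrite mulr_ge0 // !addr_ge0 // sqr_ge0.
have h : `|bt (iota x, l)| <= u + K * (Ci * `|x| + `|l|).
  have := btK (iota x, l) 0; rewrite subr0 => h.
  rewrite -[bt (iota x, l)](subrK (bt 0)); apply: le_trans (ler_normD _ _) _.
  rewrite addrC lerD2l; apply: le_trans h _; by apply: ler_wpM2l => //; exact: norm_pair_le.
apply: (@le_trans _ _ ((u + K * (Ci * `|x| + `|l|)) ^+ 2)).
  exact: norm_sqr_le.
set v := `|x|; set w := `|l|.
have h1 : (u + K * (Ci * v + w)) ^+ 2 <= 3 * (u ^+ 2 + (K * Ci * v) ^+ 2 + (K * w) ^+ 2).
  have := sqr_ge0 (u - K * Ci * v); have := sqr_ge0 (u - K * w).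
  have := sqr_ge0 (K * Ci * v - K * w); lra.
apply: le_trans h1 _; rewrite -(mulrA 3) ler_wpM2l // !exprMn.
have pu := sqr_ge0 u; have pv := sqr_ge0 v; have pw := sqr_ge0 w.
have pK := sqr_ge0 K; have pC := sqr_ge0 Ci.
have := mulr_ge0 pu pv; have := mulr_ge0 pu pw.
have pKC := mulr_ge0 pK pC.
have := mulr_ge0 pKC pw; have := mulr_ge0 pK pv; lra.
Qed.

Lemma diffusion_lipschitz (st : Hm1 * Lambda -> Xi -> H) :
  (forall xi, affine (fun z => st z xi)) -> HS_continuous E st ->
  exists2 K : R, 0 <= K & forall x y l,
    (HS_norm2 E (fun xi => (st (iota x, l) xi - st (iota y, l) xi)%R)
      <= (K * `|x - y| ^+ 2)%:E)%E.
Proof.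
move=> af cf; have [K K0 stK] := HS_affine_lipschitz hXi sepXi hE af cf.
exists (K * Ci ^+ 2) => [|x y l]; first by rewrite mulr_ge0 // sqr_ge0.
apply: le_trans (stK _ _) _; rewrite lee_fin -mulrA ler_wpM2l // -exprMn.
by apply: norm_sqr_le; exact: norm_pair_sub.
Qed.

Lemma diffusion_growth (st : Hm1 * Lambda -> Xi -> H) :
  (forall z, hilbert_schmidt E (st z)) ->
  (forall xi, affine (fun z => st z xi)) -> HS_continuous E st ->
  exists2 M : R, 0 <= M & forall x l,
    (HS_norm2 E (st (iota x, l)) <= (M * (1 + `|x| ^+ 2 + `|l| ^+ 2))%:E)%E.
Proof.
move=> hs af cf; have [K K0 stK] := HS_affine_lipschitz hXi sepXi hE af cf.
set h0 := HS_norm2 E (st 0).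
have h00 : (0 <= h0)%E by exact: HS_norm2_ge0.
have h0fin : h0 \is a fin_num by rewrite ge0_fin_numE //; case: (hs 0).
pose u := fine h0; have u0 : 0 <= u by rewrite fine_ge0.
(* One factor 2 separates [st 0], whose norm [u] is finite since it is Hilbert-Schmidt; the inner
   one expands the square of [Ci |x| + |l|]. *)
exists (2 * K * (2 * Ci ^+ 2 + 2) + 2 * u) => [|x l].
  by rewrite addr_ge0 // !mulr_ge0 // addr_ge0 // mulr_ge0 // sqr_ge0.
have -> : st (iota x, l) = (fun xi => 1 *: (st (iota x, l) xi - st 0 xi) + st 0 xi).
  by apply/funext => xi; rewrite scale1r subrK.
apply: le_trans (HS_norm2_lin hXi sepXi hE _ _ _) _.
apply: (@le_trans _ _ (2%:E * (K * `|(iota x, l)| ^+ 2)%:E + 2%:E * u%:E)%E).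
  rewrite expr1n mulr1 /u fineK // leeD2r // lee_wpmul2l //.
  by have := stK (iota x, l) 0; rewrite subr0.
rewrite -!EFinM -EFinD lee_fin.
have h1 : `|(iota x, l)| ^+ 2 <= 2 * Ci ^+ 2 * `|x| ^+ 2 + 2 * `|l| ^+ 2.
  apply: (@le_trans _ _ ((Ci * `|x| + `|l|) ^+ 2)).
    by apply: norm_sqr_le; exact: norm_pair_le.
  have := sqr_ge0 (Ci * `|x| - `|l|); lra.
have h2 : 2 * (K * `|(iota x, l)| ^+ 2) <=
    2 * K * (2 * Ci ^+ 2 * `|x| ^+ 2 + 2 * `|l| ^+ 2).
  by rewrite mulrA ler_wpM2l // mulr_ge0.
apply: le_trans (lerD h2 (lexx _)) _.
set v := `|x|; set w := `|l|.
have pv := sqr_ge0 v; have pw := sqr_ge0 w; have pC := sqr_ge0 Ci.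
have := mulr_ge0 K0 pC; have := mulr_ge0 (mulr_ge0 K0 pC) pw.
have := mulr_ge0 K0 pv; have := mulr_ge0 u0 pv; have := mulr_ge0 u0 pw; lra.
Qed.

End Coefficients.

(** * Admissible controls and costs *)

(** Subtraction reduces this to a difference that is nonnegative almost everywhere, integrable
    functions being finite there. *)
Lemma ae_le_integral d (T : measurableType d) (R : realType)
    (mu : {measure set T -> \bar R}) (D : set T) (f g : T -> \bar R) :
  measurable D -> mu.-integrable D f -> mu.-integrable D g ->
  {ae mu, forall x, D x -> f x <= g x}%E ->
  (\int[mu]_(x in D) f x <= \int[mu]_(x in D) g x)%E.
Proof.
move=> mD intf intg fg.
have fin (h : T -> \bar R) : mu.-integrable D h -> (\int[mu]_(x in D) h x)%E \is a fin_num.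
  exact: integrable_fin_num.
rewrite -sube_ge0 ?fin // -integralB //.
have mB : measurable_fun D (fun x => (g x - f x)%E).
  by apply: emeasurable_funB; [exact: measurable_int intg|exact: measurable_int intf].
rewrite (ae_eq_integral (fun x => `|g x - f x|)%E) //; last first.
- apply: filterS3 fg (integrable_ae mD intf) (integrable_ae mD intg) => x fg ff gf Dx.
  by rewrite gee0_abs // sube_ge0 ?fg // ?ff ?gf.
- exact: measurableT_comp.
by apply: integral_ge0 => x _; exact: abse_ge0.
Qed.

Lemma convex_setP (R : realType) (V : lmodType R) (A : set (convex_lmodType V))
    (k : R) (x y : V) :
  convex_set A -> 0 <= k <= 1 -> A x -> A y -> A (k *: x + (1 - k) *: y).
Proof.
move=> cA /andP[k0 k1] Ax Ay.
by have := cA x y (Itv01 k0 k1) (mem_set Ax) (mem_set Ay) => /set_mem.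
Qed.

Lemma convex_functionP (R : realType) (V : lmodType R) (A : set (convex_lmodType V))
    (f : V -> R) (k : R) (x y : V) :
  convex_function A f -> 0 <= k <= 1 -> A x -> A y ->
  f (k *: x + (1 - k) *: y) <= k * f x + (1 - k) * f y.
Proof.
move=> cf /andP[k0 k1] Ax Ay.
exact: (cf (Itv01 k0 k1) x y (mem_set Ax) (mem_set Ay)).
Qed.

(** Converts the moments of order [p] of admissible controls into second moments, the measure of the
    slab being finite. *)
Lemma sqr_le_powR (R : realType) (x p : R) : 0 <= x -> 2 <= p -> x ^+ 2 <= 1 + x `^ p.
Proof.
move=> x0 p2; have [x1|x1] := leP x 1.
  by rewrite (le_trans (exprn_ile1 2 x0 x1)) // lerDl powR_ge0.
rewrite -powR_mulrn //; apply: (le_trans (ler_powR (ltW x1) p2)).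
by rewrite lerDr.
Qed.

(** The norm of a convex combination is at most the larger of the two norms, which replaces
    convexity of the power function. *)
Lemma powR_norm_conv_le (R : realType) (V : normedModType R) (k p : R) (x y : V) :
  0 <= k <= 1 -> 0 <= p ->
  `|k *: x + (1 - k) *: y| `^ p <= `|x| `^ p + `|y| `^ p.
Proof.
move=> /andP[k0 k1] p0.
have h : `|k *: x + (1 - k) *: y| <= Num.max `|x| `|y|.
  apply: le_trans (ler_normD _ _) _; rewrite !normrZ !ger0_norm ?subr_ge0 //.
  have -> : Num.max `|x| `|y| = k * Num.max `|x| `|y| + (1 - k) * Num.max `|x| `|y|.
    by rewrite -mulrDl subrKC mul1r.
  rewrite lerD // ler_wpM2l ?subr_ge0 //.
    by rewrite le_max lexx.
  by rewrite le_max lexx orbT.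
apply: (@le_trans _ _ (Num.max `|x| `|y| `^ p)).
  by apply: ge0_ler_powR => //; rewrite nnegrE // le_max normr_ge0.
by rewrite maxEle; case: ifP => _; rewrite ?lerDr ?lerDl powR_ge0.
Qed.

Section Admissible.
Context (R : realType) d (Omega : measurableType d) (P : probability Omega R).
Hypothesis complP : measure_is_complete P.
Variables (Xi Lambda : completeNormedModType R).
Hypothesis sepL : separable Lambda.
Variables (W : R -> Xi -> Omega -> R) (t T : R).
Hypothesis tT : t <= T.
Hypothesis hW : cylindrical_wiener P W t T.
Local Notation mu := (@lebesgue_measure R).
Variables (p : R) (Lambda0 : set Lambda).
Hypothesis p2 : 2 < p.
Local Notation adm := (admissible P W p t T Lambda0).
Implicit Types a c : R -> Omega -> Lambda.

Lemma measurable_powR_norm a : progressive t T (wiener_filtration P W t) a ->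
  measurable_fun (slab t T) (fun z => (`|a z.1 z.2| `^ p)%:E).
Proof.
move=> pa; apply/measurable_EFinP.
apply: (measurableT_comp (measurable_powR p)).
apply: measurable_in_norm; exact: (progressive_measurable complP hW tT (lexx T) pa).
Qed.

Lemma admissible_sqr_lty a : adm a ->
  (\int[P]_w \int[mu]_(s in `[t, T]) (`|a s w| ^+ 2)%:E < +oo)%E.
Proof.
move=> [pa _ fa].
apply: (@le_lt_trans _ _ (1%:E * (\int[P]_w \int[mu]_(r in `[t, T]) 1%:E)
   + 1%:E * (\int[P]_w \int[mu]_(r in `[t, T]) (`|a r w| `^ p)%:E))%E).
  apply: dint_le_lin => //; try by move=> r w; rewrite lee_fin ?sqr_ge0 ?powR_ge0.
    exact: measurable_powR_norm.
  by move=> r w _; rewrite !mul1e -EFinD lee_fin sqr_le_powR // ltW.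
apply: (EFin_lin_lty ler01 ler01 _ fa).
by apply: (dint_cst_lty P (s := T) (T := T)); rewrite ?tT ?lexx.
Qed.

Lemma admissible_convex k a c : convex_set Lambda0 -> 0 <= k <= 1 -> adm a -> adm c ->
  adm (fun s w => k *: a s w + (1 - k) *: c s w).
Proof.
move=> cL k01 [pa La fa] [pc Lc fc]; split.
- exact: progressive_conv.
- by move=> s w stT; apply: convex_setP => //; [exact: La|exact: Lc].
- apply: (@le_lt_trans _ _ (1%:E * (\int[P]_w \int[mu]_(r in `[t, T]) (`|a r w| `^ p)%:E)
   + 1%:E * (\int[P]_w \int[mu]_(r in `[t, T]) (`|c r w| `^ p)%:E))%E).
    apply: dint_le_lin => //; try by move=> r w; rewrite lee_fin powR_ge0.
    + exact: measurable_powR_norm.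
    + exact: measurable_powR_norm.
    + move=> r w _; rewrite !mul1e -EFinD lee_fin powR_norm_conv_le //.
      by apply: ltW; apply: lt_trans p2.
  exact: (EFin_lin_lty ler01 ler01 fa fc).
Qed.

End Admissible.

Section InnerIntegral.
Context (R : realType) d (Omega : measurableType d) (P : probability Omega R).
Local Notation mu := (@lebesgue_measure R).
Variables (t s : R) (f : R -> Omega -> R).
Hypothesis mf : measurable_fun (slab t s) (fun z => f z.1 z.2).
Hypothesis fin : (\int[P]_w \int[mu]_(r in `[t, s]) (`|f r w|%:E) < +oo)%E.

Lemma measurable_inner_real :
  measurable_fun setT (fun w => \int[mu]_(r in `[t, s]) (f r w)%:E)%E.
Proof.
under eq_fun do rewrite integralE.
have mF : measurable_fun (slab t s) (fun z => (f z.1 z.2)%:E) by apply/measurable_EFinP.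
apply: emeasurable_funB.
  apply: (measurable_inner (F := fun r w => ((fun r' => (f r' w)%:E)^\+ r)%E)) => //.
  by have := measurable_funepos mF; rewrite !unlock.
apply: (measurable_inner (F := fun r w => ((fun r' => (f r' w)%:E)^\- r)%E)) => //.
by have := measurable_funeneg mF; rewrite !unlock.
Qed.

Lemma inner_integrable :
  P.-integrable setT (fun w => \int[mu]_(r in `[t, s]) (f r w)%:E)%E.
Proof.
apply/integrableP; split; first exact: measurable_inner_real.
apply: le_lt_trans fin; apply: ge0_integral_mono => w _; first exact: abse_ge0.
apply: le_abse_integral; first exact: measurable_itv.
exact: (measurable_path (F := fun r w => (f r w)%:E) (measurableT_comp _ mf) w).
Qed.

(** A nonnegative function of [w] with finite expectation is finite almost everywhere; here it is
    the time integral of [|f|]. *)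
Lemma path_integrable_ae :
  {ae P, forall w, mu.-integrable `[t, s] (fun r => (f r w)%:E)}.
Proof.
have mA : measurable_fun (slab t s) (fun z => (`|f z.1 z.2|%:E)).
  by apply/measurable_EFinP; exact: measurableT_comp.
have i : P.-integrable setT (fun w => \int[mu]_(r in `[t, s]) (`|f r w|%:E))%E.
  apply/integrableP; split.
    by apply: (measurable_inner (F := fun r w => (`|f r w|)%:E)) mA => r w; rewrite lee_fin.
  apply: le_lt_trans fin; apply: ge0_integral_mono => w _; first exact: abse_ge0.
  by rewrite gee0_abs // integral_ge0 // => r _; rewrite lee_fin.
apply: filterS (integrable_ae measurableT i) => w /(_ I) fw.
apply/integrableP; split.
  exact: (measurable_path (F := fun r w => (f r w)%:E) (measurableT_comp _ mf) w).
by rewrite ltey_eq fw.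
Qed.

End InnerIntegral.

(** * Integrability and convexity of the cost *)

Section Cost.
Context (R : realType) d (Omega : measurableType d) (P : probability Omega R).
Hypothesis complP : measure_is_complete P.
Variables (Xi H Lambda : completeNormedModType R).
Hypotheses (sepH : separable H) (sepL : separable Lambda).
Variables (W : R -> Xi -> Omega -> R) (t T : R).
Hypothesis tT : t <= T.
Hypothesis hW : cylindrical_wiener P W t T.
Local Notation F := (wiener_filtration P W t).
Local Notation mu := (@lebesgue_measure R).
Variables (Lambda0 : set Lambda) (l : H -> Lambda -> R) (g : H -> R).
Hypothesis lcont : {within [set z : H * Lambda | Lambda0 z.2],
  continuous (fun z : H * Lambda => l z.1 z.2)}.
Variables (Cl Cg : R).
Hypotheses (Cl0 : 0 <= Cl) (Cg0 : 0 <= Cg).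
Hypothesis lC : forall x a, Lambda0 a -> `|l x a| <= Cl * (1 + `|x| + `|a| ^+ 2).
Hypothesis gC : forall x x', `|g x - g x'| <= Cg * `|x - x'|.
Implicit Types (X Y N : R -> Omega -> H) (a c : R -> Omega -> Lambda).

(** What makes the cost finite, collected for reuse with the two given pairs and the averaged one.
    The separate moment at [T] serves the terminal cost. *)
Definition square_integrable_pair X a : Prop :=
  [/\ progressive t T F X, progressive t T F a,
      forall s w, t <= s <= T -> Lambda0 (a s w),
      (\int[P]_w \int[mu]_(s in `[t, T]) (1 + `|X s w| ^+ 2 + `|a s w| ^+ 2)%:E < +oo)%E
    & (\int[P]_w (`|X T w| ^+ 2)%:E < +oo)%E ].

Lemma measurable_running_cost X a : square_integrable_pair X a ->
  measurable_fun (slab t T) (fun z => l (X z.1 z.2) (a z.1 z.2)).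
Proof.
move=> [pX pa La _ _].
have mD := measurable_slab (Omega := Omega) t T.
have mX := progressive_measurable complP hW tT (lexx T) pX.
have ma := progressive_measurable complP hW tT (lexx T) pa.
have sD := sigma_algebra_measurable_in mD.
apply: measurable_in_fun.
have mXa := smeasurable_pair sD sepH sepL mX ma.
apply: (smeasurable_within _ lcont mXa).
by move=> [r w] [/=]; rewrite in_itv /= => tr _; exact: La.
Qed.

Lemma running_cost_dint_lty X a : square_integrable_pair X a ->
  (\int[P]_w \int[mu]_(s in `[t, T]) (`|l (X s w) (a s w)|)%:E < +oo)%E.
Proof.
move=> [pX pa La fG _].
(* The factor 2 covers [1 + |x| + |a|^2 <= 2 (1 + |x|^2 + |a|^2)]. *)
apply: (@le_lt_trans _ _ ((2 * Cl)%:E * \int[P]_w \int[mu]_(s in `[t, T])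
    (1 + `|X s w| ^+ 2 + `|a s w| ^+ 2)%:E +
   0%:E * \int[P]_w \int[mu]_(s in `[t, T])
    (1 + `|X s w| ^+ 2 + `|a s w| ^+ 2)%:E)%E).
  have mG := measurable_growth complP hW tT (lexx T) pX pa.
  apply: dint_le_lin => //; try by move=> r w; rewrite lee_fin ?addr_ge0 ?sqr_ge0.
    by rewrite mulr_ge0.
  move=> r w trT; rewrite mul0e adde0 -EFinM lee_fin.
  apply: le_trans (lC _ (La r w trT)) _; rewrite (mulrC 2) -mulrA ler_wpM2l //.
  have := sqr_ge0 (`|X r w| - 1); have := sqr_ge0 `|X r w|; have := sqr_ge0 `|a r w|; lra.
by apply: (EFin_lin_lty _ _ fG fG); rewrite ?mulr_ge0.
Qed.

Lemma terminal_cost_integrable X a : square_integrable_pair X a ->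
  P.-integrable setT (fun w => (g (X T w))%:E).
Proof.
move=> [pX _ _ _ fX].
have /borel_measurableP mX := progressive_section complP hW tT (lexx T) pX.
have cg : continuous g.
  move=> x; apply/cvgrPdist_le => e e0.
  have Cg1 : 0 < Cg + 1 by rewrite ltr_wpDl.
  near=> y; apply: le_trans (gC _ _) _.
  apply: (@le_trans _ _ ((Cg + 1) * `|x - y|)); first by rewrite ler_wpM2r // lerDl.
  rewrite -ler_pdivlMl //; near: y.
  by apply: cvgr_dist_le; [exact: cvg_id|rewrite mulr_gt0 // invr_gt0].
apply/integrableP; split.
  by apply/measurable_EFinP; apply: measurable_in_fun; exact: (smeasurable_comp cg mX).
pose K := `|g 0| + Cg; have K0 : 0 <= K by rewrite addr_ge0.
have mX2 : measurable_fun setT (fun w => (`|X T w| ^+ 2)%:E).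
  by apply/measurable_EFinP; apply: measurable_funX; exact: measurable_in_norm.
apply: (@le_lt_trans _ _ (K%:E * \int[P]_w 1%:E + K%:E * \int[P]_w (`|X T w| ^+ 2)%:E)%E).
  apply: ae_ge0_le_integral_lin => //.
    apply: measurableT_comp => //; apply/measurable_EFinP; apply: measurable_in_fun.
    exact: (smeasurable_comp cg mX).
  apply: filterE => w; rewrite -!EFinM -EFinD lee_fin.
  rewrite -[g (X T w)](subrK (g 0)); apply: le_trans (ler_normD _ _) _.
  have := gC (X T w) 0; rewrite subr0 => h.
  apply: le_trans (lerD h (lexx _)) _; rewrite mulr1.
  have h2 : `|X T w| <= 1 + `|X T w| ^+ 2.
    have := sqr_ge0 (`|X T w| - 1); have := sqr_ge0 `|X T w|; lra.
  have := ler_wpM2l Cg0 h2; have := mulr_ge0 (normr_ge0 (g 0)) (sqr_ge0 `|X T w|).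
  rewrite /K; lra.
apply: (EFin_lin_lty K0 K0 _ fX).
rewrite (_ : integral _ _ _ = 1 * P setT)%E; last exact: integral_cst.
by rewrite probability_setT mule1 ltry.
Unshelve. all: by end_near. Qed.

Lemma cost_integrable X a : square_integrable_pair X a ->
  P.-integrable setT (fun w =>
    (\int[mu]_(s in `[t, T]) (l (X s w) (a s w))%:E) + (g (X T w))%:E)%E.
Proof.
move=> hX; apply: integrableD => //; last exact: terminal_cost_integrable hX.
apply: (inner_integrable (f := fun s w => l (X s w) (a s w))).
  exact: measurable_running_cost.
exact: running_cost_dint_lty.
Qed.

Lemma cost_fin_num X a : square_integrable_pair X a ->
  cost P l g t T a X \is a fin_num.
Proof. by move=> hX; apply: integrable_fin_num => //; exact: cost_integrable. Qed.

(** [N] is the combination of [X] and [Y] up to a null set depending on the time. Convexity of [l]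
    is thus used at almost every time of almost every path, and convexity of [g] at [T], which has a
    null set of its own. *)
Lemma cost_convex_le (k : R) X Y N a c :
  0 <= k <= 1 ->
  convex_function [set z : H * Lambda | Lambda0 z.2] (fun z : H * Lambda => l z.1 z.2) ->
  convex_function [set: H] g ->
  square_integrable_pair X a -> square_integrable_pair Y c ->
  square_integrable_pair N (fun s w => k *: a s w + (1 - k) *: c s w) ->
  (forall s, t <= s <= T ->
    (\int[P]_w (`|-1 *: (k *: X s w + (1 - k) *: Y s w) + N s w| ^+ 2)%:E = 0)%E) ->
  (cost P l g t T (fun s w => k *: a s w + (1 - k) *: c s w)%R N
    <= k%:E * cost P l g t T a X + (1 - k)%:E * cost P l g t T c Y)%E.
Proof.
move=> k01 cl cg hX hY hN eq0; have /andP[k0 k1] := k01.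
have iX := cost_integrable hX; have iY := cost_integrable hY; have iN := cost_integrable hN.
rewrite /cost -(integralZl measurableT iX k) -(integralZl measurableT iY (1 - k)).
have jX := integrableZl measurableT k iX; have jY := integrableZl measurableT (1 - k) iY.
rewrite -integralD //; apply: ae_le_integral => //; first exact: integrableD.
pose Z s w := -1 *: (k *: X s w + (1 - k) *: Y s w) + N s w.
have pZ : progressive t T F Z.
  case: hX hY hN => pX _ _ _ _ [pY _ _ _ _] [pN _ _ _ _].
  by apply: progressive_lin => //; exact: progressive_conv.
have mZ := measurable_sqr_norm complP hW tT (lexx T) pZ.
have Z0 r w : (0 <= (`|Z r w| ^+ 2)%:E)%E by rewrite lee_fin sqr_ge0.
have ZE r w : (`|Z r w| ^+ 2)%:E = 0%E -> N r w = k *: X r w + (1 - k) *: Y r w.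
  move=> [] /eqP; rewrite sqrf_eq0 normr_eq0 /Z scaleN1r addrC subr_eq0.
  by move=> /eqP.
have ZT : {ae P, forall w, setT w -> (`|Z T w| ^+ 2)%:E = 0%E}.
  apply: ge0_integral_eq0_ae => //; last by apply: eq0; rewrite tT lexx.
  by apply: (measurable_section (F := fun r w => (`|Z r w| ^+ 2)%:E) mZ); rewrite tT lexx.
(* Exchanging the integrals turns vanishing second moments at all times into a vanishing time
   integral on almost every path. *)
have Zin : {ae P, forall w, setT w -> (\int[mu]_(r in `[t, T]) (`|Z r w| ^+ 2)%:E = 0)%E}.
  apply: ge0_integral_eq0_ae => //.
  - exact: (measurable_inner Z0 mZ).
  - by move=> w _; exact: integral_ge0.
  - rewrite (dint_swap P Z0 mZ) integral0_eq // => r /=; rewrite in_itv /=; exact: eq0.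
have pi (X' : R -> Omega -> H) a' : square_integrable_pair X' a' ->
    {ae P, forall w, mu.-integrable `[t, T] (fun r => (l (X' r w) (a' r w))%:E)}.
  move=> h; apply: (path_integrable_ae (f := fun r w => l (X' r w) (a' r w))).
    exact: measurable_running_cost.
  exact: running_cost_dint_lty.
apply: filterS3 (filterI (pi _ _ hX) (pi _ _ hY)) (filterI (pi _ _ hN) ZT) Zin.
move=> w [lX lY] [lN /(_ I) /ZE eT] /(_ I) ein _.
have mI : measurable (`[t, T]%classic : set R) by exact: measurable_itv.
have jlX := integrableZl (mu := mu) mI k lX; have jlY := integrableZl (mu := mu) mI (1 - k) lY.
have le1 : (\int[mu]_(r in `[t, T]) (l (N r w) (k *: a r w + (1 - k) *: c r w))%:E <=
   k%:E * \int[mu]_(r in `[t, T]) (l (X r w) (a r w))%:E +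
   (1 - k)%:E * \int[mu]_(r in `[t, T]) (l (Y r w) (c r w))%:E)%E.
  rewrite -(integralZl (mu := mu) mI lX k) -(integralZl (mu := mu) mI lY (1 - k)) -integralD //.
  apply: ae_le_integral => //; first exact: integrableD.
  have mZw := measurable_path (F := fun r w => (`|Z r w| ^+ 2)%:E) mZ w.
  have ae0 := ge0_integral_eq0_ae (mu := mu) mI mZw (fun r _ => Z0 r w) ein.
  apply: filterS ae0 => r /[swap] Tr /(_ Tr) /ZE ->.
  rewrite -!EFinM -EFinD lee_fin.
  move: Tr; rewrite /= in_itv /= => trT.
  case: hX hY => _ _ La _ _ [_ _ Lc _ _].
  exact: (convex_functionP (x := (X r w, a r w)) (y := (Y r w, c r w)) cl k01
    (La _ _ trT) (Lc _ _ trT)).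
have [fX fY] := (integrable_fin_num (mu := mu) mI lX, integrable_fin_num (mu := mu) mI lY).
rewrite eT; move: le1; rewrite -(fineK fX) -(fineK fY) => le1.
have le2 := convex_functionP (x := X T w) (y := Y T w) cg k01 I I.
rewrite -lee_fin in le2; apply: le_trans (leeD le1 le2) _.
set u := fine _; set v := fine _.
by rewrite -(EFinD u) -(EFinD v) -!EFinM -!EFinD lee_fin !mulrDr addrACA.
Qed.

End Cost.

(** * Infima of extended reals and convexity of the value function *)

Lemma ereal_inf_lin_ge (R : realType) (A : set (\bar R)) (k x y : R) : 0 < k ->
  (forall v, A v -> x%:E <= y%:E + k%:E * v)%E ->
  (x%:E <= y%:E + k%:E * ereal_inf A)%E.
Proof.
move=> k0 h.
have : (((x - y) / k)%:E <= ereal_inf A)%E.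
  apply: le_ereal_inf_tmp => v /h; case: v => [v| |].
  - by rewrite -EFinM -EFinD !lee_fin ler_pdivrMr // lerBlDl mulrC.
  - by rewrite leey.
  - by rewrite gt0_muleNy ?lte_fin // addeNy.
case: (ereal_inf A) => [v| |].
- by rewrite -EFinM -EFinD !lee_fin ler_pdivrMr // lerBlDl mulrC.
- by move=> _; rewrite gt0_muley ?lte_fin // addey // leey.
- by [].
Qed.

(** The infima are taken one at a time. For real [x] the infimum of [B] cannot be minus infinity,
    since [x] lies below its combination with a finite element of [A]; being real, it can be held
    fixed while the infimum of [A] is taken. *)
Lemma ereal_inf_conv_ge (R : realType) (A B : set (\bar R)) (k : R) (x : \bar R) :
  0 < k < 1 -> (forall u, A u -> u \is a fin_num) ->
  (forall v, B v -> v \is a fin_num) -> A !=set0 -> B !=set0 ->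
  (forall u v, A u -> B v -> x <= k%:E * u + (1 - k)%:E * v)%E ->
  (x <= k%:E * ereal_inf A + (1 - k)%:E * ereal_inf B)%E.
Proof.
move=> /andP[k0 k1] fA fB [u0 Au0] [v0 Bv0] h.
have k1' : 0 < 1 - k by rewrite subr_gt0.
case: x h => [x| |] h; last by rewrite leNye.
- have h1 u : A u -> (x%:E <= k%:E * u + (1 - k)%:E * ereal_inf B)%E.
    move=> Au; rewrite -(fineK (fA _ Au)) -EFinM; apply: ereal_inf_lin_ge => // v Bv.
    by rewrite EFinM fineK ?fA //; exact: h.
  have iB : ereal_inf B \is a fin_num.
    have : (ereal_inf B <= v0)%E by exact: ereal_inf_lbound.
    have := h1 _ Au0; have := fA _ Au0; have := fB _ Bv0.
    case: (ereal_inf B) => [r| |] //.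
      by move=> fv _ _; rewrite leye_eq => /eqP v0oo; rewrite v0oo in fv.
    by rewrite gt0_muleNy ?lte_fin // addeNy.
  rewrite addeC -(fineK iB) -EFinM; apply: ereal_inf_lin_ge => // u Au.
  by rewrite EFinM fineK // addeC; exact: h1.
- have := h _ _ Au0 Bv0; have := fA _ Au0; have := fB _ Bv0.
  by case: u0 {Au0} => // u; case: v0 {Bv0} => // v _ _; rewrite -!EFinM -EFinD.
Qed.

Theorem theorem5p14 (R : realType)
  (H Xi Lambda : completeNormedModType R)
  (ip : {dot H for (@idfun R)}) (ipXi : {dot Xi for (@idfun R)})
  (hH : norm_from_dot ip) (hXi : norm_from_dot ipXi)
  (sepH : separable H) (sepXi : separable Xi) (sepL : separable Lambda)
  (E : set Xi) (hE : orthonormal_basis ipXi E)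
  (Lambda0 : set Lambda) (convL : convex_set Lambda0)
  (p T : R) (hp : 2 < p) (hT : 0 < T)
  (DA : set H) (A : H -> H)
  (linA : linear_on DA A) (densA : dense DA)
  (dissA : maximal_dissipative ip DA A)
  (S : R -> {linear H -> H})
  (hS : contraction_semigroup S) (genS : generates DA A S)
  (b : H -> Lambda -> H) (sigma : H -> Lambda -> Xi -> H)
  (l : H -> Lambda -> R) (g : H -> R)
  (* AsB is the operator A^* B *)
  (B AsB : {linear H -> H}) (c0 : R)
  (contB : continuous B) (saB : self_adjoint ip B)
  (posB : strictly_positive ip B)
  (contAsB : continuous AsB)
  (hAsB : forall y, adjoint_at ip DA A (B y) (AsB y))
  (hc0 : 0 <= c0)
  (weakB : nonneg_operator ip (fun x => - AsB x + c0 *: B x))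
  (Hm1 : completeNormedModType R) (iota : {linear H -> Hm1})
  (hHm1 : is_completion_m1 ip B iota)
  (lcont : {within [set z : H * Lambda | Lambda0 z.2],
              continuous (fun z : H * Lambda => l z.1 z.2)})
  (lgbound : exists C : R,
    [/\ 0 < C,
        forall x x' a, Lambda0 a ->
          `|l x a - l x' a| <= C * normm1 ip B (x - x'),
        forall x a, Lambda0 a -> `|l x a| <= C * (1 + `|x| + `|a| ^+ 2)
      & forall x x', `|g x - g x'| <= C * normm1 ip B (x - x')])
  (lgbelow : ~ bounded_set Lambda0 ->
    exists M : R, (forall x a, Lambda0 a -> M <= l x a) /\
                  (forall x, M <= g x))
  (baff : exists bt : Hm1 * Lambda -> H,
    [/\ affine bt, continuous bt & forall x a, b x a = bt (iota x, a)])
  (saff : exists st : Hm1 * Lambda -> Xi -> H,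
    [/\ forall z, hilbert_schmidt E (st z),
        forall xi, affine (fun z => st z xi),
        HS_continuous E st
      & forall x a, sigma x a = st (iota x, a)])
  (lconv : convex_function [set z : H * Lambda | Lambda0 z.2]
             (fun z : H * Lambda => l z.1 z.2))
  (gconv : convex_function [set: H] g)
  (t : R) (ht : 0 <= t <= T)
  (d : measure_display) (Omega : measurableType d) (P : probability Omega R)
  (complP : measure_is_complete P)
  (W : R -> Xi -> Omega -> R)
  (hW : cylindrical_wiener P W t T)
  (* X x a is the mild solution X(.; t, x, a) *)
  (X : H -> (R -> Omega -> Lambda) -> R -> Omega -> H)
  (hX : forall x a, admissible P W p t T Lambda0 a ->
    mild_solution P ipXi W E S b sigma t T x a (X x a)) :
  ereal_convex (value P W p t T Lambda0 l g X).
Proof.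
have /andP[_ tT] := ht.
have contrS s z : 0 <= s -> `|S s z| <= `|z| by case: hS => _ _ _; apply.
have [KB KB0 normB] := normm1_le hH contB.
have iotaC z : `|iota z| <= KB * `|z| by case: hHm1 => -> _.
have [Cl [Cl0 _ lgrow gL]] := lgbound.
have [bt [abt cbt bE]] := baff; have [st [hsst ast cst sE]] := saff.
have [Kb Kb0 bL] := drift_lipschitz KB0 iotaC abt cbt.
have [Mb Mb0 bG] := drift_growth KB0 iotaC abt cbt.
have [Ks Ks0 sL] := diffusion_lipschitz hXi sepXi hE KB0 iotaC ast cst.
have [Ms Ms0 sG] := diffusion_growth hXi sepXi hE KB0 iotaC hsst ast cst.
have gL' z z' : `|g z - g z'| <= (Cl * KB) * `|z - z'|.
  by apply: le_trans (gL z z') _; rewrite -mulrA ler_wpM2l // ltW.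
have pair z a : admissible P W p t T Lambda0 a ->
    square_integrable_pair P W t T Lambda0 (X z a) a.
  move=> adma; have mX := hX z a adma.
  have fa := admissible_sqr_lty complP tT hW hp adma.
  case: (adma) (mX) => pa La _ [pX _ fX _].
  have TT : t <= T <= T by rewrite tT lexx.
  split; [exact: pX|exact: pa|exact: La|exact: (dint_growth_lty complP tT hW TT pX pa fX fa)|].
  (* [Mb + Ms] is a common growth constant for drift and diffusion. *)
  have bM x l' : `|b x l'| ^+ 2 <= (Mb + Ms) * (1 + `|x| ^+ 2 + `|l'| ^+ 2).
    rewrite bE; apply: le_trans (bG _ _) _.
    by rewrite ler_wpM2r ?lerDl // !addr_ge0 // sqr_ge0.
  have sM x l' : (HS_norm2 E (sigma x l') <= ((Mb + Ms) * (1 + `|x| ^+ 2 + `|l'| ^+ 2))%:E)%E.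
    rewrite sE; apply: le_trans (sG _ _) _.
    by rewrite lee_fin ler_wpM2r ?lerDr // !addr_ge0 // sqr_ge0.
  exact: (mild_solution_moment complP hXi hH sepXi sepH hE tT hW contrS
    (addr_ge0 Mb0 Ms0) bM sM pa fa mX TT).
move=> x y k k01.
(* At the end points both sides coincide, as [0 * v = 0] even for infinite [v]; in between, both
   weights are positive and can be divided out. *)
have [->|k0] := eqVneq k 0.
  by rewrite scale0r add0r subr0 scale1r mul0e add0e mul1e.
have [->|k1] := eqVneq k 1.
  by rewrite scale1r subrr scale0r addr0 mul0e adde0 mul1e.
have k01' : 0 < k < 1 by case/andP: k01 => k0' k1'; rewrite !lt_neqAle eq_sym k0 k1 k0' k1'.
have costV := cost_fin_num complP sepH sepL tT hW lcont (ltW Cl0) (mulr_ge0 (ltW Cl0) KB0)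
  lgrow gL'.
(* Without admissible controls every value is the infimum of the empty set, and both sides are plus
   infinity. *)
have [[a0 adm0]|nadm] := pselect (exists a, admissible P W p t T Lambda0 a); last first.
  have V0 z : value P W p t T Lambda0 l g X z = +oo%E.
    rewrite /value (_ : [set _ | _ in _] = set0) ?ereal_inf0 //.
    by apply/seteqP; split=> // u [a adma _]; case: nadm; exists a.
  have /andP[kp k1p] := k01'.
  by rewrite !V0 !gt0_muley ?lte_fin ?subr_gt0.
have fin z u : [set cost P l g t T a (X z a) | a in admissible P W p t T Lambda0] u ->
  u \is a fin_num by move=> [a adma <-]; exact: costV (pair z a adma).
have ne z : [set cost P l g t T a (X z a) | a in admissible P W p t T Lambda0] !=set0.
  by exists (cost P l g t T a0 (X z a0)); exists a0.
apply: ereal_inf_conv_ge => //; [exact: fin|exact: fin|].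
move=> _ _ [a adma <-] [c admc <-].
have admk := admissible_convex complP sepL tT hW hp convL k01 adma admc.
(* The infimum at the averaged point is tested with the averaged control and the solution that [X]
   assigns to it; uniqueness then relates this solution to the average of the two given ones. *)
apply: (@le_trans _ _ (cost P l g t T (fun s w => k *: a s w + (1 - k) *: c s w)
    (X (k *: x + (1 - k) *: y) (fun s w => k *: a s w + (1 - k) *: c s w)))).
  by apply: ereal_inf_lbound; exists (fun s w => k *: a s w + (1 - k) *: c s w).
apply: (cost_convex_le complP sepH sepL tT hW lcont (ltW Cl0) (mulr_ge0 (ltW Cl0) KB0)
  lgrow gL' k01 lconv gconv (pair x a adma) (pair y c admc) (pair _ _ admk)).
have mk : mild_solution P ipXi W E S b sigma t T (k *: x + (1 - k) *: y)
    (fun s w => k *: a s w + (1 - k) *: c s w)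
    (fun s w => k *: X x a s w + (1 - k) *: X y c s w).
  apply: (mild_solution_convex complP hXi sepXi sepH hE tT hW _ _ (hX x a adma) (hX y c admc)).
    by move=> u v m n; rewrite !bE affine_pair.
  by move=> u v m n xi; rewrite !sE (affine_pair iota (ast xi)).
have bL' u v m : `|b u m - b v m| <= Kb * `|u - v| by rewrite !bE.
have sL' u v m : (HS_norm2 E (fun xi => (sigma u m xi - sigma v m xi)%R)
    <= (Ks * `|u - v| ^+ 2)%:E)%E by rewrite !sE.
exact: (mild_solution_unique complP hXi hH sepXi sepH hE tT hW contrS Kb0 Ks0 bL' sL'
  (hX _ _ admk) mk).
Qed.
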